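(* Consider a sequence of random graphs $(G_n)_{n\ge1}$ distributed according to the two-community configuration model (see context), with $N=N_n\to\infty$, satisfying assumptions (A1)-(A5) of the context. If $\alpha\ll\frac1{\log N}$ or $\alpha\asymp\frac1{\log N}$, then for $i\in\{0,1\}$, for all $x\in\mathcal H_i$ and for all $0<\varepsilon<\frac{N_{1-i}}{N}$, there exist $a,b>0$ depending only on $\varepsilon$ and $N_i/N$ such that $$\frac{a+o_{\mathbb P}(1)}{\alpha}\ \le\ t_{\mathrm{mix}}^{(x)}(\varepsilon)\ \le\ \frac{b+o_{\mathbb P}(1)}{\alpha},$$ and there is no cutoff.
   Context: Model. A finite vertex set $V$ is partitioned into two non-empty communities $V_0,V_1$, with a fixed degree sequence $\mathbf d:V\to\{2,3,\dots\}$ such that $N_0=\sum_{v\in V_0}\mathbf d(v)$ and $N_1=\sum_{v\in V_1}\mathbf d(v)$ are both even; $N=N_0+N_1$. Each vertex $v$ carries $\mathbf d(v)$ half-edges; $\mathcal H_i$ is the set of half-edges attached to vertices of $V_i$, and $\mathcal H=\mathcal H_0\cup\mathcal H_1$. Let $p$ be an even integer with $2\le p\le\min\{N_0,N_1\}$. Independently for $i=0,1$, choose uniformly at random $p$ distinct half-edges of $\mathcal H_i$, called outgoing; the other half-edges are called internal. Choose independently a uniform pairing of the internal half-edges of $\mathcal H_0$, a uniform pairing of the internal half-edges of $\mathcal H_1$, and a uniform matching between the outgoing half-edges of $\mathcal H_0$ and those of $\mathcal H_1$. Let $\eta$ be the resulting pairing (fixed-point-free involution) on $\mathcal H$; it induces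 a random (multi)graph $G$ on $V$, with an edge between the endpoints of $x$ and $\eta(x)$. Put $\alpha_0=p/N_0$, $\alpha_1=p/N_1$, $\alpha=\alpha_0+\alpha_1$. Walk. Two half-edges are neighbors if they are distinct and attached to the same vertex; $\deg(x)$ is the number of neighbors of $x$, i.e. $\deg(x)=\mathbf d(u)-1$ if $x$ is attached to $u$. The non-backtracking random walk (NBRW) is the Markov chain on $\mathcal H$ with $P(x,y)=1/\deg(\eta(x))$ if $y$ and $\eta(x)$ are neighbors, and $P(x,y)=0$ otherwise. Its stationary law is uniform on $\mathcal H$. Set $\mathcal D_x(t)=\sum_{y\in\mathcal H}\left(\frac1N-P^t(x,y)\right)_+$, $\mathcal D(t)=\max_{x\in\mathcal H}\mathcal D_x(t)$, $t_{\mathrm{mix}}^{(x)}(\varepsilon)=\inf\{t\ge0:\mathcal D_x(t)<\varepsilon\}$ and $t_{\mathrm{mix}}(\varepsilon)=\inf\{t\ge0:\mathcal D(t)<\varepsilon\}$ (random variables depending on the graph). The sequence exhibits cutoff if for all $\varepsilon\in(0,1)$, $t_{\mathrm{mix}}(\varepsilon)\sim t_{\mathrm{mix}}(1-\varepsilon)$ as $n\to\infty$ (the ratio tends to $1$, in probability). Parameters. $\mu=\frac1N\sum_{x\in\mathcal H}\log\deg(x)$ and $\sigma^2=\frac1N\sum_{x\in\mathcal H}(\log\deg(x)-\mu)^2$. Regime. All quantities ($V_0,V_1,\mathbf d,p,N,x,\dots$) depend on $n$, which is omitted; limits are as $n\to\infty$; $a\ll b$ means $a/b\to0$; $a\asymp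 b$ means $a/b$ is bounded away from $0$ and $\infty$; $o_{\mathbb P}(1)$ denotes a random sequence tending to $0$ in probability. Assumptions: (A1) $\alpha_0+\alpha_1\le1$; (A2) $N_0\asymp N_1\asymp N$; (A3) $\liminf\sigma^2>0$; (A4) $\min_{v\in V}\mathbf d(v)\ge3$; (A5) $\Delta=\max_{v\in V}\mathbf d(v)=O(1)$.
   Formalization: The constant b may depend, besides ε and N_i/N, on limsup α log N (which is 0 when α ≪ 1/log N); with α ~ C/log N, C arbitrary, no b depending only on ε and N_i/N can exist. The o_P(1) terms may be infinite on events of vanishing probability. *)

(* Defs.v *)
From HB Require Import structures.
From mathcomp Require Import all_boot all_order all_fingroup all_algebra.
From mathcomp Require Import all_classical all_reals all_analysis.

Set Implicit Arguments.
Unset Strict Implicit.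
Unset Printing Implicit Defensive.

Import Order.TTheory GRing.Theory Num.Theory.
Import numFieldNormedType.Exports.

Local Open Scope classical_set_scope.
Local Open Scope ring_scope.

(* Communities are indexed by [bool]: [false] is community 0, [true] is
   community 1, and [~~ i] is the community other than [i].                  *)
Record two_community := TwoCommunity {
  vertex : finType;
  community : vertex -> bool;
  degree : vertex -> nat;
  noutgoing : nat;
  community_nonempty : forall i : bool, exists v, community v = i;
  degree_ge2 : forall v, (2 <= degree v)%N;
  community_even :
    forall i : bool, ~~ odd (\sum_(v | community v == i) degree v);
  noutgoing_even : ~~ odd noutgoing;
  noutgoing_ge2 : (2 <= noutgoing)%N;
  noutgoing_le :
    forall i : bool, (noutgoing <= \sum_(v | community v == i) degree v)%N
}.

Definition half_edge (M : two_community) : finType :=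
  {v : vertex M & 'I_(degree v)}.

Definition half_edges_in (M : two_community) (i : bool) : {set half_edge M} :=
  [set x | community (tag x) == i]%SET.

(* The integers N_i and N. *)
Definition nhalf_in (M : two_community) (i : bool) : nat :=
  (\sum_(v : vertex M | community v == i) degree v)%N.

Definition nhalf (M : two_community) : nat :=
  (nhalf_in M false + nhalf_in M true)%N.

Definition max_degree (M : two_community) : nat :=
  (\max_(v : vertex M) degree v)%N.

Section RandomPairing.

(* Pairings of the elements of A, encoded as the involutions of the ambient
   type whose set of moved points is exactly A.                              *)
Definition pairings (T : finType) (A : {set T}) : {set {perm T}} :=
  [set s : {perm T} |
    [forall x, (s (s x) == x) && ((s x != x) == (x \in A))]]%SET.

(* Perfect matchings between A and B (used for disjoint A, B of equal size). *)
Definition matchings (T : finType) (A B : {set T}) : {set {perm T}} :=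
  [set s in pairings (A :|: B) | [forall x in A, s x \in B]]%SET.

Definition outgoing_sets (M : two_community) (i : bool) :
    {set {set half_edge M}} :=
  [set O : {set half_edge M} |
    (O \subset half_edges_in M i) && (#|O| == noutgoing M)]%SET.

Definition average (R : realType) (T : finType) (A : {set T}) (F : T -> R) : R :=
  (\sum_(x in A) F x) / #|A|%:R.

(* Probability that the random pairing eta belongs to E. The permutations s0,
   s1 and m have disjoint supports which cover all half-edges, so their product
   is the pairing that restricts to each of them.                            *)
Definition prob (R : realType) (M : two_community)
    (E : pred {perm half_edge M}) : R :=
  average (outgoing_sets M false) (fun O0 =>
  average (outgoing_sets M true) (fun O1 =>
  average (pairings (half_edges_in M false :\: O0)%SET) (fun s0 =>
  average (pairings (half_edges_in M true :\: O1)%SET) (fun s1 =>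
  average (matchings O0 O1) (fun m => (E (s0 * s1 * m)%g)%:R))))).

End RandomPairing.

Section Walk.
Variables (R : realType) (M : two_community).

Definition neighbors (x y : half_edge M) : bool :=
  (x != y) && (tag x == tag y).

Definition hdeg (x : half_edge M) : nat := #|[set y | neighbors x y]%SET|.

Variable eta : {perm half_edge M}.

Definition nbrw (x y : half_edge M) : R :=
  if neighbors y (eta x) then (hdeg (eta x))%:R^-1 else 0.

Fixpoint nbrw_iter (t : nat) (x y : half_edge M) : R :=
  if t is s.+1 then \sum_z nbrw x z * nbrw_iter s z y else (x == y)%:R.

Definition dist_from (x : half_edge M) (t : nat) : R :=
  \sum_y Num.max 0 ((nhalf M)%:R^-1 - nbrw_iter t x y).

Definition dist (t : nat) : R :=
  \big[Num.max/0]_(x : half_edge M) dist_from x t.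

(* Mixing times are extended reals: the infimum is +oo when the level eps is
   never reached (for instance on a disconnected graph).                     *)
Definition tmix_from (x : half_edge M) (eps : R) : \bar R :=
  ereal_inf [set (t%:R : R)%:E | t in [set t : nat | dist_from x t < eps]].

Definition tmix (eps : R) : \bar R :=
  ereal_inf [set (t%:R : R)%:E | t in [set t : nat | dist t < eps]].

End Walk.

Section ModelQuantities.
Variables (R : realType) (M : two_community).

Definition alpha_in (i : bool) : R := (noutgoing M)%:R / (nhalf_in M i)%:R.

Definition alpha : R := alpha_in false + alpha_in true.

Definition mu : R :=
  (nhalf M)%:R^-1 * \sum_(x : half_edge M) ln (hdeg x)%:R.

Definition sigma2 : R :=
  (nhalf M)%:R^-1 * \sum_(x : half_edge M) (ln (hdeg x)%:R - mu) ^+ 2.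

End ModelQuantities.

Section Asymptotics.
Variable R : realType.

Definition much_less (a b : nat -> R) : Prop :=
  (a n / b n) @[n --> \oo] --> (0 : R).

Definition same_order (a b : nat -> R) : Prop :=
  exists c C : R, [/\ 0 < c, 0 < C & \forall n \near \oo, c <= a n / b n <= C].

(* Values in [\bar R], so that an o_P(1) term may be infinite on events of
   vanishing probability (where the mixing time may be infinite).            *)
Definition oP1 (M : nat -> two_community)
    (xi : forall n, {perm half_edge (M n)} -> \bar R) : Prop :=
  forall delta : R, 0 < delta ->
    prob R (fun eta => (delta%:E < `|xi n eta|)%E) @[n --> \oo] --> (0 : R).

(* Library convention: +oo / +oo = 0, so where both mixing times are infinite
   the ratio does not count as close to 1.                                   *)
Definition cutoff (M : nat -> two_community) : Prop :=
  forall eps : R, 0 < eps < 1 ->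
    oP1 (M := M) (fun n eta => (tmix eta eps / tmix eta (1 - eps) - 1)%E).

End Asymptotics.

(* Main.v *)
Require Import Defs.
From HB Require Import structures.
From mathcomp Require Import all_boot all_order all_fingroup all_algebra.
From mathcomp Require Import all_classical all_reals all_analysis.
From mathcomp Require Import ring lra zify.

Set Implicit Arguments.
Unset Strict Implicit.
Unset Printing Implicit Defensive.

Import Order.TTheory GRing.Theory Num.Theory.
Import numFieldNormedType.Exports.

Local Open Scope classical_set_scope.
Local Open Scope ring_scope.

(* At scale [ln N] the walk mixes inside each community: with high probability every
   set of at most half a community expands and the graph is far from bipartite, so two
   steps contract the fluctuations inside the communities, and after O(ln N) steps the
   law of the walk is at most a constant multiple of the uniform law. What remains is a
   two-state chain whose jump rate is of order alpha. Since alpha ln N stays bounded,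
   this chain is at least as slow as the inner mixing. It governs the decay of the
   distance, hence the upper bound, and there is no cutoff: after O(ln N) steps the
   distance is bounded away from 1, while at twice that time it is still bounded away
   from 0. For the lower bound from a given half-edge, the probability of crossing
   within O(ln N) steps concentrates around its small mean (two annealed walks from the
   same half-edge decouple after they separate), and later crossings are controlled by
   the flatness of the law of the walk. *)

(** * Euclidean inner product and norm on a finite set *)

Section SquareNorm.
Variables (R : realType) (H : finType).
Implicit Types f g h : H -> R.

(** The walk is not reversible, so its powers are not controlled by a spectrum. It is, however, the
    composition of the involution [eta] with a self-adjoint average inside vertices, and contraction
    is measured in Euclidean norm by what the averaging destroys. That average fixes the functions
    constant on vertices; only a second step sees how [eta] joins the vertices. The splitting along
    [chi], the normalised contrast between the communities, is not invariant: the leakage between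
    [chi] and its complement has size sqrt(alpha), while the slow rate is alpha. The square of the
    leakage thus competes with the rate. For the upper bound the steps are grouped in blocks of a
    fixed length J: this multiplies the rate by J, whereas the leakage over a block stays below a
    multiple of sqrt(alpha) that is independent of J. Finally, the constants must be fixed before
    the sequence of graphs is given. Every estimate therefore concerns a single graph, with
    thresholds on alpha and ln N in place of large n. *)

Definition ip f g : R := \sum_x f x * g x.
Definition sqn f : R := ip f f.
Definition nrm f : R := Num.sqrt (sqn f).

Lemma ipC f g : ip f g = ip g f.
Proof. by apply: eq_bigr => x _; rewrite mulrC. Qed.

Lemma ipDl f g h : ip (fun x => f x + g x) h = ip f h + ip g h.
Proof. by rewrite -big_split; apply: eq_bigr => x _; rewrite /= mulrDl. Qed.

Lemma ipDr f g h : ip h (fun x => f x + g x) = ip h f + ip h g.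
Proof. by rewrite ipC ipDl ipC [ip g h]ipC. Qed.

Lemma ipZl (a : R) f h : ip (fun x => a * f x) h = a * ip f h.
Proof. by rewrite mulr_sumr; apply: eq_bigr => x _; rewrite mulrA. Qed.

Lemma ipZr (a : R) f h : ip h (fun x => a * f x) = a * ip h f.
Proof. by rewrite ipC ipZl ipC. Qed.

Lemma ipBl f g h : ip (fun x => f x - g x) h = ip f h - ip g h.
Proof. by rewrite -sumrB; apply: eq_bigr => x _; rewrite /= mulrBl. Qed.

Lemma ipBr f g h : ip h (fun x => f x - g x) = ip h f - ip h g.
Proof. by rewrite ipC ipBl ipC [ip g h]ipC. Qed.

Lemma eq_ip f f' g g' : f =1 f' -> g =1 g' -> ip f g = ip f' g'.
Proof. by move=> ef eg; apply: eq_bigr => x _; rewrite ef eg. Qed.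

Lemma sqnE f : sqn f = \sum_x f x ^+ 2.
Proof. by apply: eq_bigr => x _; rewrite expr2. Qed.

Lemma eq_sqn f g : f =1 g -> sqn f = sqn g.
Proof. by move=> e; apply: eq_ip. Qed.

Lemma sqn_ge0 f : 0 <= sqn f.
Proof. by rewrite sqnE sumr_ge0 // => x _; apply: sqr_ge0. Qed.

Lemma sqnD f g : sqn (fun x => f x + g x) = sqn f + 2 * ip f g + sqn g.
Proof. by rewrite /sqn ipDl !ipDr [ip g f]ipC; ring. Qed.

Lemma sqnB f g : sqn (fun x => f x - g x) = sqn f - 2 * ip f g + sqn g.
Proof. by rewrite /sqn ipBl !ipBr [ip g f]ipC; ring. Qed.

Lemma sqnZ (a : R) f : sqn (fun x => a * f x) = a ^+ 2 * sqn f.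
Proof. by rewrite /sqn ipZl ipZr expr2 mulrA. Qed.

Lemma ler_sqn f g : (forall x, `|f x| <= `|g x|) -> sqn f <= sqn g.
Proof.
move=> h; rewrite !sqnE ler_sum // => x _.
by rewrite -[f x ^+ 2]real_normK ?num_real // -[g x ^+ 2]real_normK ?num_real // lerXn2r ?nnegrE.
Qed.

Lemma cauchy_schwarz f g : ip f g ^+ 2 <= sqn f * sqn g.
Proof.
have [g0|g0] := eqVneq (sqn g) 0.
  suff -> : ip f g = 0 by rewrite g0 expr0n mulr0.
  have gz x : g x = 0.
    apply/eqP; rewrite -sqrf_eq0; move/eqP: g0; rewrite sqnE psumr_eq0.
      by move/allP/(_ x); rewrite mem_index_enum => /(_ isT).
    by move=> y _; apply: sqr_ge0.
  by rewrite /ip big1 // => x _; rewrite gz mulr0.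
have gp : 0 < sqn g by rewrite lt_def g0 sqn_ge0.
have := sqn_ge0 (fun x => sqn g * f x - ip f g * g x).
rewrite sqnB !sqnZ ipZl ipZr => h.
have : 0 <= sqn g * (sqn f * sqn g - ip f g ^+ 2) by lra.
by rewrite pmulr_rge0 // subr_ge0.
Qed.

Lemma nrm_ge0 f : 0 <= nrm f. Proof. exact: sqrtr_ge0. Qed.

Lemma nrmK f : nrm f ^+ 2 = sqn f.
Proof. by rewrite sqr_sqrtr // sqn_ge0. Qed.

Lemma ler_nrm f g : (nrm f <= nrm g) = (sqn f <= sqn g).
Proof. by rewrite ler_sqrt // sqn_ge0. Qed.

Lemma eq_nrm f g : f =1 g -> nrm f = nrm g.
Proof. by move=> e; rewrite /nrm (eq_sqn e). Qed.

Lemma nrm_le f (a : R) : 0 <= a -> sqn f <= a ^+ 2 -> nrm f <= a.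
Proof. by move=> a0 h; rewrite -(ler_pXn2r (n := 2)) ?nnegrE ?nrm_ge0 // nrmK. Qed.

Lemma ip_le_nrm f g : `|ip f g| <= nrm f * nrm g.
Proof.
rewrite -(ler_pXn2r (n := 2)) ?nnegrE ?mulr_ge0 ?nrm_ge0 //.
by rewrite exprMn !nrmK real_normK ?num_real // cauchy_schwarz.
Qed.

Lemma nrmD f g : nrm (fun x => f x + g x) <= nrm f + nrm g.
Proof.
apply: nrm_le; first by rewrite addr_ge0 ?nrm_ge0.
rewrite sqnD sqrrD !nrmK; have := ip_le_nrm f g; have := ler_norm (ip f g); lra.
Qed.

Lemma nrmZ (a : R) f : nrm (fun x => a * f x) = `|a| * nrm f.
Proof. by rewrite /nrm sqnZ sqrtrM ?sqr_ge0 // sqrtr_sqr. Qed.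

Lemma nrmN f : nrm (fun x => - f x) = nrm f.
Proof. by rewrite (@eq_nrm _ (fun x => -1 * f x)) ?nrmZ ?normrN1 ?mul1r// => x; rewrite mulN1r. Qed.

Lemma nrmB f g : nrm (fun x => f x - g x) <= nrm f + nrm g.
Proof. by rewrite -[nrm g]nrmN; apply: nrmD. Qed.

Lemma sum_norm_le_nrm f : \sum_x `|f x| <= Num.sqrt #|H|%:R * nrm f.
Proof.
have := ip_le_nrm (fun=> 1) (fun x => `|f x|).
rewrite /ip (eq_bigr (fun x => `|f x|)); last by move=> x _; rewrite mul1r.
rewrite ger0_norm ?sumr_ge0 // => /le_trans; apply.
rewrite /nrm sqnE (eq_bigr (fun=> 1)) ?sumr_const; last by move=> x _; rewrite expr1n.
rewrite ler_wpM2l ?sqrtr_ge0 // ler_sqrt ?sqn_ge0 //.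
by rewrite ler_sqn // => x; rewrite normr_id.
Qed.

End SquareNorm.

(** * Orthogonal projection onto functions constant on vertices *)

Section VertexAverage.
Variables (R : realType) (M : two_community).
Local Notation H := (half_edge M).
Implicit Types f g h : H -> R.

Lemma sum_fiber (A : nmodType) (v : vertex M) (F : H -> A) :
  \sum_(y : H | tag y == v) F y = \sum_(i < degree v) F (Tagged _ i).
Proof.
rewrite -(big_pred1_eq (+%R) v (fun v => \sum_(i < degree v) F (Tagged _ i))).
rewrite (@sig_big_dep _ _ _ _ _ (pred1 v) (fun _ _ => true) (fun v i => F (Tagged (fun v => 'I_(degree v)) i))) /=.
by apply: eq_big => [x|[x y]] //=; rewrite andbT.
Qed.

Lemma card_fiber (v : vertex M) : #|[set y : H | tag y == v]%SET| = degree v.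
Proof.
rewrite cardsE -sum1_card (eq_bigl (fun y : H => tag y == v)) //.
by rewrite sum_fiber sum_nat_const card_ord muln1.
Qed.

Definition avg f (x : H) : R := (\sum_(y : H | tag y == tag x) f y) / (degree (tag x))%:R.

Definition vconst g := forall x y : H, tag x = tag y -> g x = g y.

Lemma avg_vconst f : vconst (avg f).
Proof. by move=> x y e; rewrite /avg e. Qed.

Lemma degree_gt0 (v : vertex M) : (0 < degree v)%N.
Proof. exact: ltnW (degree_ge2 v). Qed.

(** This makes [avg] the orthogonal projection onto the functions constant on vertices, and [fluct]
    below the squared distance to that space. *)
Lemma ip_avg f g : vconst f -> ip f (avg g) = ip f g.
Proof.
move=> fc; rewrite /ip (eq_bigr (fun x => \sum_(y : H | tag y == tag x) (degree (tag y))%:R^-1 * (f y * g y))).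
  rewrite (exchange_big_dep predT) //=; apply: eq_bigr => y _.
  rewrite sumr_const.
  have -> : #|[pred i : H | tag y == tag i]| = degree (tag y).
    by rewrite -card_fiber cardsE; apply: eq_card => x; rewrite !inE eq_sym.
  rewrite -[(_ * _) *+ _]mulr_natr mulrAC mulVf ?mul1r // pnatr_eq0 -lt0n degree_gt0 //.
move=> x _; rewrite /avg mulrA mulrC mulr_sumr mulr_sumr; apply: eq_bigr => y /eqP e.
by rewrite (fc x y) e.
Qed.

Lemma avg_id g : vconst g -> avg g =1 g.
Proof.
move=> gc x; rewrite /avg (eq_bigr (fun=> g x)); last by move=> y /eqP/gc.
rewrite sumr_const -cardsE card_fiber -[g x *+ _]mulr_natr mulfK //.
by rewrite pnatr_eq0 -lt0n degree_gt0.
Qed.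

Definition fluct f : R := sqn f - sqn (avg f).

Lemma ip_avgl f g : ip (avg f) (avg g) = ip (avg f) g.
Proof. exact: ip_avg (avg_vconst f). Qed.

Lemma fluctE f : fluct f = sqn (fun x => f x - avg f x).
Proof.
rewrite sqnB /fluct {2}/sqn; have := ip_avgl f f; rewrite [ip (avg f) f]ipC /sqn => ->; ring.
Qed.

Lemma fluct_ge0 f : 0 <= fluct f.
Proof. by rewrite fluctE sqn_ge0. Qed.

Lemma fluct_min f c : vconst c -> fluct f <= sqn (fun x => f x - c x).
Proof.
move=> cc; have := sqn_ge0 (fun x => avg f x - c x).
have := ip_avg f cc; rewrite ipC => e1.
rewrite sqnB e1 [ip c f]ipC [sqn (fun x => f x - c x)]sqnB /fluct.
by move=> h; lra.
Qed.

Lemma avgB f g : avg (fun x => f x - g x) =1 (fun x => avg f x - avg g x).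
Proof. by move=> x; rewrite /avg sumrB mulrBl. Qed.

Lemma fluctB_le f g : fluct f <= 2 * fluct g + 2 * fluct (fun x => f x - g x).
Proof.
rewrite !fluctE; set a := (fun x => g x - avg g x).
set b := (fun x => f x - g x - _).
rewrite (@eq_sqn _ _ _ (fun x => a x + b x)); last first.
  by move=> x; rewrite /a /b avgB; lra.
have := sqn_ge0 (fun x => a x - b x); rewrite sqnB sqnD; lra.
Qed.

Lemma fluct_le_sqn f : fluct f <= sqn f.
Proof. by rewrite /fluct; have := sqn_ge0 (avg f); lra. Qed.

End VertexAverage.

(** * The walk operator and its time reversal *)

Section WalkOperator.
Variables (R : realType) (M : two_community) (eta : {perm half_edge M}).
Hypothesis degree_ge3 : forall v : vertex M, (3 <= degree v)%N.
Hypothesis etaK : forall x, eta (eta x) = x.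
Local Notation H := (half_edge M).
Implicit Types f g h : H -> R.

Definition step f (x : H) : R := \sum_y nbrw R eta x y * f y.

Definition kern f (x : H) : R := (\sum_(y | neighbors y x) f y) / (hdeg x)%:R.

Lemma hdegE (x : H) : hdeg x = (degree (tag x)).-1.
Proof.
rewrite -(card_fiber (tag x)) (cardsD1 x) inE eqxx add1n /=.
by apply: eq_card => y; rewrite !inE /neighbors eq_sym [tag y == _]eq_sym.
Qed.

Lemma hdeg_ge2 (x : H) : (2 <= hdeg x)%N.
Proof. by rewrite hdegE -ltnS prednK ?degree_gt0. Qed.

Lemma hdeg_gt0 (x : H) : 0 < (hdeg x)%:R :> R.
Proof. by rewrite ltr0n (leq_trans _ (hdeg_ge2 x)). Qed.

Lemma stepE f x : step f x = kern f (eta x).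
Proof.
rewrite /step /kern mulr_suml [RHS]big_mkcond; apply: eq_bigr => y _.
by rewrite /nbrw; case: ifP => _; rewrite ?mul0r // mulrC.
Qed.

(** At one vertex of degree d, averaging over the other half-edges acts as 1 on constants and as
    -1/(d-1) on mean-zero functions. With d at least 3 the second eigenvalue is at most 1/2 in
    absolute value, the source of the constants 1/4 and 3/4 below. *)
Lemma kernE f x : kern f x = avg f x - (hdeg x)%:R^-1 * (f x - avg f x).
Proof.
have hd := hdeg_gt0 x.
have d1 : (degree (tag x))%:R = (hdeg x)%:R + 1 :> R.
  by rewrite hdegE natr1 prednK ?degree_gt0.
have e : \sum_(y | neighbors y x) f y = (degree (tag x))%:R * avg f x - f x.
  rewrite /avg mulrC divfK ?pnatr_eq0 -?lt0n ?degree_gt0 //.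
  rewrite [X in _ = X - _](bigD1 x) //= addrC addrK.
  by apply: eq_bigl => y; rewrite /neighbors andbC.
rewrite /kern e d1; field; exact: lt0r_neq0.
Qed.

Lemma eq_kern f g : f =1 g -> kern f =1 kern g.
Proof. by move=> e x; rewrite /kern (eq_bigr g). Qed.

Lemma eq_step f g : f =1 g -> step f =1 step g.
Proof. by move=> e x; rewrite !stepE; apply: eq_kern. Qed.

Lemma kern_cst (a : R) x : kern (fun=> a) x = a.
Proof.
rewrite kernE avg_id; first by rewrite subrr mulr0 subr0.
by [].
Qed.

Lemma step_cst (a : R) x : step (fun=> a) x = a.
Proof. by rewrite stepE kern_cst. Qed.

Lemma vconst_hdeg : vconst (fun x : H => (hdeg x)%:R^-1 : R).
Proof. by move=> x y e; rewrite !hdegE e. Qed.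

Lemma ip_eta f g : ip (fun x => f (eta x)) g = ip f (fun x => g (eta x)).
Proof.
rewrite /ip (reindex_inj (@perm_inj _ eta)); apply: eq_bigr => x _ /=.
by rewrite etaK.
Qed.

Lemma sqn_eta f : sqn (fun x => f (eta x)) = sqn f.
Proof. by rewrite /sqn ip_eta; apply: eq_ip => // x; rewrite etaK. Qed.

Lemma sum_eta f : \sum_x f (eta x) = \sum_x f x.
Proof. by rewrite [RHS](reindex_inj (@perm_inj _ eta)). Qed.

(** By [kernE] the operator is built from the projection [avg] and the multiplication by 1/hdeg,
    which commute because 1/hdeg is constant on vertices. *)
Lemma kern_sa f g : ip (kern f) g = ip f (kern g).
Proof.
have e (u w : H -> R) : ip (kern u) w =
    ip (avg u) (avg w) - ip (fun x => (hdeg x)%:R^-1 * w x) u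
    + ip (fun x => (hdeg x)%:R^-1 * avg u x) (avg w).
  rewrite (eq_ip (kernE u) (fun=> erefl)) ipBl ip_avgl.
  have -> : ip (fun x => (hdeg x)%:R^-1 * (u x - avg u x)) w =
      ip (fun x => (hdeg x)%:R^-1 * w x) u - ip (fun x => (hdeg x)%:R^-1 * avg u x) w.
    by rewrite /ip -sumrB; apply: eq_bigr => x _; ring.
  rewrite (@ip_avg _ _ (fun x => (hdeg x)%:R^-1 * avg u x) w); first by ring.
  by move=> x y exy; rewrite (vconst_hdeg exy) (avg_vconst u exy).
rewrite e [RHS]ipC e [ip (avg f) _]ipC; congr (_ - _ + _).
  by apply: eq_bigr => x _; ring.
by apply: eq_bigr => x _; ring.
Qed.

Lemma sum_kern f : \sum_x kern f x = \sum_x f x.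
Proof.
have := kern_sa f (fun=> 1); rewrite /ip.
under eq_bigr do rewrite mulr1.
by under [in X in _ = X -> _]eq_bigr do rewrite kern_cst mulr1.
Qed.

Lemma sum_step f : \sum_x step f x = \sum_x f x.
Proof. by rewrite (eq_bigr _ (fun x _ => stepE f x)) sum_eta sum_kern. Qed.

Lemma stepD f g x : step (fun x => f x + g x) x = step f x + step g x.
Proof. by rewrite /step -big_split; apply: eq_bigr => y _; rewrite /= mulrDr. Qed.

Lemma stepZ (a : R) f x : step (fun x => a * f x) x = a * step f x.
Proof. by rewrite /step mulr_sumr; apply: eq_bigr => y _; rewrite mulrCA. Qed.

Lemma nbrw_ge0 (x y : H) : 0 <= nbrw R eta x y.
Proof. by rewrite /nbrw; case: ifP => // _; rewrite invr_ge0. Qed.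

Lemma ler_step f g x : (forall y, f y <= g y) -> step f x <= step g x.
Proof. by move=> h; apply: ler_sum => y _; rewrite ler_wpM2l ?nbrw_ge0. Qed.

Lemma step_ge0 f x : (forall y, 0 <= f y) -> 0 <= step f x.
Proof. by move=> h; apply: sumr_ge0 => y _; rewrite mulr_ge0 ?nbrw_ge0. Qed.

Lemma sqn_kern f : sqn (kern f) <= sqn f - 3 / 4 * fluct f.
Proof.
rewrite (eq_sqn (kernE f)) sqnB.
(* The cross term vanishes: a function constant on vertices is orthogonal to a fluctuation. *)
have -> : ip (avg f) (fun x => (hdeg x)%:R^-1 * (f x - avg f x)) = 0.
  have -> : ip (avg f) (fun x => (hdeg x)%:R^-1 * (f x - avg f x)) =
     ip (fun x => (hdeg x)%:R^-1 * avg f x) (fun x => f x - avg f x).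
    by apply: eq_bigr => x _; ring.
  rewrite ipBr ip_avg ?subrr // => x y exy.
  by rewrite (vconst_hdeg exy) (avg_vconst f exy).
have : sqn (fun x => (hdeg x)%:R^-1 * (f x - avg f x)) <= 1 / 4 * fluct f.
  rewrite fluctE !sqnE mulr_sumr ler_sum // => x _; rewrite exprMn ler_wpM2r ?sqr_ge0 //.
  have : (hdeg x)%:R^-1 <= 2^-1 :> R.
    by rewrite lef_pV2 ?posrE ?hdeg_gt0 ?ltr0n // ler_nat hdeg_ge2.
  have : 0 <= (hdeg x)%:R^-1 :> R by rewrite invr_ge0.
  by nra.
rewrite /fluct; lra.
Qed.

Lemma sqn_avg_kern f : sqn (fun x => kern f x - avg f x) <= 1 / 4 * fluct f.
Proof.
rewrite (@eq_sqn _ _ _ (fun x => - ((hdeg x)%:R^-1 * (f x - avg f x)))); last first.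
  by move=> x; rewrite kernE; ring.
rewrite fluctE !sqnE mulr_sumr ler_sum // => x _; rewrite sqrrN exprMn ler_wpM2r ?sqr_ge0 //.
have : (hdeg x)%:R^-1 <= 2^-1 :> R.
  by rewrite lef_pV2 ?posrE ?hdeg_gt0 ?ltr0n // ler_nat hdeg_ge2.
have : 0 <= (hdeg x)%:R^-1 :> R by rewrite invr_ge0.
by nra.
Qed.

Lemma sqn_step f : sqn (step f) = sqn (kern f).
Proof. by rewrite (eq_sqn (stepE f)) sqn_eta. Qed.

Lemma sqn_step_le f : sqn (step f) <= sqn f.
Proof. rewrite sqn_step; have := sqn_kern f; have := fluct_ge0 f; lra. Qed.

(* One step only averages inside vertices. A second step detects that the
   vertex averages of f are not constant along the neighbouring pairs. *)
Lemma sqn_step2 f : sqn (step (step f)) <=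
  sqn f - 3 / 8 * (fluct f + fluct (fun x => avg f (eta x))).
Proof.
rewrite sqn_step; have h1 := sqn_kern (step f).
have h2 := sqn_kern f; rewrite -sqn_step in h2.
have h3 := fluctB_le (fun x => avg f (eta x)) (step f).
have h4 := fluct_le_sqn (fun x => avg f (eta x) - step f x).
have h5 := sqn_avg_kern f.
have e : sqn (fun x => avg f (eta x) - step f x) = sqn (fun x => kern f x - avg f x).
  rewrite -(sqn_eta (fun x => kern f x - avg f x)) !sqnE; apply: eq_bigr => x _.
  by rewrite stepE; ring.
rewrite e in h4; have := fluct_ge0 f; lra.
Qed.

Definition stepn t f := iter t step f.

Lemma eq_stepn t f g : f =1 g -> stepn t f =1 stepn t g.
Proof. by move=> e; elim: t => //= t IH; apply: eq_step. Qed.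

Lemma stepnD t s f : stepn (t + s) f = stepn t (stepn s f).
Proof. exact: iterD. Qed.

Lemma stepn_add t f g : stepn t (fun x => f x + g x) =1 fun x => stepn t f x + stepn t g x.
Proof. by elim: t => //= t IH x; rewrite (eq_step IH) stepD. Qed.

Lemma stepn_scale t (a : R) f : stepn t (fun x => a * f x) =1 fun x => a * stepn t f x.
Proof. by elim: t => //= t IH x; rewrite (eq_step IH) stepZ. Qed.

Lemma stepn_cst t (a : R) : stepn t (fun=> a) =1 fun=> a.
Proof. by elim: t => //= t IH x; rewrite (eq_step IH) step_cst. Qed.

Lemma ler_stepn t f g x : (forall y, f y <= g y) -> stepn t f x <= stepn t g x.
Proof. by move=> h; elim: t x => //= t IH x; apply: ler_step. Qed.

Lemma stepn_ge0 t f x : (forall y, 0 <= f y) -> 0 <= stepn t f x.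
Proof. by move=> h; elim: t x => //= t IH x; apply: step_ge0. Qed.

Lemma sum_stepn t f : \sum_x stepn t f x = \sum_x f x.
Proof. by elim: t => //= t IH; rewrite sum_step. Qed.

Lemma sqn_stepn_le t f : sqn (stepn t f) <= sqn f.
Proof. by elim: t => //= t IH; apply: le_trans (sqn_step_le _) IH. Qed.

Lemma nrm_stepn_le t f : nrm (stepn t f) <= nrm f.
Proof. by rewrite ler_nrm sqn_stepn_le. Qed.

Lemma nbrw_iterE t x y : nbrw_iter R eta t x y = stepn t (fun z => (z == y)%:R) x.
Proof. by elim: t x => //= t IH x; apply: eq_bigr => z _; rewrite IH. Qed.

Lemma stepn_nbrw_iter t f x : stepn t f x = \sum_y nbrw_iter R eta t x y * f y.
Proof.
elim: t x => /= [x|t IH x].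
  by rewrite (bigD1 x) //= eqxx mul1r big1 ?addr0 // => y; rewrite eq_sym => /negPf->; rewrite mul0r.
rewrite {1}/step (eq_bigr (fun z => \sum_y nbrw R eta x z * nbrw_iter R eta t z y * f y)).
  by rewrite exchange_big; apply: eq_bigr => y _; rewrite mulr_suml.
by move=> z _; rewrite IH mulr_sumr; apply: eq_bigr => y _; rewrite mulrA.
Qed.

Lemma nbrw_iter_ge0 t x y : 0 <= nbrw_iter R eta t x y.
Proof. by rewrite nbrw_iterE stepn_ge0. Qed.

Lemma nbrw_iterD t s x y :
  nbrw_iter R eta (t + s) x y = \sum_z nbrw_iter R eta t x z * nbrw_iter R eta s z y.
Proof.
rewrite nbrw_iterE stepnD stepn_nbrw_iter.
by apply: eq_bigr => z _; rewrite -nbrw_iterE.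
Qed.

Lemma sum_nbrw_iter t x : \sum_y nbrw_iter R eta t x y = 1.
Proof.
rewrite -(@stepn_cst t 1 x) stepn_nbrw_iter.
by apply: eq_bigr => y _; rewrite mulr1.
Qed.

(** Reversing a path and moving each of its half-edges by [eta] preserves its probability. This
    symmetry stands in for reversibility. *)
Lemma nbrw_rev x y : nbrw R eta x y = nbrw R eta (eta y) (eta x).
Proof.
rewrite /nbrw etaK /neighbors eq_sym [tag y == _]eq_sym.
by case: ifP => // /andP[_ /eqP e]; rewrite !hdegE e.
Qed.

Lemma nbrw_iter_rev t x y : nbrw_iter R eta t x y = nbrw_iter R eta t (eta y) (eta x).
Proof.
elim: t x y => [x y|t IH x y] /=; first by rewrite (inj_eq perm_inj) eq_sym.
rewrite -[RHS]/(nbrw_iter R eta t.+1 (eta y) (eta x)) -addn1 nbrw_iterD.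
rewrite -(sum_eta (fun z => nbrw_iter R eta t (eta y) z * _)).
apply: eq_bigr => z _; rewrite mulrC IH nbrw_rev; congr (_ * _).
rewrite /= (bigD1 (eta x)) //= eqxx mulr1 big1 ?addr0 // => w /negPf->.
by rewrite mulr0.
Qed.

End WalkOperator.

(** * Co-area formula, Cheeger inequality and its dual *)

Section Isoperimetry.
Variables (R : realType) (M : two_community) (eta : {perm half_edge M}).
Hypothesis etaK : forall x, eta (eta x) = x.
Local Notation H := (half_edge M).
Local Notation V := (vertex M).

Definition halves (S : {set V}) : {set H} := [set x : H | tag x \in S]%SET.

(* With [sigma = pred0] the left-hand sum is the co-area formula for G; the
   predicate [sigma] marks edges which are not allowed to join vertices of the
   same level set. *)
Lemma coarea (sigma : pred H) (phi : R) (G : V -> R) :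
  (forall v, 0 <= G v) ->
  (forall tau, 0 <= tau -> phi * #|halves [set v | tau < G v]%SET|%:R <=
     #|[set x : H | (tau < G (tag x)) && (~~ (tau < G (tag (eta x))) || sigma x)]%SET|%:R) ->
  phi * (\sum_(x : H) G (tag x)) <=
  \sum_(x : H) if sigma x then G (tag x) else Num.max 0 (G (tag x) - G (tag (eta x))).
Proof.
move: {2}(#|_|)%N (leqnn #|[set v | 0 < G v]%SET|) => n.
elim: n G => [|n IH] G cG G0 hG.
  have z v : G v = 0.
    move: cG; rewrite leqn0 cards_eq0 => /eqP/setP/(_ v); rewrite !inE lt_def G0 andbT.
    by move/negbFE/eqP.
  rewrite big1 ?mulr0; last by move=> x _; rewrite z.
  by rewrite big1 // => x _; rewrite !z subrr maxxx; case: ifP.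
have [S0|] := eqVneq [set v | 0 < G v]%SET finset.set0.
  by apply: IH; rewrite ?S0 ?cards0.
case/set0Pn=> v0; rewrite inE => v0p.
(* The lowest positive value is peeled off: both sides lose the contribution of the level set where
   [G] is positive, and the minimiser leaves the support. *)
case: (@Order.TotalTheory.arg_minP _ _ _ v0 (fun v => 0 < G v) G v0p) => m mp mmin.
set g := G m.
pose G' v := if 0 < G v then G v - g else 0.
have GE v : G v = G' v + (0 < G v)%R%:R * g.
  rewrite /G'; case: ifP => h; first by rewrite mul1r subrK.
  by rewrite mul0r addr0; apply/eqP; rewrite eq_le G0 andbT leNgt h.
have G'0 v : 0 <= G' v by rewrite /G'; case: ifP => // h; rewrite subr_ge0 mmin.
have lev tau v : 0 <= tau -> (tau < G' v) = (tau + g < G v).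
  move=> t0; rewrite /G'; case: ifP => h; first by rewrite ltrBrDr.
  rewrite !ltNge t0 /=; symmetry; apply/negbTE; rewrite negbK.
  apply: le_trans (_ : 0 <= _); last by rewrite addr_ge0 // ltW.
  by rewrite leNgt h.
have IH' : phi * (\sum_(x : H) G' (tag x)) <=
  \sum_(x : H) if sigma x then G' (tag x) else Num.max 0 (G' (tag x) - G' (tag (eta x))).
  apply: IH => //.
    rewrite -ltnS (leq_trans _ cG) // proper_card //; apply/properP; split.
      apply/fintype.subsetP => v; rewrite !inE lev // add0r; apply: le_lt_trans.
      exact: ltW.
    by exists m; rewrite !inE // /G' mp subrr ltxx.
  move=> tau t0; have := hG (tau + g) (addr_ge0 t0 (ltW mp)).
  have -> : [set v | tau < G' v]%SET = [set v | tau + g < G v]%SET.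
    by apply/setP => v; rewrite !inE lev.
  set A := [set x : H | _ ]%SET; set B := [set x : H | _ ]%SET.
  suff -> : A = B by [].
  by apply/setP => x; rewrite !inE !lev.
have h0 := hG 0 (lexx 0).
pose S0 := [set x : H | (0 < G (tag x)) && (~~ (0 < G (tag (eta x))) || sigma x)]%SET.
have -> : \sum_(x : H) G (tag x) = \sum_(x : H) G' (tag x) + #|halves [set v | 0 < G v]%SET|%:R * g.
  rewrite (eq_bigr _ (fun x _ => GE (tag x))) big_split /=; congr (_ + _).
  rewrite -mulr_suml; congr (_ * _); rewrite -sum1_card natr_sum [RHS]big_mkcond.
  by apply: eq_bigr => x _; rewrite !inE; case: (0 < _).
have -> : \sum_(x : H) (if sigma x then G (tag x) else Num.max 0 (G (tag x) - G (tag (eta x))))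
  = \sum_(x : H) (if sigma x then G' (tag x) else Num.max 0 (G' (tag x) - G' (tag (eta x))))
    + #|S0|%:R * g.
  rewrite -sum1_card natr_sum [X in _ + X * _]big_mkcond mulr_suml -big_split; apply: eq_bigr => x _ /=.
  have z v : (0 < G v) = false -> G v = 0.
    by move=> h; apply/eqP; rewrite eq_le G0 andbT leNgt h.
  have gx := mmin (tag x); have gy := mmin (tag (eta x)).
  rewrite !inE /G'; case hx: (0 < G (tag x)) gx => gx; last rewrite (z _ hx);
    case hy: (0 < G (tag (eta x))) gy => gy; try rewrite (z _ hy);
    case: (sigma x) => /=; rewrite ?subr0 ?mul0r ?mul1r ?addr0 ?subrK //.
  - by congr Num.max; ring.
  - by rewrite !max_r ?subr_ge0 ?subrK ?gx // ltW.
  - by rewrite !max_l // sub0r oppr_le0 ?subr_ge0 ?gy // ltW.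
rewrite mulrDr lerD // mulrA ler_wpM2r // ltW //.
Qed.

(** The quadratic half of both Cheeger arguments. Here [lay] is the co-area integrand of F^2; summed
    over the two ends of an edge it factors into the difference (or the sum) [u] of the two values
    times [w], the sum of their absolute values. *)
Lemma level_cauchy_schwarz (phi s : R) (lay u w : H -> R) :
  0 <= phi -> 0 <= s -> phi * s <= \sum_x lay x ->
  (forall x, lay x + lay (eta x) <= u x * w x) -> sqn w <= 4 * s ->
  phi ^+ 2 * s <= sqn u.
Proof.
move=> p0 s0 h1 h2 h3.
have h4 : 2 * (phi * s) <= ip u w.
  apply: (@le_trans _ _ (\sum_x (lay x + lay (eta x)))); last exact: ler_sum.
  rewrite big_split /= (sum_eta eta lay); lra.
have h5 := cauchy_schwarz u w.
have [->|sp] := eqVneq s 0; first by rewrite mulr0 sqn_ge0.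
have sp' : 0 < s by rewrite lt_def sp.
have h6 : (2 * (phi * s)) ^+ 2 <= ip u w ^+ 2.
  by rewrite lerXn2r ?nnegrE // ?mulr_ge0 // (le_trans _ h4) // !mulr_ge0.
have h7 : sqn u * sqn w <= sqn u * (4 * s) by rewrite ler_wpM2l ?sqn_ge0.
have : (phi ^+ 2 * s) * (4 * s) <= sqn u * (4 * s).
  by apply: le_trans (le_trans h5 h7); apply: le_trans h6; rewrite le_eqVlt; apply/orP; left; apply/eqP; ring.
by rewrite ler_pM2r // mulr_gt0.
Qed.

Lemma sqn_sum_pair (F : H -> R) :
  sqn (fun x => `|F x| + `|F (eta x)|) <= 4 * sqn F.
Proof.
apply: (@le_trans _ _ (\sum_x (2 * F x ^+ 2 + 2 * F (eta x) ^+ 2))).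
  rewrite sqnE ler_sum // => x _.
  rewrite -[F x ^+ 2]real_normK ?num_real // -[F (eta x) ^+ 2]real_normK ?num_real //.
  have := sqr_ge0 (`|F x| - `|F (eta x)|); nra.
rewrite big_split /= (sum_eta eta (fun x => 2 * F x ^+ 2)).
by rewrite -!mulr_sumr -sqnE; lra.
Qed.

Lemma cheeger (phi : R) (F : V -> R) : 0 <= phi -> (forall v, 0 <= F v) ->
  (forall tau, 0 <= tau -> phi * #|halves [set v | tau < F v]%SET|%:R <=
     #|[set x : H | (tau < F (tag x)) && ~~ (tau < F (tag (eta x)))]%SET|%:R) ->
  phi ^+ 2 * sqn (fun x : H => F (tag x)) <=
  sqn (fun x => F (tag x) - F (tag (eta x))).
Proof.
move=> p0 F0 hF.
have lev tau v : 0 <= tau -> (tau < F v ^+ 2) = (Num.sqrt tau < F v).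
  by move=> t0; rewrite -{1}(sqr_sqrtr t0) ltr_pXn2r ?nnegrE ?sqrtr_ge0.
have h : phi * (\sum_(x : H) F (tag x) ^+ 2) <=
    \sum_(x : H) Num.max 0 (F (tag x) ^+ 2 - F (tag (eta x)) ^+ 2).
  apply: (@coarea pred0 phi (fun v => F v ^+ 2)) => [v|tau t0]; first exact: sqr_ge0.
  have := hF _ (sqrtr_ge0 tau).
  have -> : [set v | tau < F v ^+ 2]%SET = [set v | Num.sqrt tau < F v]%SET.
    by apply/setP => v; rewrite !inE lev.
  by move/le_trans; apply; rewrite ler_nat subset_leq_card //;
    apply/fintype.subsetP => x; rewrite !inE !lev // orbF.
have e : sqn (fun x => F (tag x) - F (tag (eta x))) = sqn (fun x => `|F (tag x) - F (tag (eta x))|).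
  by rewrite !sqnE; apply: eq_bigr => x _; rewrite real_normK ?num_real.
rewrite e; apply: (level_cauchy_schwarz p0 (sqn_ge0 _) _ _ (sqn_sum_pair (fun x => F (tag x)))).
  by rewrite sqnE; exact: h.
move=> x /=; rewrite etaK; set a := F (tag x); set b := F (tag (eta x)).
have a0 : 0 <= a := F0 _; have b0 : 0 <= b := F0 _.
rewrite (ger0_norm a0) (ger0_norm b0).
have : `|a ^+ 2 - b ^+ 2| = `|a - b| * (a + b).
  by rewrite subr_sqr normrM [`|a + b|]ger0_norm ?addr_ge0.
by case: (lerP 0 (a ^+ 2 - b ^+ 2)) => h1; case: (lerP 0 (b ^+ 2 - a ^+ 2)) => h2 <-;
  rewrite ?(max_r h1) ?(max_r h2) ?(max_l (ltW h1)) ?(max_l (ltW h2));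
  rewrite ?(ger0_norm h1) ?(ltr0_norm h1); lra.
Qed.

(** The predicate of [coarea] marks the edges on which F keeps a strict sign: there F^2 counts in
    full and the two values do not cancel. On the other edges the sum of the values is, up to sign,
    the difference of their absolute values. *)
Lemma dual_cheeger (beta : R) (F : V -> R) : 0 <= beta ->
  (forall tau, 0 <= tau -> beta * #|halves [set v | tau < F v ^+ 2]%SET|%:R <=
     #|[set x : H | (tau < F (tag x) ^+ 2) &&
        (~~ (tau < F (tag (eta x)) ^+ 2) || (0 < F (tag x) * F (tag (eta x))))]%SET|%:R) ->
  beta ^+ 2 * sqn (fun x : H => F (tag x)) <=
  sqn (fun x => F (tag x) + F (tag (eta x))).
Proof.
move=> p0 hF.
have h := @coarea (fun x => 0 < F (tag x) * F (tag (eta x))) beta (fun v => F v ^+ 2)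
  (fun v => sqr_ge0 _) hF.
have e : sqn (fun x => F (tag x) + F (tag (eta x))) = sqn (fun x => `|F (tag x) + F (tag (eta x))|).
  by rewrite !sqnE; apply: eq_bigr => x _; rewrite real_normK ?num_real.
rewrite e; apply: (level_cauchy_schwarz p0 (sqn_ge0 _) _ _ (sqn_sum_pair (fun x => F (tag x)))).
  by rewrite sqnE; exact: h.
move=> x /=; rewrite etaK; set a := F (tag x); set b := F (tag (eta x)).
rewrite [b * a]mulrC; case: ifP => ab.
  have -> : `|a| + `|b| = `|a + b|.
    case: (lerP 0 a) => a0; case: (lerP 0 b) => b0.
    - by rewrite !ger0_norm ?addr_ge0.
    - by move: ab; rewrite ltNge mulr_ge0_le0 // ltW.
    - by move: ab; rewrite ltNge mulr_le0_ge0 // ltW.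
    - by rewrite !ler0_norm ?opprD // ?ltW // -[0](addr0 0) ltrD.
  by rewrite -expr2 real_normK ?num_real // sqrrD; lra.
have : `|a ^+ 2 - b ^+ 2| <= `|a + b| * (`|a| + `|b|).
  by rewrite subr_sqr normrM mulrC ler_wpM2l // ler_normB.
by case: (lerP 0 (a ^+ 2 - b ^+ 2)) => h1; case: (lerP 0 (b ^+ 2 - a ^+ 2)) => h2;
  rewrite ?(max_r h1) ?(max_r h2) ?(max_l (ltW h1)) ?(max_l (ltW h2));
  rewrite ?(ger0_norm h1) ?(ltr0_norm h1); lra.
Qed.

End Isoperimetry.

(** * From expansion of sets to functions constant on vertices *)

Section Expansion.
Variables (R : realType) (M : two_community) (eta : {perm half_edge M}).
Hypothesis degree_ge3 : forall v : vertex M, (3 <= degree v)%N.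
Hypothesis etaK : forall x, eta (eta x) = x.
Local Notation H := (half_edge M).
Local Notation V := (vertex M).
Implicit Types f g h u : H -> R.

(** Sets are tested only if they fill at most half of each community, since a whole community may
    have very few edges leaving it. *)
Definition expander (phi : R) := forall S : {set V},
  (forall i, (2 * #|halves S :&: half_edges_in M i|%SET <= nhalf_in M i)%N) ->
  phi * #|halves S|%:R <= #|[set x : H | (tag x \in S) && (tag (eta x) \notin S)]%SET|%:R.

(** [L] splits [U] into two classes; the half-edges counted leave [U] or join a class to itself. A
    bipartite component, split along its classes, would have none. *)
Definition non_bipartite (beta : R) := forall U L : {set V},
  beta * #|halves U|%:R <=
  #|[set x : H | (tag x \in U) &&
     ((tag (eta x) \notin U) || ((tag x \in L) == (tag (eta x) \in L)))]%SET|%:R.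

Definition crossing : {set H} :=
  [set x : H | community (tag (eta x)) != community (tag x)]%SET.

Definition rep (v : V) : H := Tagged (fun v => 'I_(degree v)) (Ordinal (degree_gt0 v)).

Lemma vconst_rep g x : vconst g -> g (rep (tag x)) = g x.
Proof. by move=> gc; apply: gc. Qed.

Lemma half_edges_inE i (x : H) : (x \in half_edges_in M i) = (community (tag x) == i).
Proof. by rewrite inE. Qed.

Lemma card_half_edges_in i : #|half_edges_in M i| = nhalf_in M i.
Proof.
rewrite -sum1_card /nhalf_in.
rewrite (eq_bigl (fun x : H => community (tag x) == i)); last by move=> x; rewrite inE.
rewrite (partition_big (fun x : H => tag x) (fun v => community v == i)) //=.
apply: eq_bigr => v /eqP vi; rewrite -[RHS](card_fiber v) -sum1_card.
by apply: eq_bigl => x; rewrite inE andb_idl // => /eqP ->; rewrite vi.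
Qed.

Lemma card_half_edge : #|H| = nhalf M.
Proof.
rewrite /nhalf -!card_half_edges_in -cardsT.
rewrite -(cardsID (half_edges_in M false) [set: H]%SET) finset.setTI; congr (_ + _)%N.
by apply: eq_card => x; rewrite !inE andbT; case: (community _).
Qed.

Lemma sum_community (F : H -> R) :
  \sum_x F x = \sum_(x in half_edges_in M false) F x + \sum_(x in half_edges_in M true) F x.
Proof.
rewrite (bigID (mem (half_edges_in M false))) /=; congr (_ + _).
by apply: eq_bigl => x; rewrite !inE; case: (community _).
Qed.

Lemma dual_gap beta g : 0 <= beta -> non_bipartite beta -> vconst g ->
  beta ^+ 2 * sqn g <= sqn (fun x => g x + g (eta x)).
Proof.
move=> b0 nb gc; pose F v := g (rep v).
have Fg x : F (tag x) = g x by apply: vconst_rep.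
rewrite -(eq_sqn Fg) -(@eq_sqn _ _ (fun x => F (tag x) + F (tag (eta x))) (fun x => g x + g (eta x))); last first.
  by move=> x; rewrite !Fg.
apply: dual_cheeger => // tau t0.
have := nb [set v | tau < F v ^+ 2]%SET [set v | 0 < F v]%SET.
move=> /le_trans; apply; rewrite ler_nat subset_leq_card //.
apply/fintype.subsetP => x; rewrite !inE => /andP[h1]; rewrite h1 /=.
case: (ltP tau (F (tag (eta x)) ^+ 2)) => //= h2 /eqP h3.
have nz (a : R) : tau < a ^+ 2 -> a != 0.
  by apply: contraTneq => ->; rewrite expr0n /= -leNgt.
have := nz _ h1; have := nz _ h2; rewrite !neq_lt.
move: h3; case: (ltrP 0 (F (tag x))) => h4; case: (ltrP 0 (F (tag (eta x)))) => h5 // _.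
  by move=> _ _; apply: mulr_gt0.
by rewrite !orbF => h6 h7; rewrite nmulr_rgt0.
Qed.

Lemma cheeger_half phi g : 0 <= phi -> expander phi -> vconst g -> (forall x, 0 <= g x) ->
  (forall i, (2 * #|[set x in half_edges_in M i | (0 < g x)%R]%SET| <= nhalf_in M i)%N) ->
  phi ^+ 2 * sqn g <= sqn (fun x => g x - g (eta x)).
Proof.
move=> p0 ex gc g0 hg; pose F v := g (rep v).
have Fg x : F (tag x) = g x by apply: vconst_rep.
rewrite -(eq_sqn Fg) -(@eq_sqn _ _ (fun x => F (tag x) - F (tag (eta x))) (fun x => g x - g (eta x))); last first.
  by move=> x; rewrite !Fg.
apply: cheeger => // [v|tau t0]; first exact: g0.
have := ex [set v | tau < F v]%SET; have -> : [set x : H | (tag x \in [set v | tau < F v]%SET)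
  && (tag (eta x) \notin [set v | tau < F v]%SET)]%SET =
  [set x : H | (tau < F (tag x)) && ~~ (tau < F (tag (eta x)))]%SET.
  by apply/setP => x; rewrite !inE.
apply=> i; apply: leq_trans (hg i); rewrite leq_mul2l /= subset_leq_card //.
apply/fintype.subsetP => x; rewrite !inE Fg => /andP[h ->] /=.
exact: le_lt_trans h.
Qed.

(* With Q the simple random walk operator, [q = Q g] and [w = (I - Q) g], this is
   [w (I + Q) w <= 2 (|g|^2 - |Q g|^2)]; it holds because [I - Q >= 0]. *)
Lemma fluct_eta_ge b g : vconst g ->
  (let w := fun x => g x - avg (fun y => g (eta y)) x in
   b * sqn w <= sqn (fun x => w x + w (eta x))) ->
  b * sqn (fun x => g x - avg (fun y => g (eta y)) x) <= 4 * fluct (fun x => g (eta x)).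
Proof.
move=> gc /=; set q := avg _; move/le_trans; apply.
have qc : vconst q by apply: avg_vconst.
pose ge := fun x => g (eta x); pose qe := fun x => q (eta x).
have e1 : ip g ge = ip g q by rewrite -(ip_avg _ gc).
have e2 : ip q ge = sqn q by rewrite -(ip_avg _ qc).
have e3 : ip qe g = sqn q by rewrite /qe (ip_eta etaK) e2.
have e4 : fluct ge = sqn g - sqn q by rewrite /fluct (sqn_eta etaK).
have e5 : sqn ge = sqn g by apply: (sqn_eta etaK).
have e6 : sqn qe = sqn q by apply: (sqn_eta etaK).
have e7 : ip ge qe = ip g q by rewrite /ge (ip_eta etaK); apply: eq_ip => // x; rewrite /qe etaK.
have e8 : ip g qe = sqn q by rewrite ipC.
have h := sqn_ge0 (fun x => (g x + q x) - (ge x + qe x)).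
rewrite sqnB !sqnD !ipDl !ipDr e1 e2 e5 e6 e7 e8 in h.
rewrite (@eq_sqn _ _ _ (fun x => (g x - q x) + (ge x - qe x))); last by [].
rewrite sqnD !sqnB ipBl !ipBr e1 e2 e5 e6 e7 e8 e4.
by rewrite -/(sqn q) in h *; lra.
Qed.

(** With Q the simple random walk operator, the hypothesis bounds the form of I - Q at g from below,
    so w = g - Qg cannot be small. The dual inequality is then applied to w, and [fluct_eta_ge]
    returns to g. *)
Lemma fluct_eta_gap beta a g : 0 <= beta -> non_bipartite beta -> vconst g -> 0 <= a ->
  a * sqn g <= sqn (fun x => g x - g (eta x)) ->
  beta ^+ 2 * a ^+ 2 / 16 * sqn g <= fluct (fun x => g (eta x)).
Proof.
move=> b0 nb gc a0 hg; pose q := avg (fun y => g (eta y)).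
pose w := fun x => g x - q x.
have wc : vconst w by move=> x y e; rewrite /w /q (gc _ _ e) (avg_vconst _ e).
have h1 := fluct_eta_ge gc (dual_gap b0 nb wc); rewrite -/q -/w in h1.
have h2 : a * sqn g <= 2 * ip g w.
  apply: le_trans hg _; rewrite sqnB (sqn_eta etaK) -(ip_avg _ gc) /w ipBr -/q /sqn; lra.
have h3 := cauchy_schwarz g w.
have h4 : a ^+ 2 * sqn g <= 4 * sqn w.
  have [z|nz] := eqVneq (sqn g) 0; first by rewrite z mulr0 mulr_ge0 ?sqn_ge0.
  have gp : 0 < sqn g by rewrite lt_def nz sqn_ge0.
  rewrite -(ler_pM2r gp); have : (a * sqn g) ^+ 2 <= (2 * ip g w) ^+ 2.
    by rewrite lerXn2r ?nnegrE ?(le_trans _ h2) // mulr_ge0 ?sqn_ge0.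
  rewrite !exprMn; nra.
have : beta ^+ 2 * (a ^+ 2 * sqn g) <= beta ^+ 2 * (4 * sqn w).
  by rewrite ler_wpM2l ?sqr_ge0.
lra.
Qed.

Lemma median_exists g i : exists m : R,
  (2 * #|[set x in half_edges_in M i | (m < g x)%R]%SET| <= nhalf_in M i)%N /\
  (2 * #|[set x in half_edges_in M i | (g x < m)%R]%SET| <= nhalf_in M i)%N.
Proof.
pose P := fun x : H => (x \in half_edges_in M i) &&
  (2 * #|[set y in half_edges_in M i | (g x < g y)%R]%SET| <= nhalf_in M i)%N.
have [v0 v0i] := @community_nonempty M i.
pose x0 := rep v0; have x0i : x0 \in half_edges_in M i by rewrite inE v0i.
have [x1 Px1] : exists x, P x.
  case: (@Order.TotalTheory.arg_maxP _ _ _ x0 (fun x => x \in half_edges_in M i) g x0i) => x xi xm.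
  exists x; rewrite /P xi (_ : [set y in _ | _]%SET = finset.set0) ?cards0 //.
  apply/setP => y; rewrite !inE; apply/negbTE/negP => /andP[yi].
  by rewrite ltNge => /negP; apply; apply: xm; rewrite inE.
(* The median is the least value with at most half of the community above it. The largest value
   below it fails this test, so more than half lies at or above the median. *)
case: (@Order.TotalTheory.arg_minP _ _ _ x1 P g Px1) => x /andP[xi hx] xm.
exists (g x); split=> //.
set B := [set y in _ | _]%SET.
have [->|] := eqVneq B finset.set0; first by rewrite cards0 muln0.
case/set0Pn => y0 y0B.
case: (@Order.TotalTheory.arg_maxP _ _ _ y0 (fun y => y \in B) g y0B) => y yB ym.
have /andP[yi ylt] : (y \in half_edges_in M i) && (g y < g x) by move: yB; rewrite inE.
have : ~~ P y by apply/negP => /xm; rewrite leNgt ylt.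
rewrite /P yi /= -ltnNge; set C := [set z in _ | _]%SET => hC.
have : (#|B| + #|C| = nhalf_in M i)%N.
  rewrite -card_half_edges_in -(cardsID B (half_edges_in M i)); congr (_ + _)%N.
    by apply: eq_card => z; rewrite !inE; case: (_ == i).
  apply: eq_card => z; rewrite !inE; case zi: (_ == i); rewrite ?andbF //= andbT -leNgt.
  apply/idP/idP => [h|]; last exact: lt_le_trans.
  rewrite leNgt; apply/negP => h2; move: h; rewrite ltNge => /negP; apply; apply: ym.
  by rewrite !inE zi.
move=> e; move: hC; rewrite -e; move: #|B| #|C| => b c; lia.
Qed.

End Expansion.

(** * Contraction over two steps *)

Section Contraction.
Variables (R : realType) (M : two_community) (eta : {perm half_edge M}).
Variables (phi beta : R).
Hypothesis degree_ge3 : forall v : vertex M, (3 <= degree v)%N.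
Hypothesis etaK : forall x, eta (eta x) = x.
Hypothesis phi01 : 0 <= phi <= 1.
Hypothesis beta01 : 0 <= beta <= 1.
Hypothesis exp_eta : expander eta phi.
Hypothesis nonbip_eta : non_bipartite eta beta.
Local Notation H := (half_edge M).
Implicit Types f g h u : H -> R.

(** One sixteenth of the constant given by [fluct_eta_gap] at a = phi^2 / 4. The slack absorbs the
    factor 3/8 of [sqn_step2] and the loss due to truncation. *)
Definition gap : R := beta ^+ 2 * phi ^+ 4 / 4096.

Lemma sum_in_avg f i :
  \sum_(x in half_edges_in M i) avg f x = \sum_(x in half_edges_in M i) f x.
Proof.
pose c := fun x : H => (x \in half_edges_in M i)%:R : R.
have cc : vconst c by move=> x y e; rewrite /c !inE e.
have := ip_avg f cc; rewrite /ip /c.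
have e h : \sum_x (x \in half_edges_in M i)%:R * h x = \sum_(x in half_edges_in M i) h x.
  by rewrite [RHS]big_mkcond; apply: eq_bigr => x _; case: ifP => _; rewrite ?mul1r ?mul0r.
by rewrite !e.
Qed.

Hypothesis card_crossing : #|crossing eta| = (2 * noutgoing M)%N.
Hypothesis few_outgoing : forall i, 16 * (noutgoing M)%:R <= phi ^+ 2 * (nhalf_in M i)%:R.

(** Each community is centred at its own median, and the positive and negative parts are treated
    apart, so that only sets of at most half of each community occur. On crossing edges the two
    medians differ. This error is absorbed because crossings are few and because, the means being
    zero, recentring adds n_i m_i^2 to the squared norm. *)
Lemma poincare g : vconst g -> (forall i, \sum_(x in half_edges_in M i) g x = 0) ->
  phi ^+ 2 / 4 * sqn g <= sqn (fun x => g x - g (eta x)).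
Proof.
move=> gc gs; have /andP[p0 _] := phi01.
have [m0 [m0a m0b]] := median_exists g false.
have [m1 [m1a m1b]] := median_exists g true.
pose m (i : bool) := if i then m1 else m0.
have ma i : (2 * #|[set x in half_edges_in M i | (m i < g x)%R]%SET| <= nhalf_in M i)%N by case: i.
have mb i : (2 * #|[set x in half_edges_in M i | (g x < m i)%R]%SET| <= nhalf_in M i)%N by case: i.
pose c (x : H) := community (tag x).
pose G x := g x - m (c x).
have Gc : vconst G by move=> x y e; rewrite /G /c (gc _ _ e) e.
pose Gp x := Num.max 0 (G x); pose Gm x := Num.max 0 (- G x).
have sG : sqn G = sqn Gp + sqn Gm.
  rewrite !sqnE -big_split; apply: eq_bigr => x _ /=; rewrite /Gp /Gm.
  case: (lerP 0 (G x)) => h; case: (lerP 0 (- G x)) => h'; try lra.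
  have -> : G x = 0 by lra.
  by rewrite oppr0 expr0n addr0.
have hp : phi ^+ 2 * sqn Gp <= sqn (fun x => Gp x - Gp (eta x)).
  apply: cheeger_half => // [x y e|x|i].
  - by rewrite /Gp (Gc _ _ e).
  - by rewrite /Gp le_max lexx.
  - apply: leq_trans (ma i); rewrite leq_mul2l /= subset_leq_card //.
    apply/fintype.subsetP => x; rewrite !inE => /andP[/eqP xi]; rewrite xi eqxx /=.
    by rewrite /Gp /G /c xi lt_max ltxx /= subr_gt0.
have hm : phi ^+ 2 * sqn Gm <= sqn (fun x => Gm x - Gm (eta x)).
  apply: cheeger_half => // [x y e|x|i].
  - by rewrite /Gm (Gc _ _ e).
  - by rewrite /Gm le_max lexx.
  - apply: leq_trans (mb i); rewrite leq_mul2l /= subset_leq_card //.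
    apply/fintype.subsetP => x; rewrite !inE => /andP[/eqP xi]; rewrite xi eqxx /=.
    by rewrite /Gm /G /c xi lt_max ltxx /= oppr_gt0 subr_lt0.
have hE : sqn (fun x => Gp x - Gp (eta x)) + sqn (fun x => Gm x - Gm (eta x)) <=
    sqn (fun x => G x - G (eta x)).
  rewrite !sqnE -big_split ler_sum // => x _ /=; rewrite /Gp /Gm.
  case: (lerP 0 (G x)) => h1; case: (lerP 0 (- G x)) => h2;
  case: (lerP 0 (G (eta x))) => h3; case: (lerP 0 (- G (eta x))) => h4; nra.
have si i : \sum_(x in half_edges_in M i) G x ^+ 2 =
    \sum_(x in half_edges_in M i) g x ^+ 2 + (nhalf_in M i)%:R * m i ^+ 2.
  rewrite (eq_bigr (fun x => g x ^+ 2 + (m i ^+ 2 - 2 * m i * g x))); last first.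
    by move=> x; rewrite inE => /eqP xi; rewrite /G /c xi; ring.
  rewrite big_split sumrB -[X in _ - X]mulr_sumr gs mulr0 subr0 sumr_const card_half_edges_in.
  by rewrite -[_ *+ _]mulr_natl.
have sG2 : sqn G = sqn g + (nhalf_in M false)%:R * m0 ^+ 2 + (nhalf_in M true)%:R * m1 ^+ 2.
  by rewrite !sqnE (sum_community (fun x => G x ^+ 2)) (sum_community (fun x => g x ^+ 2)) !si /m; ring.
have hG : sqn (fun x => G x - G (eta x)) <= 2 * sqn (fun x => g x - g (eta x))
    + 8 * (noutgoing M)%:R * (m0 ^+ 2 + m1 ^+ 2).
  apply: (@le_trans _ _ (\sum_x (2 * (g x - g (eta x)) ^+ 2 +
     (if x \in crossing eta then 4 * (m0 ^+ 2 + m1 ^+ 2) else 0)))).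
    rewrite sqnE ler_sum // => x _; rewrite !inE /G /c.
    case: ifP => [|/negbFE/eqP ->]; last first.
      rewrite addr0; set d := m _; have := sqr_ge0 (g x - g (eta x)).
    by rewrite (_ : g x - d - (g (eta x) - d) = g x - g (eta x)); [lra|ring].
    move=> cr; set a := m (community (tag x)); set b := m _.
    have ha : a ^+ 2 + b ^+ 2 = m0 ^+ 2 + m1 ^+ 2.
      by move: cr; rewrite /a /b /m; case: (community _); case: (community _) => // _; ring.
    have := sqr_ge0 (a + b); have := sqr_ge0 (g x - g (eta x) + a - b); nra.
  rewrite big_split /= -mulr_sumr -sqnE lerD2l -big_mkcond sumr_const card_crossing.
  by rewrite -[_ *+ _]mulr_natl natrM le_eqVlt; apply/orP; left; apply/eqP; ring.
have h0 := few_outgoing false; have h1 := few_outgoing true.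
have : 16 * (noutgoing M)%:R * (m0 ^+ 2 + m1 ^+ 2) <= phi ^+ 2 * sqn G.
  have a0 := sqr_ge0 m0; have a1 := sqr_ge0 m1.
  have := ler_wpM2r a0 h0; have := ler_wpM2r a1 h1.
  have : 0 <= phi ^+ 2 * sqn g by rewrite mulr_ge0 ?sqr_ge0 ?sqn_ge0.
  by rewrite sG2; lra.
have : phi ^+ 2 * sqn g <= phi ^+ 2 * sqn G.
  rewrite ler_wpM2l ?sqr_ge0 // sG2 -addrA lerDl addr_ge0 // mulr_ge0 ?sqr_ge0 //.
have : phi ^+ 2 * sqn G = phi ^+ 2 * sqn Gp + phi ^+ 2 * sqn Gm by rewrite sG mulrDr.
lra.
Qed.

Lemma gap_le1 : 0 <= gap <= 1 / 4096.
Proof.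
have /andP[p0 p1] := phi01; have /andP[b0 b1] := beta01.
have h1 : 0 <= beta ^+ 2 <= 1 by rewrite exprn_ge0 // exprn_ile1.
have h2 : 0 <= phi ^+ 4 <= 1 by rewrite exprn_ge0 // exprn_ile1.
by rewrite /gap; nra.
Qed.

Lemma fluct_gap g : vconst g ->
  phi ^+ 2 / 4 * sqn g <= sqn (fun x => g x - g (eta x)) ->
  16 * gap * sqn g <= fluct (fun x => g (eta x)).
Proof.
have /andP[p0 _] := phi01; have /andP[b0 _] := beta01.
move=> gc h; have := fluct_eta_gap etaK b0 nonbip_eta gc _ h.
move=> /(_ (divr_ge0 (sqr_ge0 _) (ler0n _ _))); rewrite /gap.
by apply: le_trans; rewrite le_eqVlt; apply/orP; left; apply/eqP; field.
Qed.

Lemma step2_contract f : (forall i, \sum_(x in half_edges_in M i) f x = 0) ->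
  sqn (step eta (step eta f)) <= (1 - gap) * sqn f.
Proof.
move=> f0; have h := sqn_step2 degree_ge3 etaK f.
have := fluct_gap (avg_vconst f); rewrite poincare; first last.
- by move=> i; rewrite sum_in_avg.
- exact: avg_vconst.
move=> /(_ isT) h2; have := gap_le1; have := fluct_ge0 f.
have e : fluct f = sqn f - sqn (avg f) by [].
have := sqn_ge0 (avg f); nra.
Qed.

Lemma step2_density u (tau : R) : (forall x, 0 <= u x) -> \sum_x u x = #|H|%:R ->
  (forall i, 2 * #|H|%:R <= tau * (nhalf_in M i)%:R) -> 0 < tau ->
  8 * tau ^+ 2 * #|H|%:R <= sqn u ->
  sqn (step eta (step eta u)) <= (1 - gap) * sqn u.
Proof.
move=> u0 su htau tau0 hu; have /andP[p0 _] := phi01.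
set g := avg u; have gc : vconst g := avg_vconst u.
have g0 x : 0 <= g x by rewrite /g /avg divr_ge0 // sumr_ge0.
have sg : \sum_x g x = #|H|%:R.
  by rewrite sum_community !sum_in_avg -sum_community.
pose k x := Num.max 0 (g x - tau).
have kc : vconst k by move=> x y e; rewrite /k (gc _ _ e).
have k0 x : 0 <= k x by rewrite /k le_max lexx.
have hk : phi ^+ 2 * sqn k <= sqn (fun x => k x - k (eta x)).
  apply: cheeger_half => // i.
  rewrite -(ler_nat R) natrM -(ler_pM2l tau0); apply: le_trans (htau i).
  rewrite mulrCA ler_pM2l // -sg mulr_natr -sumr_const.
  rewrite [X in _ <= X](bigID (mem [set x in half_edges_in M i | (0 < k x)%R]%SET)) /=.
  rewrite -[X in X <= _]addr0 lerD ?sumr_ge0 // ler_sum // => x.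
  by rewrite !inE /k lt_max ltxx /= subr_gt0 => /andP[_ /ltW].
have h1 : 16 * gap * sqn k <= fluct (fun x => k (eta x)).
  apply: fluct_gap => //; apply: le_trans hk; rewrite ler_wpM2r ?sqn_ge0 //.
  by have := sqr_ge0 phi; lra.
(* Truncation at [tau] is 1-Lipschitz, so truncating a function and its vertex average brings them
   no further apart; [fluct_min] compares with the truncated average. *)
have h2 : fluct (fun x => k (eta x)) <= fluct (fun x => g (eta x)).
  rewrite [X in _ <= X]fluctE.
  pose a x := Num.max 0 (avg (fun y => g (eta y)) x - tau).
  have ac : vconst a by move=> x y e; rewrite /a (avg_vconst _ e).
  apply: le_trans (fluct_min _ ac) _; apply: ler_sqn => x; rewrite /k /a.
  set b := g (eta x); set d := avg _ x.
  case: (lerP 0 (b - tau)); case: (lerP 0 (d - tau)) => h3 h4;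
  rewrite ler_norml; case: (lerP 0 (b - d)) => h5; rewrite ?(ger0_norm h5) ?(ltr0_norm h5); lra.
have h3 : sqn g <= 2 * sqn k + 2 * tau ^+ 2 * #|H|%:R.
  rewrite !sqnE mulr_sumr.
  rewrite (_ : 2 * tau ^+ 2 * #|H|%:R = \sum_(x : H) 2 * tau ^+ 2).
    rewrite -big_split ler_sum // => x _ /=; rewrite /k.
    have := g0 x; case: (lerP 0 (g x - tau)) => h4 h5; last by nra.
    by have := sqr_ge0 (g x - 2 * tau); nra.
  by rewrite sumr_const mulr_natr.
have h4 := sqn_step2 degree_ge3 etaK u; rewrite -/g in h4.
have e : fluct u = sqn u - sqn g by [].
have := gap_le1; have := fluct_ge0 u; have := sqn_ge0 k; have := sqn_ge0 g.
case: (lerP (sqn g) (sqn u / 2)) => h5 h6 h7 h8 h9.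
  have := fluct_ge0 (fun x => g (eta x)); nra.
have : sqn u / 8 <= sqn k by lra.
nra.
Qed.

End Contraction.

(** * Two weakly coupled linear recurrences *)

Section TwoByTwo.
Variable R : realType.

(** The weighted sum a + c e with c = 2B/(1-k) decays geometrically: the damping of e pays for the
    term B e, and the smallness of B^2 keeps c B below g/2. *)
Lemma two_by_two (a e : nat -> R) (g k B : R) :
  0 <= g <= 1 - k -> 0 <= k < 1 -> 0 <= B -> 4 * B ^+ 2 <= g * (1 - k) ->
  (forall l, 0 <= a l) -> (forall l, 0 <= e l) ->
  (forall l, a l.+1 <= (1 - g) * a l + B * e l) ->
  (forall l, e l.+1 <= k * e l + B * a l) ->
  let v := a 0%N + 2 * B / (1 - k) * e 0%N in
  forall l, a l <= (1 - g / 2) ^+ l * v /\ e l <= k ^+ l * e 0%N + B / (1 - k) * v.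
Proof.
move=> /andP[g0 gk] /andP[k0 k1] B0 hB a0 e0 ha he v l.
have k1' : 0 < 1 - k by lra.
pose c := 2 * B / (1 - k).
have c0 : 0 <= c by rewrite /c divr_ge0 ?mulr_ge0 // ltW.
have cB : c * (1 - k) = 2 * B by rewrite /c divfK // lt0r_neq0.
have hcB : c * B <= g / 2.
  rewrite -(ler_pM2r k1') mulrAC cB; lra.
have hv l' : a l' + c * e l' <= (1 - g / 2) ^+ l' * v.
  elim: l' => [|n IH]; first by rewrite expr0 mul1r.
  rewrite exprS -mulrA; apply: (@le_trans _ _ ((1 - g / 2) * (a n + c * e n))).
    have := ha n; have := ler_wpM2l c0 (he n).
    have : c * B * a n <= g / 2 * a n by rewrite ler_wpM2r.
    have : c * (g / 2) * e n <= c * ((1 - k) / 2) * e n.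
      by rewrite ler_wpM2r // ler_wpM2l //; lra.
    have : c * (1 - k) * e n = 2 * B * e n by rewrite cB.
    lra.
  by rewrite ler_wpM2l //; lra.
have v0 : 0 <= v by rewrite addr_ge0 // mulr_ge0.
have al l' : a l' <= v.
  apply: (@le_trans _ _ (a l' + c * e l')); first by rewrite lerDl mulr_ge0.
  apply: le_trans (hv l') _; rewrite -[X in _ <= X]mul1r ler_wpM2r // exprn_ile1 //; lra.
split.
  by apply: le_trans (hv l); rewrite lerDl mulr_ge0.
elim: l => [|n IH].
  by rewrite expr0 mul1r lerDl mulr_ge0 // divr_ge0 // ltW.
apply: le_trans (he n) _; have h1 := ler_wpM2l k0 IH; have h2 := ler_wpM2l B0 (al n).
have e1 : B / (1 - k) * (1 - k) = B by rewrite divfK // lt0r_neq0.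
have e2 : B / (1 - k) * v = k * (B / (1 - k) * v) + B * v.
  by rewrite -{3}e1; ring.
rewrite exprS e2; lra.
Qed.

(** The cone e <= c a with c = 2B/(1-k) is invariant, so a stays positive and feels e only through a
    term of order B^2. *)
Lemma two_by_two_lower (a e : nat -> R) (g k B : R) :
  0 <= k < 1 -> 0 <= B -> g <= (1 - k) / 4 -> 4 * B ^+ 2 <= (1 - k) ^+ 2 / 4 ->
  a 0%N = 1 -> e 0%N = 0 ->
  (forall l, (1 - g) * a l - 2 * B * e l <= a l.+1) ->
  (forall l, 0 <= e l) ->
  (forall l, e l.+1 <= k * e l + B * `|a l|) ->
  forall l, (1 - g - 4 * B ^+ 2 / (1 - k)) ^+ l <= a l.
Proof.
move=> /andP[k0 k1] B0 hg hB a0 e00 ha e0 he l.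
have k1' : 0 < 1 - k by lra.
pose c := 2 * B / (1 - k).
have c0 : 0 <= c by rewrite /c divr_ge0 ?mulr_ge0 // ltW.
have cB : c * (1 - k) = 2 * B by rewrite /c divfK // lt0r_neq0.
have hcB : 2 * (B * c) = 4 * B ^+ 2 / (1 - k) by rewrite /c; field; rewrite lt0r_neq0.
have h4 : 4 * B ^+ 2 / (1 - k) <= (1 - k) / 4.
  by rewrite ler_pdivrMr //; lra.
set q := 1 - g - _.
have q0 : (1 + k) / 2 <= q by rewrite /q; lra.
suff : q ^+ l <= a l /\ e l <= c * a l by case.
elim: l => [|n [IH1 IH2]]; first by rewrite expr0 a0 e00 mulr1.
have an0 : 0 <= a n by apply: le_trans IH1; rewrite exprn_ge0 //; lra.
have h : q * a n <= a n.+1.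
  apply: le_trans (ha n); rewrite /q -hcB.
  have := ler_wpM2l B0 IH2; lra.
split.
  rewrite exprS; apply: le_trans h; rewrite ler_wpM2l //; lra.
apply: le_trans (he n) _; rewrite ger0_norm //.
have h1 := ler_wpM2l k0 IH2.
have h2 : c * ((1 + k) / 2 * a n) <= c * a n.+1.
  by rewrite ler_wpM2l // (le_trans _ h) // ler_wpM2r.
have : c * (1 - k) * a n = 2 * B * a n by rewrite cB.
lra.
Qed.

End TwoByTwo.

(** * The contrast between communities and crossing probabilities *)

Section CommunityFunction.
Variables (R : realType) (M : two_community) (eta : {perm half_edge M}).
Hypothesis degree_ge3 : forall v : vertex M, (3 <= degree v)%N.
Hypothesis etaK : forall x, eta (eta x) = x.
Hypothesis card_crossing : #|crossing eta| = (2 * noutgoing M)%N.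
Local Notation H := (half_edge M).
Implicit Types f g e : H -> R.
Local Notation N := (nhalf M)%:R.
Local Notation "'n_ i" := (nhalf_in M i)%:R (at level 2).
Local Notation step := (step eta).
Local Notation stepn := (stepn eta).

Lemma nhalf_in_gt0 i : (0 < nhalf_in M i)%N.
Proof. exact: leq_trans (ltnW (noutgoing_ge2 M)) (noutgoing_le M i). Qed.

Lemma nhalfE : N = 'n_false + 'n_true :> R.
Proof. by rewrite -natrD. Qed.

Lemma nhalf_gt0 : 0 < N :> R.
Proof. by rewrite nhalfE addr_gt0 // ltr0n nhalf_in_gt0. Qed.

(** The share of crossing half-edges, that is, the crossing rate at stationarity. *)
Definition omega : R := 2 * (noutgoing M)%:R / N.

Definition chi_norm : R := Num.sqrt ('n_false * 'n_true * N).

(** These two values make [chi] a unit function, constant on each community and orthogonal to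
    constants: the approximate slow mode. *)
Definition chi_at (i : bool) : R := (if i then - 'n_false else 'n_true) / chi_norm.

Definition chi (x : H) : R := chi_at (community (tag x)).

Lemma chi_norm_gt0 : 0 < chi_norm.
Proof. by rewrite sqrtr_gt0 !mulr_gt0 ?nhalf_gt0 // ltr0n nhalf_in_gt0. Qed.

Lemma chi_norm2 : chi_norm ^+ 2 = 'n_false * 'n_true * N.
Proof. by rewrite sqr_sqrtr // !mulr_ge0. Qed.

Lemma vconst_chi : vconst chi.
Proof. by move=> x y exy; rewrite /chi exy. Qed.

Lemma sum_by_community (a : bool -> R) :
  \sum_(x : H) a (community (tag x)) = 'n_false * a false + 'n_true * a true.
Proof.
have h i : \sum_(x in half_edges_in M i) a (community (tag x)) = 'n_i * a i.
  transitivity (\sum_(x in half_edges_in M i) a i).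
    by apply: eq_bigr => x; rewrite inE => /eqP ->.
  by rewrite sumr_const card_half_edges_in mulr_natl.
by rewrite sum_community !h.
Qed.

Lemma sum_chi : \sum_x chi x = 0.
Proof. by rewrite (sum_by_community chi_at) /chi_at; ring. Qed.

Lemma sqn_chi : sqn chi = 1.
Proof.
rewrite sqnE (sum_by_community (fun i => chi_at i ^+ 2)) /chi_at !expr_div_n sqrrN chi_norm2 nhalfE.
field; rewrite -natrD !pnatr_eq0 -!lt0n !nhalf_in_gt0 /=.
by rewrite addn_gt0 nhalf_in_gt0.
Qed.

Lemma nrm_chi : nrm chi = 1.
Proof. by rewrite /nrm sqn_chi sqrtr1. Qed.

Lemma chi_jump i : (chi_at i - chi_at (~~ i)) * chi_at i = ('n_i)^-1.
Proof.
have := chi_norm2; have h := chi_norm_gt0; rewrite /chi_at.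
have n0 : 'n_false != 0 :> R by rewrite pnatr_eq0 -lt0n nhalf_in_gt0.
have n1 : 'n_true != 0 :> R by rewrite pnatr_eq0 -lt0n nhalf_in_gt0.
have n2 : 'n_false + 'n_true != 0 :> R by rewrite -nhalfE lt0r_neq0 ?nhalf_gt0.
case: i => /= e.
  rewrite (_ : _ * _ = 'n_false * ('n_false + 'n_true) / chi_norm ^+ 2); last first.
    by field; rewrite lt0r_neq0.
  by rewrite e nhalfE; field; rewrite ?n2 ?n1 ?n0.
rewrite (_ : _ * _ = 'n_true * ('n_false + 'n_true) / chi_norm ^+ 2); last first.
  by field; rewrite lt0r_neq0.
by rewrite e nhalfE; field; rewrite ?n2 ?n1 ?n0.
Qed.

Lemma sqn_chi_eta : sqn (fun x => chi (eta x) - chi x) = 2 * alpha R M.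
Proof.
have e0 := chi_jump false; have e1 := chi_jump true.
have e2 : (chi_at true - chi_at false) ^+ 2 = ('n_false)^-1 + ('n_true)^-1 :> R.
  by rewrite -e0 -e1 /=; ring.
rewrite sqnE (eq_bigr (fun x => if x \in crossing eta then (chi_at true - chi_at false) ^+ 2 else 0)).
  rewrite -big_mkcond sumr_const card_crossing -[_ *+ _]mulr_natl e2 natrM /alpha /alpha_in.
  by ring.
move=> x _; rewrite inE /chi; case: (community (tag x)); case: (community _) => /=;
  rewrite ?subrr ?expr0n //.
by rewrite -sqrrN opprB.
Qed.

Definition jump (x : H) : R := chi x - chi_at (~~ community (tag x)).

(** The probability that after [t] steps the walk is in the community opposite to that of [x]; a
    crossing at the current step exchanges the two roles. *)
Fixpoint other (t : nat) (x : H) : R :=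
  if t is s.+1 then
    if x \in crossing eta then 1 - step (other s) x else step (other s) x
  else 0.

(** The probability of at least one crossing during the first [t] steps. *)
Fixpoint crossed (t : nat) (x : H) : R :=
  if t is s.+1 then if x \in crossing eta then 1 else step (crossed s) x else 0.

Lemma step_vconst (k : H -> R) g x : vconst k ->
  step (fun y => k y * g y) x = k (eta x) * step g x.
Proof.
move=> kc; rewrite /step mulr_sumr; apply: eq_bigr => y _; rewrite /nbrw.
case: ifP => [/andP[_ /eqP e]|_]; last by rewrite !mul0r mulr0.
by rewrite (kc _ _ e) mulrCA.
Qed.

Lemma step_le1 g x : (forall y, g y <= 1) -> step g x <= 1.
Proof. by move=> h; rewrite -(step_cst eta degree_ge3 1 x) ler_step. Qed.

Lemma crossed01 t x : 0 <= crossed t x <= 1.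
Proof.
elim: t x => /= [x|t IH x]; first by rewrite lexx ler01.
case: ifP => _; first by rewrite ler01 lexx.
by rewrite step_ge0 ?step_le1 // => y; case/andP: (IH y).
Qed.

Lemma other01 t x : 0 <= other t x <= 1.
Proof.
elim: t x => /= [x|t IH x]; first by rewrite lexx ler01.
have h0 : 0 <= step (other t) x by apply: step_ge0 => y; case/andP: (IH y).
have h1 : step (other t) x <= 1 by apply: step_le1 => y; case/andP: (IH y).
by case: ifP => _; lra.
Qed.

Lemma other_le_crossed t x : other t x <= crossed t x.
Proof.
elim: t x => //= t IH x; case: ifP => _; last exact: ler_step.
by rewrite lerBlDr lerDl step_ge0 // => y; case/andP: (other01 t y).
Qed.

Lemma sum_crossing : \sum_(x : H) (x \in crossing eta)%:R = 2 * (noutgoing M)%:R :> R.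
Proof. by rewrite -natrM -card_crossing -sum1_card natr_sum [RHS]big_mkcond; apply: eq_bigr => x _; case: ifP. Qed.

Lemma sum_crossed_le t : \sum_x crossed t x <= t%:R * (2 * (noutgoing M)%:R).
Proof.
elim: t => /= [|t IH]; first by rewrite big1 // mul0r.
rewrite -natr1 mulrDl mul1r -sum_crossing addrC.
apply: (@le_trans _ _ (\sum_x ((x \in crossing eta)%:R + step (crossed t) x))).
  apply: ler_sum => x _; have h : 0 <= step (crossed t) x.
    by apply: step_ge0 => y; case/andP: (crossed01 t y).
  by case: ifP => _; rewrite ?lerDl ?add0r.
by rewrite big_split /= sum_step // lerD2l sum_crossing.
Qed.

(* A walk which crosses exactly once ends in the other community. *)
Lemma sum_other_ge t J : (t <= J)%N ->
  t%:R * (2 * (noutgoing M)%:R - 2 * \sum_(x in crossing eta) step (crossed J) x)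
    <= \sum_x other t x.
Proof.
have cm s x : (s <= J)%N -> crossed s x <= crossed J x.
  move=> sJ; rewrite -(subnKC sJ); elim: (J - s)%N => [|n IH]; first by rewrite addn0.
  apply: le_trans IH _; rewrite addnS.
  elim: (s + n)%N x => [|m IH] x /=; first by case/andP: (crossed01 1 x).
  by case: ifP => // _; apply: ler_step.
elim: t => /= [_|t IH tJ]; first by rewrite mul0r big1.
have {}IH := IH (ltnW tJ).
rewrite -natr1 mulrDl mul1r; apply: le_trans (lerD IH (lexx _)) _.
rewrite -sum_crossing (big_mkcond (mem (crossing eta))) /= mulr_sumr -sumrB.
rewrite -[X in X + _](sum_step eta degree_ge3) -big_split ler_sum // => x _ /=.
case: ifP => _; last by rewrite mulr0 subr0 addr0.
have : step (other t) x <= step (crossed J) x.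
  by apply: ler_step => y; apply: le_trans (other_le_crossed t y) (cm _ _ (ltnW tJ)).
rewrite /= mulr1n; lra.
Qed.

(** Along the walk [chi] takes only two values, so its expectation is determined by the probability
    of being on the other side. Through this identity the decay of the slow mode becomes a count of
    crossings. *)
Lemma stepn_chi t x : stepn t chi x = chi x - jump x * other t x.
Proof.
elim: t x => /= [x|t IH x]; first by rewrite mulr0 subr0.
have jc : vconst jump by move=> y z e; rewrite /jump /chi e.
rewrite -/(stepn t chi) (eq_step eta IH).
have -> : step (fun y => chi y - jump y * other t y) x =
    chi (eta x) - jump (eta x) * step (other t) x.
  rewrite -step_vconst // -[chi (eta x)]mulr1 -{1}(step_cst eta degree_ge3 1 x).
  rewrite -(step_vconst _ _ vconst_chi) -mulN1r -stepZ -stepD.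
  by apply: eq_step => y; ring.
rewrite inE /jump /chi; case: (community (tag x)); case: (community _) => //=; ring.
Qed.

Lemma ip_stepn_chi t :
  1 - ip (stepn t chi) chi = \sum_x ('n_(community (tag x)))^-1 * other t x.
Proof.
rewrite -{1}sqn_chi /sqn -ipBl; apply: eq_bigr => x _.
by rewrite stepn_chi -chi_jump /jump /chi; ring.
Qed.

Definition perp f (x : H) : R := f x - ip f chi * chi x.

Lemma ip_perp f : ip (perp f) chi = 0.
Proof. by rewrite /perp ipBl ipZl -/(sqn chi) sqn_chi mulr1 subrr. Qed.

Lemma sqn_perp f : sqn f = ip f chi ^+ 2 + sqn (perp f).
Proof. by rewrite /perp sqnB sqnZ ipZr sqn_chi; ring. Qed.

Lemma nrm_perp f : nrm (perp f) <= nrm f.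
Proof. by rewrite ler_nrm [sqn f]sqn_perp lerDr sqr_ge0. Qed.

Lemma ip_chi_le f : `|ip f chi| <= nrm f.
Proof. by have := ip_le_nrm f chi; rewrite nrm_chi mulr1. Qed.

Lemma nrm_le_perp f : nrm f <= `|ip f chi| + nrm (perp f).
Proof.
apply: nrm_le; first by rewrite addr_ge0 ?nrm_ge0.
rewrite sqn_perp sqrrD real_normK ?num_real // nrmK.
have : 0 <= `|ip f chi| * nrm (perp f) by rewrite mulr_ge0 ?nrm_ge0.
lra.
Qed.

(** The sums over the two communities solve a homogeneous linear system, nonsingular because [chi]
    takes two distinct values. *)
Lemma perp_sum0 f i : \sum_x f x = 0 -> \sum_(x in half_edges_in M i) perp f x = 0.
Proof.
move=> f0; have e1 : \sum_x perp f x = 0.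
  by rewrite /perp sumrB f0 -mulr_sumr sum_chi mulr0 subrr.
have e2 := ip_perp f; rewrite sum_community in e1.
rewrite /ip sum_community in e2.
have e3 j : \sum_(x in half_edges_in M j) perp f x * chi x =
    (\sum_(x in half_edges_in M j) perp f x) * chi_at j.
  by rewrite mulr_suml; apply: eq_bigr => x; rewrite inE /chi => /eqP ->.
rewrite !e3 in e2; set a := \sum_(x in half_edges_in M false) _ in e1 e2; set b := \sum_(x in half_edges_in M true) _ in e1 e2.
have eb : b = - a by lra.
have : a * (chi_at false - chi_at true) = 0 by rewrite -e2 eb; ring.
have nz : chi_at false - chi_at true != 0.
  have h := chi_jump false; apply/eqP => z; move: h; rewrite /= z mul0r.
  by move/esym/eqP; rewrite invr_eq0 pnatr_eq0 -leqn0 leqNgt nhalf_in_gt0.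
by move/eqP; rewrite mulf_eq0 (negPf nz) orbF => /eqP a0; case: i; rewrite -?/a -?/b ?eb a0 ?oppr0.
Qed.

(** As [eta] is an isometric involution and [kern] is self-adjoint, the adjoint of the walk is its
    conjugate by [eta]: time reversal at the level of operators. *)
Lemma step_adjoint t f g :
  ip (stepn t f) g = ip f (fun y => stepn t (fun z => g (eta z)) (eta y)).
Proof.
elim: t g => /= [|t IH] g; first by apply: eq_ip => // x; rewrite etaK.
have -> : ip (step (stepn t f)) g = ip (stepn t f) (fun y => step (fun z => g (eta z)) (eta y)).
  rewrite (eq_ip (stepE eta _) (fun=> erefl)) (ip_eta etaK) (kern_sa degree_ge3).
  by apply: eq_ip => // x; rewrite stepE etaK.
rewrite -/(stepn t f) IH; apply: eq_ip => // x; rewrite -[RHS]/(stepn t.+1 _ _) /stepn iterSr.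
by apply: eq_stepn => y; rewrite etaK.
Qed.

Lemma nrm_eta f : nrm (fun x => f (eta x)) = nrm f.
Proof. by rewrite /nrm (sqn_eta etaK). Qed.

Definition drift : R := nrm (fun x => chi (eta x) - chi x).

Lemma drift2 : drift ^+ 2 = 2 * alpha R M.
Proof. by rewrite nrmK sqn_chi_eta. Qed.

Lemma step_chi x : step chi x = chi (eta x).
Proof. by rewrite stepE kernE // (avg_id vconst_chi) subrr mulr0 subr0. Qed.

Lemma stepn_sub t f g : stepn t (fun x => f x - g x) =1 fun x => stepn t f x - stepn t g x.
Proof.
move=> x; rewrite -mulN1r -stepn_scale -stepn_add.
by apply: eq_stepn => y; rewrite mulN1r.
Qed.

Lemma nrm_step2_chi : nrm (fun x => stepn 2 chi x - chi x) <= 2 * drift.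
Proof.
rewrite (@eq_nrm _ _ _ (fun x => step (fun y => chi (eta y) - chi y) x + (chi (eta x) - chi x))).
  apply: le_trans (nrmD _ _) _; have := nrm_stepn_le degree_ge3 etaK 1 (fun y => chi (eta y) - chi y).
  by rewrite /= -/drift; lra.
move=> x /=; rewrite (eq_step eta step_chi).
have := stepn_sub 1 (fun y => chi (eta y)) chi x; rewrite /= => ->.
by rewrite step_chi; ring.
Qed.

(* [stepn t] and the projections commute up to [drift]: both the leakage from
   chi to its complement and the leakage back have size O(sqrt alpha). *)
Lemma ip_stepn_perp t f : `|ip (stepn t f) chi - ip f chi * ip (stepn t chi) chi|
  <= nrm (perp f) * (2 * drift + nrm (fun x => stepn t chi x - chi x)).
Proof.
have -> : ip (stepn t f) chi - ip f chi * ip (stepn t chi) chi = ip (stepn t (perp f)) chi.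
  by rewrite -ipZl -ipBl; apply: eq_ip => // x; rewrite /perp stepn_sub stepn_scale.
rewrite step_adjoint -[X in `|X|]subr0 -(ip_perp f) -ipBr.
apply: le_trans (ip_le_nrm _ _) _; rewrite ler_wpM2l ?nrm_ge0 //.
rewrite (@eq_nrm _ _ _ (fun y => (fun x => stepn t (fun z => chi (eta z)) x - chi (eta x)) (eta y))).
  rewrite (nrm_eta (fun x => stepn t (fun z => chi (eta z)) x - chi (eta x))).
  rewrite (@eq_nrm _ _ _ (fun x => (stepn t (fun z => chi (eta z) - chi z) x
    + (stepn t chi x - chi x)) - (chi (eta x) - chi x))); last first.
    by move=> x; rewrite stepn_sub; ring.
  apply: le_trans (nrmB _ _) _; apply: le_trans (lerD (nrmD _ _) (lexx _)) _.
  have := nrm_stepn_le degree_ge3 etaK t (fun z => chi (eta z) - chi z).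
  by rewrite -/drift; lra.
by move=> x; rewrite etaK.
Qed.

End CommunityFunction.

(** * Distance to stationarity on a good graph *)

Section Distance.
Variables (R : realType) (M : two_community) (eta : {perm half_edge M}).
Variables (phi beta rho : R).
Hypothesis degree_ge3 : forall v : vertex M, (3 <= degree v)%N.
Hypothesis etaK : forall x, eta (eta x) = x.
Hypothesis card_crossing : #|crossing eta| = (2 * noutgoing M)%N.
Hypothesis phi01 : 0 <= phi <= 1.
Hypothesis beta01 : 0 <= beta <= 1.
Hypothesis exp_eta : expander eta phi.
Hypothesis nonbip_eta : non_bipartite eta beta.
Hypothesis few_outgoing : forall i, 16 * (noutgoing M)%:R <= phi ^+ 2 * (nhalf_in M i)%:R.
Hypothesis rho01 : 0 < rho <= 1.
Hypothesis balanced : forall i, rho * (nhalf M)%:R <= (nhalf_in M i)%:R.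
Local Notation H := (half_edge M).
Implicit Types f g u : H -> R.
Local Notation N := ((nhalf M)%:R : R).
Local Notation step := (step eta).
Local Notation stepn := (stepn eta).
Local Notation P := (nbrw_iter R eta).
Local Notation gap := (gap phi beta).
Local Notation chi := (chi R (M := M)).
Local Notation drift := (drift R eta).
Local Notation omega := (omega R M).

(** This is 8 tau^2 at tau = 2/rho, the level above which [step2_density] contracts the mean square
    of a density. *)
Definition flat : R := 32 / rho ^+ 2.

Let N_gt0 : 0 < N := nhalf_gt0 R M.
Let rho_gt0 : 0 < rho. Proof. by case/andP: rho01. Qed.

Lemma flat_ge1 : 1 <= flat.
Proof.
have /andP[r0 r1] := rho01; rewrite /flat ler_pdivlMr ?exprn_gt0 // mul1r.
by apply: (@le_trans _ _ 1); [rewrite exprn_ile1 // ltW|rewrite ler1n].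
Qed.

Lemma sqn_stepn_density u m : (forall x, 0 <= u x) -> \sum_x u x = N ->
  sqn (stepn (2 * m) u) <= Num.max (flat * N) ((1 - gap) ^+ m * sqn u).
Proof.
move=> u0 su; elim: m => [|m IH]; first by rewrite mul1r le_max lexx orbT.
have -> : (2 * m.+1 = 2 + 2 * m)%N by rewrite mulnS.
set w := stepn (2 * m) u in IH; rewrite stepnD -/w /=.
have g1 := gap_le1 phi01 beta01.
have w0 x : 0 <= w x by apply: stepn_ge0.
have sw : \sum_x w x = #|H|%:R by rewrite sum_stepn // su card_half_edge.
have [hw|hw] := lerP (flat * N) (sqn w).
  have h : sqn (step (step w)) <= (1 - gap) * sqn w.
    apply: (@step2_density _ _ _ _ _ degree_ge3 etaK phi01 beta01 exp_eta nonbip_eta _ (2 / rho)) => //.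
    - move=> i; rewrite card_half_edge mulrAC ler_pdivlMr // -mulrA ler_pM2l // mulrC.
      exact: balanced.
    - by rewrite divr_gt0.
    - rewrite card_half_edge expr_div_n; move: hw; rewrite /flat.
      by rewrite (_ : 8 * (2 ^+ 2 / rho ^+ 2) = 32 / rho ^+ 2) //; field; rewrite lt0r_neq0.
  apply: le_trans h _; rewrite exprS -mulrA le_max.
  move: IH; rewrite le_max => /orP[h|h]; apply/orP; [left|right].
    apply: le_trans h; rewrite -[X in _ <= X]mul1r ler_wpM2r ?sqn_ge0 //; lra.
  by rewrite ler_wpM2l //; lra.
rewrite le_max (le_trans _ (ltW hw)) //.
exact: (sqn_stepn_le degree_ge3 etaK 2 w).
Qed.

Variable m0 : nat.
Hypothesis burn_in : (1 - gap) ^+ m0 * N <= 1.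

Definition dirac_density (y : H) (z : H) : R := N * (z == y)%:R.

Lemma dirac_density_ge0 y z : 0 <= dirac_density y z.
Proof. by rewrite mulr_ge0 // ltW. Qed.

Lemma sum_dirac_density y : \sum_z dirac_density y z = N.
Proof.
rewrite /dirac_density -mulr_sumr (bigD1 y) //= eqxx big1 ?addr0 ?mulr1 //.
by move=> z /negPf->.
Qed.

Lemma stepn_dirac_density t y z : stepn t (dirac_density y) z = N * P t z y.
Proof. by rewrite stepn_scale nbrw_iterE. Qed.

Lemma sqn_dirac_density t y : (2 * m0 <= t)%N ->
  sqn (stepn t (dirac_density y)) <= flat * N.
Proof.
move=> ht; rewrite -(subnK ht) stepnD.
apply: le_trans (sqn_stepn_le degree_ge3 etaK _ _) _.
apply: le_trans (sqn_stepn_density _ (dirac_density_ge0 y) (sum_dirac_density y)) _.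
rewrite ge_max lexx /=.
have -> : sqn (dirac_density y) = N * N.
  rewrite /dirac_density sqnZ sqnE (bigD1 y) //= eqxx big1 ?addr0 ?expr1n ?mulr1 ?expr2 //.
  by move=> z /negPf->; rewrite expr0n.
rewrite mulrA ler_wpM2r ?(ltW N_gt0) //; exact: le_trans burn_in flat_ge1.
Qed.

(** Chapman-Kolmogorov splits the time into two parts of length at least 2 m0. Cauchy-Schwarz
    combines their mean square bounds, the first of which is obtained by time reversal, into a
    pointwise bound. *)
Lemma nbrw_iter_le t x y : (4 * m0 <= t)%N -> P t x y <= flat / N.
Proof.
have A0 : 0 <= flat by exact: le_trans flat_ge1.
have sq s z : (2 * m0 <= s)%N -> sqn (fun w => P s w z) <= flat / N.
  move=> /(sqn_dirac_density z); rewrite (eq_sqn (stepn_dirac_density s z)) sqnZ => h.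
  rewrite ler_pdivlMr // -(ler_pM2l N_gt0); lra.
move=> ht; have ht2 : (2 * m0 <= t)%N by apply: leq_trans ht; rewrite leq_mul2r orbT.
rewrite -(subnKC ht2) nbrw_iterD.
have h := cauchy_schwarz (fun z => P (2 * m0) x z) (fun z => P (t - 2 * m0) z y).
have h1 : sqn (fun z => P (2 * m0) x z) <= flat / N.
  rewrite (@eq_sqn _ _ _ (fun z => (fun w => P (2 * m0) w (eta x)) (eta z))).
    by rewrite (sqn_eta etaK (fun w => P (2 * m0) w (eta x))) sq.
  by move=> z; rewrite nbrw_iter_rev.
have h2 : sqn (fun z => P (t - 2 * m0) z y) <= flat / N.
  by apply: sq; rewrite leq_subRL // -mulnDl.
have c0 : 0 <= flat / N by rewrite divr_ge0 // ltW.
rewrite -[flat / N]ger0_norm //; apply: le_trans (ler_norm _) _.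
rewrite -ler_sqr ?nnegrE // !real_normK ?num_real //.
apply: le_trans h _; rewrite expr2 ler_pM ?sqn_ge0 //.
Qed.

(** Since P <= flat/N, each term of the distance is at most 1/N - P/flat. *)
Lemma dist_from_le t x : (4 * m0 <= t)%N -> dist_from R eta x t <= 1 - flat^-1.
Proof.
move=> ht; have A1 := flat_ge1; have A0 : 0 < flat by apply: lt_le_trans A1.
have -> : 1 - flat^-1 = \sum_(y : H) (N^-1 - P t x y / flat).
  rewrite sumrB -mulr_suml (sum_nbrw_iter R eta degree_ge3) mul1r sumr_const card_half_edge.
  by rewrite -[_ *+ _]mulr_natl divff // lt0r_neq0.
apply: ler_sum => y _; have h := nbrw_iter_le x y ht.
have p0 : 0 <= P t x y := nbrw_iter_ge0 R eta t x y.
rewrite ge_max; apply/andP; split.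
  by rewrite subr_ge0 ler_pdivrMr // mulrC.
by rewrite lerD2l lerN2 ler_piMr // invf_le1.
Qed.

Lemma dist_le t : (4 * m0 <= t)%N -> dist R eta t <= 1 - flat^-1.
Proof.
move=> ht; apply/bigmax_leP; split=> [|x _]; last exact: dist_from_le.
by rewrite subr_ge0 invf_le1 ?flat_ge1 // (lt_le_trans _ flat_ge1).
Qed.

(* The relaxation rate of the fluctuations inside the communities. *)
Definition kappa : R := Num.sqrt (1 - gap).

Hypothesis gap_gt0 : 0 < gap.

Lemma kappa01 : 0 <= kappa < 1.
Proof.
rewrite sqrtr_ge0 /= -[X in _ < X]sqrtr1 ltr_sqrt // ltrBlDr ltrDl.
exact: gap_gt0.
Qed.

Lemma nrm_step2_contract f : (forall i, \sum_(x in half_edges_in M i) f x = 0) ->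
  nrm (stepn 2 f) <= kappa * nrm f.
Proof.
move=> h; rewrite /kappa /nrm -sqrtrM; last by have := gap_le1 phi01 beta01; lra.
rewrite ler_sqrt ?mulr_ge0 ?sqn_ge0 //; last by have := gap_le1 phi01 beta01; lra.
exact: (step2_contract degree_ge3 etaK phi01 beta01 exp_eta nonbip_eta card_crossing).
Qed.

Lemma perpD f g : perp (fun x => f x + g x) =1 fun x => perp f x + perp g x.
Proof. by move=> x; rewrite /perp ipDl; ring. Qed.

Lemma perpZ (a : R) f : perp (fun x => a * f x) =1 fun x => a * perp f x.
Proof. by move=> x; rewrite /perp ipZl; ring. Qed.

Lemma eq_perp f g : f =1 g -> perp f =1 perp g.
Proof. by move=> h x; rewrite /perp h (eq_ip h (fun=> erefl)). Qed.

Lemma perp_chi x : perp chi x = 0.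
Proof. by rewrite /perp -/(sqn chi) sqn_chi mul1r subrr. Qed.

Lemma nrm_perp_chi : nrm (perp chi) = 0.
Proof. by rewrite /nrm sqnE big1 ?sqrtr0 // => x _; rewrite perp_chi expr0n. Qed.

Lemma nrm_perp_stepn t f : \sum_x f x = 0 ->
  nrm (perp (stepn t.+2 f)) <=
    `|ip f chi| * nrm (perp (stepn t.+2 chi)) + kappa * nrm (perp f).
Proof.
move=> f0.
rewrite (@eq_nrm _ _ _ (fun x => ip f chi * perp (stepn t.+2 chi) x
   + perp (stepn t.+2 (perp f)) x)); last first.
  move=> x; rewrite -perpZ -perpD; apply: eq_perp => y.
  rewrite -stepn_scale -stepn_add; apply: eq_stepn => z; rewrite /perp; ring.
apply: le_trans (nrmD _ _) _; rewrite nrmZ lerD2l.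
apply: le_trans (nrm_perp _) _.
rewrite -[t.+2]addn2 stepnD; apply: le_trans (nrm_stepn_le degree_ge3 etaK _ _) _.
by apply: nrm_step2_contract => i; apply: perp_sum0.
Qed.

Lemma nrm_perp_step2_chi : nrm (perp (stepn 2 chi)) <= 2 * drift.
Proof.
rewrite (@eq_nrm _ _ _ (perp (fun x => stepn 2 chi x - chi x))).
  by apply: le_trans (nrm_perp _) _; apply: nrm_step2_chi.
move=> x; have h := perpD (fun x => stepn 2 chi x) (fun x => -1 * chi x) x.
rewrite perpZ perp_chi mulr0 addr0 in h; rewrite -h.
by apply: eq_perp => y; rewrite mulN1r.
Qed.

Lemma sum_stepn_chi t : \sum_x stepn t chi x = 0.
Proof. by rewrite (sum_stepn eta degree_ge3) sum_chi. Qed.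

Lemma drift_ge0 : 0 <= drift. Proof. exact: nrm_ge0. Qed.

(** Each double step leaks at most 2 [drift] out of [chi] and damps earlier leakage by [kappa]; the
    geometric series makes the bound uniform in time. *)
Lemma nrm_perp_stepn_chi l :
  nrm (perp (stepn (2 * l) chi)) <= 2 * drift / (1 - kappa).
Proof.
have /andP[k0 k1] := kappa01; have k1' : 0 < 1 - kappa by lra.
elim: l => [|l IH].
  by rewrite muln0 nrm_perp_chi divr_ge0 ?mulr_ge0 ?drift_ge0 // ltW.
have -> : (2 * l.+1 = 2 + 2 * l)%N by rewrite mulnS.
rewrite stepnD; apply: le_trans (nrm_perp_stepn 0 (sum_stepn_chi _)) _.
have h : `|ip (stepn (2 * l) chi) chi| <= 1.
  apply: le_trans (ip_chi_le _) _; rewrite -(nrm_chi R M).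
  exact: nrm_stepn_le.
have h2 : `|ip (stepn (2 * l) chi) chi| * nrm (perp (stepn 2 chi)) <= 1 * (2 * drift).
  by rewrite ler_pM ?nrm_ge0 // nrm_perp_step2_chi.
have h3 := ler_wpM2l k0 IH.
have e : 2 * drift / (1 - kappa) * (1 - kappa) = 2 * drift by rewrite divfK // lt0r_neq0.
lra.
Qed.

Lemma ip_stepn_chi_le t : 1 - ip (stepn t chi) chi <= t%:R * omega / rho.
Proof.
rewrite ip_stepn_chi //.
apply: (@le_trans _ _ (\sum_x (rho * N)^-1 * crossed R eta t x)).
  apply: ler_sum => x _; have /andP[oth0 _] := other01 R eta degree_ge3 t x.
  apply: ler_pM => //; last exact: other_le_crossed.
  by rewrite lef_pV2 ?balanced // posrE ?mulr_gt0 // ltr0n nhalf_in_gt0.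
rewrite -mulr_sumr mulrC ler_pdivrMr ?mulr_gt0 //.
have := sum_crossed_le R degree_ge3 card_crossing t.
by move/le_trans; apply; rewrite le_eqVlt; apply/orP; left; apply/eqP; rewrite /omega; field;
  rewrite !lt0r_neq0.
Qed.

Lemma ip_stepn_chi_ge t :
  \sum_(x in crossing eta) step (crossed R eta t) x <= (noutgoing M)%:R / 2 ->
  t%:R * omega / 2 <= 1 - ip (stepn t chi) chi.
Proof.
move=> h; rewrite ip_stepn_chi //.
apply: (@le_trans _ _ (\sum_x N^-1 * other R eta t x)); last first.
  apply: ler_sum => x _; have /andP[oth0 _] := other01 R eta degree_ge3 t x.
  rewrite ler_wpM2r // lef_pV2 ?posrE // ?ltr0n ?nhalf_in_gt0 // ler_nat /nhalf.
  by case: (community _); rewrite ?leq_addr ?leq_addl.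
rewrite -mulr_sumr [X in _ <= X]mulrC ler_pdivlMr //.
have := sum_other_ge R degree_ge3 card_crossing (leqnn t).
apply: le_trans.
rewrite (_ : t%:R * omega / 2 * N = t%:R * (noutgoing M)%:R); last first.
  by rewrite /omega; field; rewrite lt0r_neq0.
by rewrite ler_wpM2l //; lra.
Qed.

Lemma dist_ge0 t : 0 <= dist R eta t.
Proof. by rewrite /dist; apply/bigmax_geP; left. Qed.

(** The law of the walk is tested against [chi], whose values are at most 1 / sqrt(rho N) in
    absolute value, and the result is summed over the starting half-edges. *)
Lemma ip_chi_dist t : rho / 2 * ip (stepn t chi) chi <= dist R eta t.
Proof.
have i0 : 0 <= (rho * N)^-1 by rewrite invr_ge0 mulr_ge0 // ltW.
have cb (x : H) : `|chi x| <= Num.sqrt ((rho * N)^-1).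
  rewrite -sqrtr_sqr ler_sqrt //.
  have n0 : 0 < (nhalf_in M false)%:R :> R by rewrite ltr0n nhalf_in_gt0.
  have n1 : 0 < (nhalf_in M true)%:R :> R by rewrite ltr0n nhalf_in_gt0.
  have b0 := balanced false; have b1 := balanced true.
  have Ne := nhalfE R M.
  rewrite /chi /chi_at expr_div_n chi_norm2 ler_pdivrMr ?mulr_gt0 //.
  have -> : (rho * N)^-1 * ((nhalf_in M false)%:R * (nhalf_in M true)%:R * N) =
     (nhalf_in M false)%:R * (nhalf_in M true)%:R / rho.
    by field; rewrite !lt0r_neq0.
  rewrite ler_pdivlMr // Ne in b0 b1 *.
  have r0 := rho_gt0.
  by case: ifP => _; rewrite ?sqrrN expr2; nra.
have s1 x : \sum_y `|P t x y - N^-1| = 2 * dist_from R eta x t.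
  have h0 : \sum_y (P t x y - N^-1) = 0.
    rewrite sumrB (sum_nbrw_iter R eta degree_ge3) sumr_const card_half_edge.
    by rewrite -[_ *+ _]mulr_natl divff ?subrr // lt0r_neq0.
  rewrite (eq_bigr (fun y => 2 * Num.max 0 (N^-1 - P t x y) + (P t x y - N^-1))).
    by rewrite big_split /= h0 addr0 -mulr_sumr.
  move=> y _.
  by case: (lerP 0 (N^-1 - P t x y)) => h; [rewrite ler0_norm|rewrite ger0_norm]; lra.
have -> : ip (stepn t chi) chi = \sum_x \sum_y (P t x y - N^-1) * (chi y * chi x).
  apply: eq_bigr => x _; rewrite stepn_nbrw_iter.
  rewrite [RHS](eq_bigr (fun y => P t x y * chi y * chi x - N^-1 * chi x * chi y)); last first.
    by move=> y _; ring.
  by rewrite sumrB -mulr_suml -mulr_sumr sum_chi mulr0 subr0.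
have h : \sum_x \sum_y (P t x y - N^-1) * (chi y * chi x) <=
    \sum_(x : H) (rho * N)^-1 * (2 * dist R eta t).
  apply: ler_sum => x _; apply: (@le_trans _ _ ((rho * N)^-1 * \sum_y `|P t x y - N^-1|)).
    rewrite mulr_sumr ler_sum // => y _; apply: le_trans (ler_norm _) _.
    rewrite normrM mulrC ler_wpM2r // normrM.
    by rewrite -[(rho * N)^-1]sqr_sqrtr // expr2 ler_pM.
  rewrite ler_wpM2l // s1 ler_pM2l //.
  exact: (@le_bigmax _ _ _ 0 (fun x => dist_from R eta x t)).
rewrite sumr_const card_half_edge -[(_ * _) *+ _]mulr_natl in h.
have e : N * ((rho * N)^-1 * (2 * dist R eta t)) = 2 / rho * dist R eta t.
  by field; rewrite !lt0r_neq0.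
rewrite e in h; have := ler_wpM2l (_ : 0 <= rho / 2) h.
move/(_ (divr_ge0 (ltW rho_gt0) (ler0n _ _)))/le_trans; apply.
by rewrite mulrA (_ : rho / 2 * (2 / rho) = 1) ?mul1r //; field; rewrite lt0r_neq0.
Qed.

Lemma dist_lower l :
  2 * omega / rho <= (1 - kappa) / 4 -> 16 * drift ^+ 2 <= (1 - kappa) ^+ 2 / 4 ->
  rho / 2 * (1 - 2 * omega / rho - 16 * drift ^+ 2 / (1 - kappa)) ^+ l <= dist R eta (2 * l).
Proof.
have r2 : 0 <= rho / 2 by rewrite divr_ge0 // ltW.
move=> h1 h2; apply: le_trans (ip_chi_dist _); rewrite ler_wpM2l //.
have /andP[k0 k1] := kappa01; have k1' : 0 < 1 - kappa by lra.
have e16 : 4 * (2 * drift) ^+ 2 = 16 * drift ^+ 2 by ring.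
pose g := 1 - ip (stepn 2 chi) chi.
have hg : g <= 2 * omega / rho by exact: ip_stepn_chi_le.
have := @two_by_two_lower _ (fun l => ip (stepn (2 * l) chi) chi)
  (fun l => nrm (perp (stepn (2 * l) chi))) g kappa (2 * drift) kappa01.
have twoS k : (2 * k.+1 = 2 + 2 * k)%N by rewrite mulnS.
rewrite e16 => /(_ _ _ h2) h; apply: (le_trans _ (h _ _ _ _ _ _ _ l)).
- have : 16 * drift ^+ 2 / (1 - kappa) <= (1 - kappa) / 4 by rewrite ler_pdivrMr //; lra.
  move=> h5; rewrite lerXn2r ?nnegrE; lra.
- by rewrite mulr_ge0 ?drift_ge0.
- exact: le_trans hg h1.
- by rewrite muln0 -/(sqn chi) sqn_chi.
- by rewrite muln0 nrm_perp_chi.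
- move=> k; rewrite twoS stepnD.
  have := ip_stepn_perp degree_ge3 etaK 2 (stepn (2 * k) chi).
  rewrite ler_norml => /andP[h5 _].
  have h6 : nrm (perp (stepn (2 * k) chi)) * (2 * drift + nrm (fun x => stepn 2 chi x - chi x))
      <= nrm (perp (stepn (2 * k) chi)) * (4 * drift).
    rewrite ler_wpM2l ?nrm_ge0 //; have := nrm_step2_chi R degree_ge3 etaK; rewrite -/drift; lra.
  rewrite /g; lra.
- by move=> k; apply: nrm_ge0.
- move=> k; rewrite twoS stepnD.
  apply: le_trans (nrm_perp_stepn 0 (sum_stepn_chi _)) _.
  rewrite addrC lerD2l mulrC ler_wpM2r //; exact: nrm_perp_step2_chi.
Qed.

(** In the intended use both sides of the condition on B^2 are of order alpha, and the left one does
    not depend on J: a long enough block satisfies it. The first hypothesis makes a second crossing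
    within a block rare, so that the rate of a block is truly proportional to J. *)
Lemma dist_from_upper k l t x (J := (2 * k.+1)%N) (B := 5 * drift / (1 - kappa)) :
  \sum_(x in crossing eta) step (crossed R eta J) x <= (noutgoing M)%:R / 2 ->
  J%:R * omega / rho <= drift -> J%:R * omega / rho <= 1 - kappa ->
  4 * B ^+ 2 <= J%:R * omega / 2 * (1 - kappa) -> 2 * B / (1 - kappa) <= 1 ->
  (2 * m0 + J * l <= t)%N ->
  dist_from R eta x t <= Num.sqrt flat *
    (2 * (1 - J%:R * omega / 4) ^+ l + kappa ^+ l + 2 * B / (1 - kappa)).
Proof.
move=> hR hJ1 hJ2 hB hB2 ht.
have /andP[k0 k1] := kappa01; have k1' : 0 < 1 - kappa by lra.
have A0 : 0 <= flat by apply: le_trans flat_ge1.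
pose u := stepn (2 * m0) (dirac_density (eta x)); pose f z := u z - 1.
have su : \sum_z u z = N by rewrite (sum_stepn eta degree_ge3) sum_dirac_density.
have sf : \sum_z f z = 0.
  rewrite /f sumrB su.
  by rewrite sumr_const card_half_edge subrr.
have nf : nrm f <= Num.sqrt (flat * N).
  rewrite /nrm ler_sqrt; last by rewrite mulr_ge0 // ltW.
  apply: le_trans (sqn_dirac_density (eta x) (leqnn _)); rewrite -/u.
  rewrite /f sqnB [ip u _](eq_bigr u); last by move=> z _; rewrite mulr1.
  rewrite su.
  rewrite [sqn (fun=> 1)]sqnE (eq_bigr (fun=> 1)); last by move=> z _; rewrite expr1n.
  by rewrite sumr_const card_half_edge; have := N_gt0; lra.
have aJ0 := ip_stepn_chi_ge hR; have aJ1 := ip_stepn_chi_le J.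
set F := Num.sqrt (flat * N) in nf; have F0 : 0 <= F by apply: sqrtr_ge0.
pose a l := `|ip (stepn (J * l) f) chi|; pose e l := nrm (perp (stepn (J * l) f)).
have B0 : 0 <= B by rewrite /B divr_ge0 ?mulr_ge0 ?drift_ge0 // ltW.
have om0 : 0 <= J%:R * omega / 2 by rewrite divr_ge0 ?mulr_ge0 ?invr_ge0.
have hBd : 2 * drift / (1 - kappa) + 3 * drift <= B.
  have : drift <= drift / (1 - kappa).
    by rewrite ler_pdivlMr // ler_piMr ?drift_ge0 //; lra.
  rewrite /B; lra.
have hpJ : nrm (perp (stepn J chi)) <= 2 * drift / (1 - kappa) by apply: nrm_perp_stepn_chi.
have hdJ : nrm (fun x => stepn J chi x - chi x) <= drift + 2 * drift / (1 - kappa).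
  apply: le_trans (nrm_le_perp _) _; apply: lerD.
    rewrite ipBl -/(sqn chi) sqn_chi -normrN opprB ger0_norm; first exact: le_trans hJ1.
    exact: le_trans aJ0.
  rewrite (@eq_nrm _ _ _ (perp (stepn J chi))) // => z.
  have h := perpD (fun x => stepn J chi x) (fun x => -1 * chi x) z.
  rewrite perpZ perp_chi mulr0 addr0 in h; rewrite -h.
  by apply: eq_perp => y; rewrite mulN1r.
have := @two_by_two _ a e (J%:R * omega / 2) kappa B.
have gk : J%:R * omega / 2 <= 1 - kappa by apply: le_trans hJ2; apply: le_trans aJ1.
move=> /(_ _ kappa01 B0 hB) h.
have hS m z : stepn (J * m.+1) f z = stepn J (stepn (J * m) f) z by rewrite mulnS stepnD.
have sfm m : \sum_z stepn (J * m) f z = 0 by rewrite (sum_stepn eta degree_ge3).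
have {}h := h _ _ _ _ _ l; rewrite om0 gk in h.
have {h} [h1 h2] : a l <= (1 - J%:R * omega / 2 / 2) ^+ l * (a 0%N + 2 * B / (1 - kappa) * e 0%N) /\
    e l <= kappa ^+ l * e 0%N + B / (1 - kappa) * (a 0%N + 2 * B / (1 - kappa) * e 0%N).
  have a0 m : 0 <= a m by apply: normr_ge0.
  have e0 m : 0 <= e m by apply: nrm_ge0.
  apply: h => //.
  - move=> m; rewrite /a (eq_ip (hS m) (fun=> erefl)).
    have h := ip_stepn_perp degree_ge3 etaK J (stepn (J * m) f).
    have h3 : nrm (perp (stepn (J * m) f)) * (2 * drift + nrm (fun x => stepn J chi x - chi x))
        <= B * e m.
      by rewrite mulrC ler_wpM2r ?nrm_ge0 //; lra.
    set b := ip (stepn (J * m) f) chi in h *; set c := ip (stepn J chi) chi in h aJ0 aJ1.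
    have c0 : 0 <= c by lra.
    have : `|b * c| <= (1 - J%:R * omega / 2) * `|b|.
      by rewrite normrM mulrC ler_wpM2r // ger0_norm //; lra.
    have := lerB_normD (ip (stepn J (stepn (J * m) f)) chi) (- (b * c)).
    rewrite normrN; lra.
  - move=> m; rewrite /e (eq_nrm (eq_perp (hS m))).
    have h := @nrm_perp_stepn (2 * k) (stepn (J * m) f) (sfm m).
    rewrite (_ : (2 * k).+2 = J) in h; last by rewrite /J mulnS.
    apply: le_trans h _.
    rewrite addrC lerD2l mulrC ler_wpM2r // (le_trans hpJ) //.
    have := drift_ge0; lra.
have a0F : a 0%N <= F by rewrite /a muln0; apply: le_trans (ip_chi_le _) nf.
have e0F : e 0%N <= F by rewrite /e muln0; apply: le_trans (nrm_perp _) nf.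
have v2 : a 0%N + 2 * B / (1 - kappa) * e 0%N <= 2 * F.
  have : 2 * B / (1 - kappa) * e 0%N <= 1 * F.
    apply: ler_pM => //; first exact: divr_ge0 (mulr_ge0 (ler0n _ 2) B0) (ltW k1').
    exact: nrm_ge0.
  lra.
have hn : nrm (stepn (J * l) f) <=
    F * (2 * (1 - J%:R * omega / 4) ^+ l + kappa ^+ l + 2 * B / (1 - kappa)).
  apply: le_trans (nrm_le_perp _) _; rewrite -/(a l) -/(e l).
  have q0 : 0 <= (1 - J%:R * omega / 4) ^+ l.
    by apply: exprn_ge0; have := om0; have := gk; lra.
  have e4 : J%:R * omega / 2 / 2 = J%:R * omega / 4 by field.
  rewrite e4 in h1; have h3 := ler_wpM2l q0 v2.
  have h4 : kappa ^+ l * e 0%N <= kappa ^+ l * F by rewrite ler_wpM2l // exprn_ge0.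
  have h5 : B / (1 - kappa) * (a 0%N + 2 * B / (1 - kappa) * e 0%N) <= B / (1 - kappa) * (2 * F).
    by rewrite ler_wpM2l // divr_ge0 // ltW.
  by rewrite !mulrDr; lra.
(* Time reversal replaces the law started at [x] by the evolved density of the point mass at
   [eta x], to which the operator bounds apply. *)
apply: (@le_trans _ _ (N^-1 * \sum_z `|stepn t (dirac_density (eta x)) z - 1|)).
  rewrite mulr_sumr /dist_from (reindex_inj (@perm_inj _ eta)) ler_sum // => z _ /=.
  rewrite stepn_dirac_density nbrw_iter_rev // etaK.
  have -> : `|N * P t z (eta x) - 1| = N * `|N^-1 - P t z (eta x)|.
    rewrite distrC -[X in X * `|_|]ger0_norm ?ltW // -normrM mulrBr divff // lt0r_neq0 //.
  rewrite mulrA mulVf ?mul1r ?lt0r_neq0 // ge_max normr_ge0 ler_norm //.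
have -> : \sum_z `|stepn t (dirac_density (eta x)) z - 1| =
    \sum_z `|stepn (t - (2 * m0 + J * l)) (stepn (J * l) f) z|.
  apply: eq_bigr => z _; congr `|_|.
  have tE : (t = t - (2 * m0 + J * l) + (J * l + 2 * m0))%N.
    by rewrite [(J * l + _)%N]addnC subnK.
  rewrite {1}tE 2!stepnD -/u.
  have fE y : stepn (J * l) f y = stepn (J * l) u y - 1 by rewrite stepn_sub stepn_cst.
  by rewrite (eq_stepn _ _ fE) stepn_sub stepn_cst.
apply: (@le_trans _ _ (N^-1 * (Num.sqrt #|H|%:R * nrm (stepn (J * l) f)))).
  rewrite ler_wpM2l ?invr_ge0 //; apply: le_trans (sum_norm_le_nrm _) _.
  by rewrite ler_wpM2l ?sqrtr_ge0 // nrm_stepn_le.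
rewrite card_half_edge; have sN : 0 <= Num.sqrt N by apply: sqrtr_ge0.
apply: (@le_trans _ _ (N^-1 * (Num.sqrt N * (F *
   (2 * (1 - J%:R * omega / 4) ^+ l + kappa ^+ l + 2 * B / (1 - kappa)))))).
  by rewrite ler_wpM2l ?invr_ge0 // ler_wpM2l.
rewrite /F sqrtrM // -{1}[N]sqr_sqrtr; last exact: ltW.
rewrite expr2.
rewrite le_eqVlt; apply/orP; left; apply/eqP; field.
by apply/andP; split; apply: lt0r_neq0 => //; rewrite sqrtr_gt0.
Qed.

End Distance.

(** * Averages over finite sets *)

Section Average.
Variables (R : realType) (T : finType).
Implicit Types (A : {set T}) (F G : T -> R).

Lemma average_le A F G : (forall x, x \in A -> F x <= G x) -> average A F <= average A G.
Proof. by move=> h; rewrite ler_wpM2r ?invr_ge0 // ler_sum. Qed.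

Lemma eq_average A F G : (forall x, x \in A -> F x = G x) -> average A F = average A G.
Proof. by move=> h; rewrite /average (eq_bigr G). Qed.

Lemma averageD A F G : average A (fun x => F x + G x) = average A F + average A G.
Proof. by rewrite /average big_split mulrDl. Qed.

Lemma averageZ A (a : R) F : average A (fun x => a * F x) = a * average A F.
Proof. by rewrite /average -mulr_sumr mulrA. Qed.

Lemma average_cst A (a : R) : A != finset.set0 -> average A (fun=> a) = a.
Proof.
rewrite -card_gt0 => h; rewrite /average sumr_const -[_ *+ _]mulr_natr mulfK //.
by rewrite pnatr_eq0 -lt0n.
Qed.

Lemma average_imset (h : T -> T) A F : injective h ->
  average [set h x | x in A]%SET F = average A (fun x => F (h x)).
Proof.
move=> hi; rewrite /average card_imset // big_imset //=.
by move=> x y _ _; apply: hi.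
Qed.

End Average.

(** * Pairings and matchings: conjugation and existence *)

Section PairingSets.
Variable T : finType.
Implicit Types (A B : {set T}) (s u : {perm T}).

Lemma pairingsP A s :
  reflect ((forall x, s (s x) = x) /\ (forall x, (s x != x) = (x \in A))) (s \in pairings A).
Proof.
rewrite inE; apply: (iffP forallP) => [h|[h1 h2] x].
  by split=> x; have /andP[/eqP h1 /eqP h2] := h x.
by rewrite h1 h2 !eqxx.
Qed.

Lemma pairings_conj u A s : ((s ^ u)%g \in pairings [set u x | x in A]%SET) = (s \in pairings A).
Proof.
apply/pairingsP/pairingsP => -[h1 h2]; split=> x.
- by apply: (@perm_inj _ u); rewrite -(permJ s u) -(permJ s u) h1.
- by rewrite -[RHS](mem_imset _ _ (@perm_inj _ u)) -h2 permJ (inj_eq perm_inj).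
- by rewrite -[x](permKV u) !permJ h1.
- by rewrite -[x](permKV u) !permJ (inj_eq perm_inj) h2 (mem_imset _ _ (@perm_inj _ u)).
Qed.

Lemma pairings_imset u A :
  pairings [set u x | x in A]%SET = [set (s ^ u)%g | s in pairings A]%SET.
Proof.
apply/setP => s; rewrite -[s](conjgKV u) pairings_conj (mem_imset _ _ (conjg_inj u)) //.
Qed.

Lemma in_matchings A B s :
  (s \in matchings A B) = (s \in pairings (A :|: B)%SET) && [forall x in A, s x \in B].
Proof. by rewrite inE. Qed.

Lemma matchings_imset u A B :
  matchings [set u x | x in A]%SET [set u x | x in B]%SET = [set (s ^ u)%g | s in matchings A B]%SET.
Proof.
apply/setP => s; rewrite -[s](conjgKV u) (mem_imset _ _ (conjg_inj u)).
set t := (s ^ _)%g; rewrite !in_matchings -imsetU pairings_conj; congr (_ && _).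
apply/forall_inP/forall_inP => h x.
  by move=> xA; rewrite -(mem_imset _ _ (@perm_inj _ u)) -permJ h // imset_f.
by case/imsetP => y yA ->; rewrite permJ (mem_imset _ _ (@perm_inj _ u)) h.
Qed.

Lemma pairings_mem A s x : s \in pairings A -> (s x \in A) = (x \in A).
Proof. by case/pairingsP => h1 h2; rewrite -!h2 h1 eq_sym. Qed.

Lemma pairings_out A s x : s \in pairings A -> x \notin A -> s x = x.
Proof. by case/pairingsP => h1 h2; rewrite -h2 negbK => /eqP. Qed.

Lemma matchings_neq0 A B : disjoint (mem A) (mem B) -> #|A| = #|B| -> matchings A B != finset.set0.
Proof.
move=> dAB cAB.
(* Elements of equal rank in the two enumerations are exchanged. *)
pose swap C D x := nth x (enum (D : {set T})) (index x (enum (C : {set T}))).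
have sw (C D : {set T}) x : #|C| = #|D| -> x \in C -> (swap C D x \in D) && (swap D C (swap C D x) == x).
  move=> cCD xC; have hi : (index x (enum C) < size (enum D))%N.
    by rewrite -cardE -cCD cardE index_mem mem_enum.
  have sD : swap C D x \in D by rewrite -mem_enum mem_nth.
  rewrite sD /=; apply/eqP; rewrite /swap.
  rewrite index_uniq ?enum_uniq // (set_nth_default x) ?nth_index ?mem_enum //.
  by rewrite -cardE cCD cardE.
pose f x := if x \in A then swap A B x else if x \in B then swap B A x else x.
have nAB x : x \in B -> x \in A = false by move=> xB; apply: (disjointFl dAB).
have fA x : x \in A -> (f x \in B) && (f (f x) == x).
  move=> xA; have /andP[h1 h2] := sw A B x cAB xA.
  by rewrite /f xA h1 /= (nAB _ h1).
have fB x : x \in B -> (f x \in A) && (f (f x) == x).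
  move=> xB; have /andP[h1 h2] := sw B A x (esym cAB) xB.
  by rewrite /f (nAB _ xB) xB h1.
have fK x : f (f x) = x.
  case xA: (x \in A); first by case/andP: (fA _ xA) => _ /eqP.
  case xB: (x \in B); first by case/andP: (fB _ xB) => _ /eqP.
  by rewrite /f xA xB xA xB.
apply/set0Pn; exists (perm (can_inj fK)); rewrite inE; apply/andP; split.
  apply/pairingsP; split=> x; rewrite !permE ?fK // inE.
  case xA: (x \in A) => /=.
    have /andP[h _] := fA _ xA; apply/eqP => e; move: h; rewrite e => /nAB.
    by rewrite xA.
  case xB: (x \in B) => /=.
    have /andP[h _] := fB _ xB; apply/eqP => e; move: h; rewrite e.
    by rewrite xA.
  by rewrite /f xA xB eqxx.
by apply/forall_inP => x xA; rewrite permE; case/andP: (fA _ xA).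
Qed.

Lemma subset_of_card A k : (k <= #|A|)%N ->
  [set B : {set T} | (B \subset A) && (#|B| == k)]%SET != finset.set0.
Proof. by move=> h; rewrite -card_gt0 cards_draws bin_gt0. Qed.

(** A set of even size is cut into two halves, which are then matched. *)
Lemma pairings_neq0 A : ~~ odd #|A| -> pairings A != finset.set0.
Proof.
move=> oA; have h : (#|A|./2 <= #|A|)%N by rewrite -{2}(odd_double_half #|A|) -addnn addnA leq_addl.
case/set0Pn: (subset_of_card h) => B; rewrite inE => /andP[BA /eqP cB].
have cD : #|A :\: B| = #|B|.
  rewrite cardsD (finset.setIidPr BA) cB -{1}(odd_double_half #|A|) (negPf oA) add0n -addnn addnK //.
have dB : disjoint (mem B) (mem (A :\: B)%SET).
  by rewrite -setI_eq0; apply/eqP/setP => x; rewrite !inE; case: (x \in B).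
case/set0Pn: (matchings_neq0 dB (esym cD)) => s; rewrite inE => /andP[sp _].
by apply/set0Pn; exists s; rewrite -(finset.setID A B) (finset.setIidPr BA).
Qed.

End PairingSets.

(** * The random pairing: exchangeability and successive revealing *)

Section Expectation.
Variables (R : realType) (M : two_community).
Local Notation H := (half_edge M).
Local Notation p := (noutgoing M).
Implicit Types (F G w : {perm H} -> R) (D : {set H}).

Definition expect F : R :=
  average (outgoing_sets M false) (fun O0 =>
  average (outgoing_sets M true) (fun O1 =>
  average (pairings (half_edges_in M false :\: O0)%SET) (fun s0 =>
  average (pairings (half_edges_in M true :\: O1)%SET) (fun s1 =>
  average (matchings O0 O1) (fun m => F (s0 * s1 * m)%g))))).

Lemma probE (E : pred {perm H}) : prob R E = expect (fun eta => (E eta)%:R).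
Proof. by []. Qed.

Definition valid (eta : {perm H}) := [/\ forall x, eta (eta x) = x, forall x, eta x != x
  & forall i, #|crossing eta :&: half_edges_in M i| = p].

Lemma outgoingP i (O : {set H}) : O \in outgoing_sets M i ->
  (forall x, x \in O -> community (tag x) = i) /\ #|O| = p.
Proof.
rewrite inE => /andP[/fintype.subsetP h /eqP ->]; split=> // x /h.
by rewrite inE => /eqP.
Qed.

Lemma valid_product O0 O1 s0 s1 m : O0 \in outgoing_sets M false -> O1 \in outgoing_sets M true ->
  s0 \in pairings (half_edges_in M false :\: O0)%SET ->
  s1 \in pairings (half_edges_in M true :\: O1)%SET -> m \in matchings O0 O1 ->
  valid (s0 * s1 * m)%g.
Proof.
move=> /outgoingP[out0 c0] /outgoingP[out1 c1] p0 p1; rewrite inE => /andP[pm /forall_inP mm].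
set eta := (s0 * s1 * m)%g.
have O10 x : x \in O0 -> x \in O1 = false.
  by move=> h; apply/negP => /out1; rewrite (out0 _ h).
have mO0 x : x \in O1 -> m x \in O0.
  have e : [set m x | x in O0]%SET = O1.
    apply/eqP; rewrite eqEcard card_imset ?c0 ?c1 ?leqnn ?andbT; last exact: perm_inj.
    by apply/fintype.subsetP => y /imsetP[z zO ->]; apply: mm.
  by rewrite -{1}e => /imsetP[y yO ->]; case/pairingsP: pm => ->.
have e_in0 x : community (tag x) = false -> x \notin O0 -> eta x = s0 x.
  move=> cx xO; have xA : x \in (half_edges_in M false :\: O0)%SET by rewrite !inE xO cx.
  have := pairings_mem x p0; rewrite xA !inE => /andP[h1 /eqP h2].
  rewrite /eta !permM (pairings_out p1) ?inE ?h2 ?andbF //.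
  by rewrite (pairings_out pm) // inE (negPf h1) /=; apply/negP => /out1; rewrite h2.
have e_in1 x : community (tag x) = true -> x \notin O1 -> eta x = s1 x.
  move=> cx xO; have xA : x \in (half_edges_in M true :\: O1)%SET by rewrite !inE xO cx.
  have := pairings_mem x p1; rewrite xA !inE => /andP[h1 /eqP h2].
  rewrite /eta !permM (pairings_out p0) ?inE ?cx ?andbF //.
  by rewrite (pairings_out pm) // inE (negPf h1) orbF; apply/negP => /out0; rewrite h2.
have e_out x : x \in (O0 :|: O1)%SET -> eta x = m x.
  rewrite inE => /orP[xO|xO]; rewrite /eta !permM (pairings_out p0) ?(pairings_out p1) //.
  - by rewrite !inE (out0 _ xO) andbF.
  - by rewrite !inE xO.
  - by rewrite !inE xO.
  - by rewrite !inE (out1 _ xO) andbF.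
have inv x : (eta (eta x) = x) /\ (eta x != x).
  case xO: (x \in (O0 :|: O1)%SET).
    have mx : m x \in (O0 :|: O1)%SET by rewrite (pairings_mem _ pm).
    have /pairingsP[h1 h2] := pm.
    by rewrite e_out // e_out // h1 h2.
  move: (xO); rewrite inE => /norP[x0 x1].
  case cx: (community (tag x)).
    have xA : x \in (half_edges_in M true :\: O1)%SET by rewrite !inE x1 cx.
    have := pairings_mem x p1; rewrite xA !inE => /andP[g1 /eqP g2].
    have /pairingsP[h1 h2] := p1.
    by rewrite e_in1 // e_in1 // h1 h2.
  have xA : x \in (half_edges_in M false :\: O0)%SET by rewrite !inE x0 cx.
  have := pairings_mem x p0; rewrite xA !inE => /andP[g1 /eqP g2].
  have /pairingsP[h1 h2] := p0.
  by rewrite e_in0 // e_in0 // h1 h2.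
split=> [x|x|i]; [by case: (inv x)|by case: (inv x)|].
have -> : (crossing eta :&: half_edges_in M i)%SET = if i then O1 else O0.
  apply/setP => x; rewrite !inE.
  case cx: (community (tag x)); case: i => /=; rewrite ?andbF ?andbT.
  - case xO: (x \in O1).
      by rewrite e_out ?inE ?xO ?orbT // (out0 _ (mO0 _ xO)).
    have := pairings_mem x p1; rewrite !inE xO cx /= => /andP[_ /eqP h].
    by rewrite e_in1 ?xO // h.
  - by apply/esym/negP => /out0; rewrite cx.
  - by apply/esym/negP => /out1; rewrite cx.
  - case xO: (x \in O0).
      by rewrite e_out ?inE ?xO // (out1 _ (mm _ xO)).
    have := pairings_mem x p0; rewrite !inE xO cx /= => /andP[_ /eqP h].
    by rewrite e_in0 ?xO // h.
by case: i.
Qed.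

Lemma expect_le F G : (forall eta, valid eta -> F eta <= G eta) -> expect F <= expect G.
Proof.
move=> h; apply: average_le => O0 h0; apply: average_le => O1 h1.
apply: average_le => s0 h2; apply: average_le => s1 h3; apply: average_le => m h4.
by apply: h; apply: (valid_product h0 h1 h2 h3 h4).
Qed.

Lemma eq_expect F G : (forall eta, valid eta -> F eta = G eta) -> expect F = expect G.
Proof. by move=> h; apply/eqP; rewrite eq_le !expect_le // => eta /h ->. Qed.

Lemma expectD F G : expect (fun eta => F eta + G eta) = expect F + expect G.
Proof.
rewrite /expect -averageD; apply: eq_average => O0 _.
rewrite -averageD; apply: eq_average => O1 _.
rewrite -averageD; apply: eq_average => s0 _.
rewrite -averageD; apply: eq_average => s1 _.
by rewrite -averageD.
Qed.

Lemma expectZ (a : R) F : expect (fun eta => a * F eta) = a * expect F.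
Proof.
rewrite /expect -averageZ; apply: eq_average => O0 _.
rewrite -averageZ; apply: eq_average => O1 _.
rewrite -averageZ; apply: eq_average => s0 _.
rewrite -averageZ; apply: eq_average => s1 _.
by rewrite -averageZ.
Qed.

Lemma expect_cst (a : R) : expect (fun=> a) = a.
Proof.
have ne i : outgoing_sets M i != finset.set0.
  by apply: subset_of_card; rewrite card_half_edges_in noutgoing_le.
have ev i O : O \in outgoing_sets M i -> pairings (half_edges_in M i :\: O)%SET != finset.set0.
  rewrite inE => /andP[h /eqP c]; apply: pairings_neq0.
  rewrite cardsD (finset.setIidPr h) card_half_edges_in oddB ?noutgoing_le // c; last exact: noutgoing_le.
  have ei : odd (nhalf_in M i) = false by apply/negbTE/(@community_even M i).
  by rewrite ei (negPf (noutgoing_even M)).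
rewrite /expect -[RHS](average_cst _ (ne false)); apply: eq_average => O0 h0.
rewrite -[RHS](average_cst _ (ne true)); apply: eq_average => O1 h1.
rewrite -[RHS](average_cst _ (ev _ _ h0)); apply: eq_average => s0 _.
rewrite -[RHS](average_cst _ (ev _ _ h1)); apply: eq_average => s1 _.
rewrite average_cst //; have [out0 c0] := outgoingP h0; have [out1 c1] := outgoingP h1.
apply: matchings_neq0; last by rewrite c0.
rewrite -setI_eq0; apply/eqP/setP => x; rewrite !inE.
by apply/negbTE/negP => /andP[/out0 e /out1]; rewrite e.
Qed.

Lemma expect_ge0 F : (forall eta, valid eta -> 0 <= F eta) -> 0 <= expect F.
Proof. by move=> h; rewrite -(expect_cst 0) expect_le. Qed.

Lemma expect_sum (I : Type) (r : seq I) (Q : pred I) (F : I -> {perm H} -> R) :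
  expect (fun eta => \sum_(i <- r | Q i) F i eta) = \sum_(i <- r | Q i) expect (F i).
Proof.
elim: r => [|i r IH].
  by rewrite big_nil -[RHS](expect_cst 0); apply: eq_expect => eta _; rewrite big_nil.
rewrite big_cons -IH; case: ifP => h.
  by rewrite -expectD; apply: eq_expect => eta _; rewrite big_cons h.
by apply: eq_expect => eta _; rewrite big_cons h.
Qed.

Definition preserves_communities (u : {perm H}) :=
  forall x, community (tag (u x)) = community (tag x).

(** A permutation preserving the communities carries each of the five uniform choices to a uniform
    choice, so the law of the pairing is invariant under conjugation. The exchangeability estimates
    below rest on this. *)
Lemma expect_conj u F : preserves_communities u ->
  expect F = expect (fun eta => F (eta ^ u)%g).
Proof.
move=> hu; have uH i : [set u x | x in half_edges_in M i]%SET = half_edges_in M i.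
  apply/eqP; rewrite eqEcard card_imset ?leqnn ?andbT; last exact: perm_inj.
  by apply/fintype.subsetP => y /imsetP[x]; rewrite !inE => xi ->; rewrite hu.
pose h (O : {set H}) := [set u x | x in O]%SET.
have hi : injective h by exact: imset_inj (@perm_inj _ u).
have uO i : outgoing_sets M i = [set h O | O in outgoing_sets M i]%SET.
  apply/esym/eqP; rewrite eqEcard card_imset // leqnn andbT.
  apply/fintype.subsetP => X /imsetP[B]; rewrite !inE => /andP[h1 h2] ->.
  by rewrite -(uH i) imsetS // card_imset //; apply: perm_inj.
have uD i O : (half_edges_in M i :\: h O)%SET = [set u x | x in half_edges_in M i :\: O]%SET.
  apply/setP => y; rewrite -[y](permKV u) (mem_imset _ _ (@perm_inj _ u)) !finset.in_setD.
  by rewrite (mem_imset _ _ (@perm_inj _ u)) !half_edges_inE hu.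
rewrite /expect uO average_imset // -uO; apply: eq_average => O0 _.
rewrite uO average_imset // -uO; apply: eq_average => O1 _.
rewrite !uD !pairings_imset average_imset; last exact: conjg_inj.
apply: eq_average => s0 _; rewrite average_imset; last exact: conjg_inj.
apply: eq_average => s1 _; rewrite matchings_imset average_imset; last exact: conjg_inj.
by apply: eq_average => m _; rewrite !conjMg.
Qed.

(* The weights depending on the pairing only through the partners of the
   half-edges of D, for events under which D is closed under the pairing. *)
Definition weight_on D w := [/\ forall eta, 0 <= w eta,
  forall u, preserves_communities u -> (forall x, x \in D -> u x = x) ->
    forall eta, w (eta ^ u)%g = w eta
  & forall eta, valid eta -> w eta != 0 -> forall x, x \in D -> eta x \in D].

Lemma weight_on0 : weight_on finset.set0 (fun=> 1).
Proof. by split=> // eta _ _ x; rewrite inE. Qed.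

Lemma weight_onS D w x y : weight_on D w ->
  weight_on (x |: (y |: D))%SET (fun eta => w eta * (eta x == y)%:R).
Proof.
case=> w0 wu wc; split=> [eta|u hu uD eta|eta ve].
- by rewrite mulr_ge0.
- rewrite wu // => [|z zD]; last by apply: uD; rewrite !inE zD !orbT.
  have ux : u x = x by apply: uD; rewrite !inE eqxx.
  have uy : u y = y by apply: uD; rewrite !inE eqxx orbT.
  by rewrite -{1}ux permJ -{1}uy (inj_eq perm_inj).
rewrite mulf_eq0 => /norP[we]; rewrite pnatr_eq0 eqb0 negbK => /eqP e z.
have [eK _ _] := ve.
rewrite !inE => /or3P[/eqP->|/eqP->|zD]; first by rewrite e eqxx orbT.
  by rewrite -e eK eqxx.
by rewrite wc // !orbT.
Qed.

Lemma tperm_preserves (y y' : H) : community (tag y) = community (tag y') ->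
  preserves_communities (tperm y y').
Proof. by move=> e x; case: tpermP => [->|->|]. Qed.

(** Conjugation by the transposition of the two candidate partners leaves the weight unchanged and
    exchanges the two events. *)
Lemma expect_partner_sym D w x y y' : weight_on D w ->
  x \notin D -> y \notin D -> y' \notin D -> y != x -> y' != x ->
  community (tag y) = community (tag y') ->
  expect (fun eta => w eta * (eta x == y)%:R) = expect (fun eta => w eta * (eta x == y')%:R).
Proof.
move=> [_ wu _] xD yD y'D yx y'x e; rewrite (expect_conj _ (tperm_preserves e)).
apply: eq_expect => eta _; rewrite wu //; last first.
- by move=> z zD; rewrite tpermD //; [apply: contraNneq yD|apply: contraNneq y'D] => ->.
- exact: tperm_preserves.
have ux : tperm y y' x = x by rewrite tpermD.
have := permJ eta (tperm y y') x; rewrite ux => ->.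
by rewrite -[X in _ == X](tpermR y y') (inj_eq perm_inj).
Qed.

(** The unrevealed half-edges in the community of [y], other than [x], are equally likely partners
    of [x]. The predecessor covers the case where [x] is among them; the community of [x] itself is
    arbitrary. *)
Lemma partner_le D w x y : weight_on D w -> x \notin D -> y \notin D -> y != x ->
  (#|half_edges_in M (community (tag y)) :\: D|.-1)%:R *
    expect (fun eta => w eta * (eta x == y)%:R) <= expect w.
Proof.
move=> hw xD yD yx; have [w0 _ _] := hw.
set B := (half_edges_in M _ :\: D)%SET.
apply: (@le_trans _ _ (\sum_(z in (B :\ x)%SET) expect (fun eta => w eta * (eta x == z)%:R))).
  rewrite (eq_bigr (fun=> expect (fun eta => w eta * (eta x == y)%:R))); last first.
    move=> z; rewrite !inE => /and3P[zx zD /eqP zc].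
    by apply: expect_partner_sym hw _ _ _ _ _ _.
  rewrite sumr_const -[(expect _) *+ _]mulr_natl ler_wpM2r ?ler_nat //.
    by apply: expect_ge0 => eta _; rewrite mulr_ge0.
  by rewrite [#|B|](cardsD1 x); case: (x \in B) => //=; rewrite leq_pred.
rewrite -expect_sum; apply: expect_le => eta _.
rewrite -mulr_sumr -[X in _ <= X]mulr1 ler_wpM2l // -natr_sum.
rewrite -[1]/(1%:R) ler_nat.
rewrite big_mkcond (bigD1 (eta x)) //= big1 ?addn0; first by case: ifP; rewrite ?leq_b1.
by move=> z /negPf h; rewrite eq_sym h; case: ifP.
Qed.

Lemma partner_in_le D w x i (X : {set H}) : weight_on D w -> x \notin D ->
  X \subset (half_edges_in M i :\: D)%SET ->
  (#|half_edges_in M i :\: D|.-1)%:R * expect (fun eta => w eta * (eta x \in X)%:R)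
    <= #|X|%:R * expect w.
Proof.
move=> hw xD /fintype.subsetP XS; have [w0 _ _] := hw.
have -> : expect (fun eta => w eta * (eta x \in X)%:R) =
    \sum_(y in X) expect (fun eta => w eta * (eta x == y)%:R).
  rewrite -expect_sum; apply: eq_expect => eta _; rewrite -mulr_sumr; congr (_ * _).
  rewrite -natr_sum; congr (_%:R); rewrite big_mkcond (bigD1 (eta x)) //= eqxx big1 ?addn0.
    by case: ifP.
  by move=> z /negPf h; rewrite eq_sym h; case: ifP.
rewrite mulr_sumr mulr_natl -sumr_const; apply: ler_sum => y yX.
have := XS _ yX; rewrite !inE => /andP[yD /eqP yi].
have [->|yx] := eqVneq y x; last by rewrite -yi partner_le.
rewrite (_ : expect _ = 0) ?mulr0; first by apply: expect_ge0.
rewrite -[RHS](expect_cst 0); apply: eq_expect => eta [_ h _].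
by rewrite (negPf (h x)) mulr0.
Qed.

(** The unrevealed half-edges of a community cross with equal probability, so this probability is
    the expected fraction of crossing ones. *)
Lemma expect_crossing_sum D w x i : weight_on D w -> x \in (half_edges_in M i :\: D)%SET ->
  #|half_edges_in M i :\: D|%:R * expect (fun eta => w eta * (x \in crossing eta)%:R) =
  expect (fun eta => w eta * #|crossing eta :&: (half_edges_in M i :\: D)|%SET%:R).
Proof.
move=> hw; rewrite !inE => /andP[xD /eqP xi]; have [_ wu _] := hw.
rewrite mulr_natl -sumr_const.
rewrite (eq_bigr (fun z => expect (fun eta => w eta * (z \in crossing eta)%:R))).
  rewrite -expect_sum; apply: eq_expect => eta _; rewrite -mulr_sumr; congr (_ * _).
  rewrite -natr_sum -sum1_card; congr (_%:R); rewrite big_mkcond [RHS]big_mkcond.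
  by apply: eq_bigr => z _; rewrite [in RHS]inE; case: (z \in crossing eta); case: (z \in _).
move=> z; rewrite !inE => /andP[zD /eqP zi].
have e : community (tag x) = community (tag z) by rewrite xi zi.
rewrite (expect_conj _ (tperm_preserves e)); apply: eq_expect => eta _; rewrite wu.
- have := permJ eta (tperm x z) z; rewrite tpermR !inE => ->.
  by rewrite tperm_preserves // e.
- exact: tperm_preserves.
by move=> y yD; rewrite tpermD //; [apply: contraNneq xD|apply: contraNneq zD] => ->.
Qed.

Lemma crossing_le D w x i : weight_on D w -> x \in (half_edges_in M i :\: D)%SET ->
  #|half_edges_in M i :\: D|%:R * expect (fun eta => w eta * (x \in crossing eta)%:R) <=
  p%:R * expect w.
Proof.
move=> hw xi; rewrite (expect_crossing_sum hw xi) -expectZ; have [w0 _ _] := hw.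
apply: expect_le => eta [_ _ c]; rewrite mulrC ler_wpM2r // ler_nat -(c i).
by rewrite subset_leq_card // finset.setIS // finset.subsetDl.
Qed.

Lemma crossing_ge D w x i : weight_on D w -> x \in (half_edges_in M i :\: D)%SET ->
  (p%:R - #|D|%:R) * expect w <=
  #|half_edges_in M i :\: D|%:R * expect (fun eta => w eta * (x \in crossing eta)%:R).
Proof.
move=> hw xi; rewrite (expect_crossing_sum hw xi) -expectZ; have [w0 _ _] := hw.
apply: expect_le => eta [_ _ c]; rewrite mulrC ler_wpM2l // lerBlDr -natrD ler_nat -(c i).
apply: leq_trans (leq_card_setU _ _); rewrite subset_leq_card //.
by apply/fintype.subsetP => z; rewrite !inE => /andP[-> ->]; case: (z \in D).
Qed.

End Expectation.

(** * Probability that a set is closed or has prescribed partners *)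

Section PatternProbability.
Variables (R : realType) (M : two_community).
Local Notation H := (half_edge M).
Local Notation p := (noutgoing M).
Implicit Types (w : {perm H} -> R) (D X Y : {set H}).

Definition closed_under (X : {set H}) (eta : {perm H}) : bool := [forall x in X, eta x \in X].

Definition maps_into (X Y : {set H}) (eta : {perm H}) : bool := [forall x in X, eta x \in Y].

Lemma weight_ge0 D w : weight_on D w -> 0 <= expect w.
Proof. by case=> w0 _ _; apply: expect_ge0. Qed.

Lemma maps_into_step D w (X Y X' : {set H}) (Y' : H -> {set H}) x : weight_on D w -> x \in X ->
  (forall eta, valid eta -> w eta != 0 -> maps_into X Y eta -> maps_into X' (Y' (eta x)) eta) ->
  expect (fun eta => w eta * (maps_into X Y eta)%:R) <=
  \sum_(y in Y :\ x) expect (fun eta => w eta * (eta x == y)%:R * (maps_into X' (Y' y) eta)%:R).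
Proof.
move=> [w0 _ _] xX h; rewrite -expect_sum; apply: expect_le => eta ve.
case: (boolP (maps_into X Y eta)) => hm; last first.
  by rewrite mulr0 sumr_ge0 // => y _; rewrite !mulr_ge0.
have [->|nz] := eqVneq (w eta) 0; first by rewrite mul0r sumr_ge0 // => y _; rewrite !mul0r.
have exY : eta x \in (Y :\ x)%SET.
  by have [_ nf _] := ve; rewrite !inE nf; have /forall_inP := hm; apply.
by rewrite (bigD1 (eta x)) //= eqxx !mulr1 h // mulr1 lerDl sumr_ge0 // => y _; rewrite !mulr_ge0.
Qed.

Lemma expect_partner_sum D w x (Y : {set H}) : weight_on D w ->
  \sum_(y in Y) expect (fun eta => w eta * (eta x == y)%:R) =
  expect (fun eta => w eta * (eta x \in Y)%:R).
Proof.
move=> _; rewrite -expect_sum; apply: eq_expect => eta _; rewrite -mulr_sumr; congr (_ * _).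
rewrite -natr_sum; congr (_%:R); rewrite big_mkcond (bigD1 (eta x)) //= eqxx big1 ?addn0.
  by case: ifP.
by move=> z /negPf h; rewrite eq_sym h; case: ifP.
Qed.

Lemma partner_any_le D w x (X : {set H}) (m : nat) : weight_on D w -> x \notin D ->
  [disjoint X & D]%B -> (forall i, m < #|half_edges_in M i :\: D|%SET)%N -> (0 < m)%N ->
  expect (fun eta => w eta * (eta x \in X)%:R) <= #|X|%:R / m%:R * expect w.
Proof.
move=> hw xD dX hm m0; have w0 := weight_ge0 hw.
have mp : 0 < m%:R :> R by rewrite ltr0n.
have hi i : expect (fun eta => w eta * (eta x \in (X :&: half_edges_in M i)%SET)%:R) <=
    #|X :&: half_edges_in M i|%SET%:R / m%:R * expect w.
  have XS : (X :&: half_edges_in M i)%SET \subset (half_edges_in M i :\: D)%SET.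
    apply/fintype.subsetP => y; rewrite !inE => /andP[yX ->]; rewrite andbT.
    by rewrite (disjointFr dX yX).
  have := partner_in_le hw xD XS; set e := expect _ => h.
  rewrite mulrAC ler_pdivlMr // mulrC; apply: le_trans h.
  apply: ler_wpM2r; last by rewrite ler_nat; have := hm i; lia.
  by apply: expect_ge0 => eta _; case: hw => wp _ _; rewrite mulr_ge0.
have e1 : #|X|%:R = #|X :&: half_edges_in M false|%SET%:R + #|X :&: half_edges_in M true|%SET%:R :> R.
  rewrite -natrD -(cardsID (half_edges_in M false) X); congr (_ + _)%:R.
  by apply: eq_card => y; rewrite !inE; case: (community _); rewrite ?andbT ?andbF.
rewrite e1 !mulrDl; apply: le_trans (lerD (hi false) (hi true)).
rewrite -expectD; apply: expect_le => eta _.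
rewrite -mulrDr ler_wpM2l //; first by case: hw.
by rewrite -natrD ler_nat !inE; case: (community _); case: (_ \in X).
Qed.

Lemma card_weight_step (A D : {set H}) x y :
  (#|A :\: D| - 2 <= #|A :\: (x |: (y |: D))|%SET)%N.
Proof.
rewrite leq_subLR -(cardsID [set x; y]%SET (A :\: D)) leq_add //.
  by apply: leq_trans (subset_leq_card (finset.subsetIr _ _)) _; rewrite cards2; case: eqP.
apply: subset_leq_card; apply/fintype.subsetP => z; rewrite !inE.
by case: (z == x); case: (z == y).
Qed.

(** The pairs inside [X] are revealed one after the other, each at cost |X|/m. [X] may straddle the
    communities. For odd n the event is impossible. *)
Lemma closed_le n D w (X : {set H}) (m : nat) (t : R) : weight_on D w -> #|X| = n ->
  [disjoint X & D]%B -> (forall i, m + n <= #|half_edges_in M i :\: D|%SET)%N -> (0 < m)%N ->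
  #|X|%:R / m%:R <= t ->
  expect (fun eta => w eta * (closed_under X eta)%:R) <= t ^+ (uphalf n) * expect w.
Proof.
elim/ltn_ind: n D w X => n IH D w X hw cX dX hm m0 ht.
have w0 := weight_ge0 hw; have wp : forall eta, 0 <= w eta by case: hw.
have t0 : 0 <= t by apply: le_trans ht; rewrite divr_ge0.
have [n0|] := eqVneq n 0%N.
  by rewrite n0 mul1r; apply: expect_le => eta _; rewrite ler_piMr // lern1 leq_b1.
rewrite -{1}cX cards_eq0 => /set0Pn[x xX].
have xD : x \notin D by rewrite (disjointFr dX xX).
pose X' y := (X :\ x :\ y)%SET.
have h1 : expect (fun eta => w eta * (closed_under X eta)%:R) <=
  \sum_(y in X :\ x) expect (fun eta => w eta * (eta x == y)%:R * (closed_under (X' y) eta)%:R).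
  rewrite -expect_sum; apply: expect_le => eta ve; have [eK nf _] := ve.
  case: (boolP (closed_under X eta)) => hm'; last first.
    by rewrite mulr0 sumr_ge0 // => y _; rewrite !mulr_ge0.
  have /forall_inP hX := hm'.
  have exX : eta x \in (X :\ x)%SET by rewrite !inE nf hX.
  rewrite (bigD1 (eta x)) //= eqxx !mulr1.
  have -> : closed_under (X' (eta x)) eta.
    apply/forall_inP => z; rewrite !inE => /and3P[z1 z2 zX]; rewrite hX // (inj_eq perm_inj) z2.
    by rewrite -[X in _ == X](eK x) (inj_eq perm_inj) z1.
  by rewrite mulr1 lerDl sumr_ge0 // => y _; rewrite !mulr_ge0.
apply: le_trans h1 _.
have [n1|n2] := leqP n 1.
  have : (#|X :\ x| = 0)%N by move: (cardsD1 x X); rewrite xX cX; lia.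
  move/eqP; rewrite cards_eq0 => /eqP ->; rewrite big_set0.
  by rewrite mulr_ge0 // exprn_ge0.
apply: (@le_trans _ _ (\sum_(y in X :\ x) t ^+ (uphalf n).-1 * expect (fun eta => w eta * (eta x == y)%:R))).
  apply: ler_sum => y; rewrite !inE => /andP[yx yX].
  have cX' : #|X' y| = (n - 2)%N.
    have := cardsD1 x X; rewrite xX cX; have := cardsD1 y (X :\ x)%SET; rewrite !inE yx yX /X'.
    by move=> -> ->; lia.
  have -> : (uphalf n).-1 = uphalf (n - 2) by case: (n) n2 => [|[|k]] //; rewrite subn2.
  apply: (IH _ _ _ _ (X' y) (weight_onS x y hw) cX') => //.
  - lia.
  - rewrite -setI_eq0; apply/eqP/setP => z; rewrite !inE.
    case: (z == x); case: (z == y); rewrite ?andbF //=.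
    by case zX : (z \in X) => //=; rewrite (disjointFr dX zX).
  - move=> i; apply: leq_trans (card_weight_step _ _ x y).
    by have := hm i; lia.
  - apply: le_trans ht; rewrite ler_wpM2r ?invr_ge0 // ler_nat subset_leq_card //.
    by apply/fintype.subsetP => z; rewrite !inE => /and3P[].
rewrite -mulr_sumr (expect_partner_sum _ _ hw).
have -> : (uphalf n = (uphalf n).-1.+1)%N by case: (n) n2 => [|[|k]].
rewrite exprSr -mulrA /= ler_wpM2l ?exprn_ge0 //.
apply: (@le_trans _ _ (#|X :\ x|%:R / m%:R * expect w)).
  apply: (partner_any_le hw) => //.
    rewrite -setI_eq0; apply/eqP/setP => z; rewrite !inE.
    by case zX : (z \in X); rewrite ?andbF //= (disjointFr dX zX) andbF.
  by move=> i; have := hm i; lia.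
rewrite ler_wpM2r //; apply: le_trans ht; rewrite ler_wpM2r ?invr_ge0 // ler_nat.
by rewrite subset_leq_card // subD1set.
Qed.

(** The probability (k-1)(k-3)...1 / ((n-1)(n-3)...(n-k+1)) that a given set of even size k is a
    union of pairs in a uniform pairing of n points; it is 0 for odd k. *)
Fixpoint closed_rate (n k : nat) : R :=
  match k with
  | 0 => 1
  | 1 => 0
  | k'.+2 => k'.+1%:R / (n.-1)%:R * closed_rate (n - 2) k'
  end.

Lemma closed_rate_ge0 n k : 0 <= closed_rate n k.
Proof.
elim/ltn_ind: k n => -[|[|k]] IH n //=.
by rewrite mulr_ge0 ?divr_ge0 // IH.
Qed.

Lemma closed_in_le n D w (X : {set H}) i : weight_on D w -> #|X| = n ->
  X \subset (half_edges_in M i :\: D)%SET ->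
  expect (fun eta => w eta * (closed_under X eta)%:R) <=
  closed_rate #|half_edges_in M i :\: D|%SET n * expect w.
Proof.
elim/ltn_ind: n D w X => n IH D w X hw cX XS.
have w0 := weight_ge0 hw; have wp : forall eta, 0 <= w eta by case: hw.
have [n0|] := eqVneq n 0%N.
  by rewrite n0 mul1r; apply: expect_le => eta _; rewrite ler_piMr // lern1 leq_b1.
rewrite -{1}cX cards_eq0 => /set0Pn[x xX].
have /fintype.subsetP XS' := XS.
have /andP[xD xi] : (x \notin D) && (x \in half_edges_in M i).
  by have := XS' _ xX; rewrite !inE.
pose X' y := (X :\ x :\ y)%SET.
have h1 : expect (fun eta => w eta * (closed_under X eta)%:R) <=
  \sum_(y in X :\ x) expect (fun eta => w eta * (eta x == y)%:R * (closed_under (X' y) eta)%:R).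
  rewrite -expect_sum; apply: expect_le => eta ve; have [eK nf _] := ve.
  case: (boolP (closed_under X eta)) => hm'; last first.
    by rewrite mulr0 sumr_ge0 // => y _; rewrite !mulr_ge0.
  have /forall_inP hX := hm'.
  have exX : eta x \in (X :\ x)%SET by rewrite !inE nf hX.
  rewrite (bigD1 (eta x)) //= eqxx !mulr1.
  have -> : closed_under (X' (eta x)) eta.
    apply/forall_inP => z; rewrite !inE => /and3P[z1 z2 zX]; rewrite hX // (inj_eq perm_inj) z2.
    by rewrite -[X in _ == X](eK x) (inj_eq perm_inj) z1.
  by rewrite mulr1 lerDl sumr_ge0 // => y _; rewrite !mulr_ge0.
apply: le_trans h1 _.
have cX1 : #|X :\ x| = n.-1 by move: (cardsD1 x X); rewrite xX cX; lia.
have [n1|n2] := leqP n 1.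
  have : (#|X :\ x| = 0)%N by rewrite cX1; lia.
  move/eqP; rewrite cards_eq0 => /eqP ->; rewrite big_set0.
  by rewrite mulr_ge0 // closed_rate_ge0.
have nE : n = (n - 2).+2 by lia.
set a := #|half_edges_in M i :\: D|%SET.
apply: (@le_trans _ _ (\sum_(y in X :\ x) closed_rate (a - 2) (n - 2) * expect (fun eta => w eta * (eta x == y)%:R))).
  apply: ler_sum => y; rewrite !inE => /andP[yx yX].
  have cX' : #|X' y| = (n - 2)%N.
    have := cardsD1 x X; rewrite xX cX; have := cardsD1 y (X :\ x)%SET; rewrite !inE yx yX /X'.
    by move=> -> ->; lia.
  have -> : (a - 2 = #|half_edges_in M i :\: (x |: (y |: D))|%SET)%N.
    have /andP[yD yi] : (y \notin D) && (y \in half_edges_in M i).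
      by have := XS' _ yX; rewrite !inE.
    rewrite /a (cardsD1 x) (cardsD1 y (_ :\ x)) !inE xD yD yx.
    rewrite inE in xi; rewrite inE in yi; rewrite xi yi /= !add1n subn2 /=.
    by apply: eq_card => z; rewrite !inE; case: (z == x); case: (z == y).
  apply: (IH _ _ _ _ (X' y) (weight_onS x y hw) cX'); first by lia.
  apply/fintype.subsetP => z; rewrite !inE => /and3P[zy zx /XS'] /=.
  by rewrite !inE => /andP[zD ->]; rewrite (negPf zx) (negPf zy) (negPf zD).
rewrite -mulr_sumr (expect_partner_sum _ _ hw) [in X in _ <= X]nE /= mulrAC mulrC.
rewrite [X in _ <= X](_ : _ = closed_rate (a - 2) (n - 2) * ((n - 2).+1%:R / a.-1%:R * expect w)); last by ring.
rewrite [X in X <= _]mulrC ler_wpM2l ?closed_rate_ge0 //.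
have XS1 : (X :\ x)%SET \subset (half_edges_in M i :\: D)%SET.
  by apply: fintype.subset_trans XS; apply: subD1set.
have := partner_in_le hw xD XS1; rewrite -/a cX1 (_ : n.-1 = (n - 2).+1); last by lia.
have a1 : 0 < a.-1%:R :> R.
  by have := subset_leq_card XS; rewrite cX -/a ltr0n; lia.
by rewrite mulrAC ler_pdivlMr // mulrC.
Qed.

(** Each reveal uses up one target in [Y] and two half-edges in all, whence the ratios (|Y| - l) /
    (m - 2l - 1) in the hypothesis, with m the number of initially free half-edges. Stopping after
    [j] reveals keeps all of them below [t]. *)
Lemma maps_into_le (j : nat) D w (X Y : {set H}) i (t : R) : weight_on D w -> (j <= #|X|)%N ->
  [disjoint X & D]%B -> [disjoint X & Y]%B ->
  Y \subset (half_edges_in M i :\: D)%SET -> X \subset half_edges_in M i -> 0 <= t ->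
  (forall l, (l < j)%N -> (2 * l + 1 < #|half_edges_in M i :\: D|%SET)%N /\
     #|Y|%:R - l%:R <= t * (#|half_edges_in M i :\: D|%SET%:R - 2 * l%:R - 1)) ->
  expect (fun eta => w eta * (maps_into X Y eta)%:R) <= t ^+ j * expect w.
Proof.
elim: j D w X Y => [|j IH] D w X Y hw jX dXD dXY YS Xi t0 ht.
  rewrite mul1r; apply: expect_le => eta _; case: hw => wp _ _.
  by rewrite ler_piMr // lern1 leq_b1.
have w0 := weight_ge0 hw.
have /set0Pn[x xX] : X != finset.set0 by rewrite -card_gt0; apply: leq_trans jX.
have xD : x \notin D by rewrite (disjointFr dXD xX).
have /fintype.subsetP YS' := YS; have /fintype.subsetP Xi' := Xi.
have xY : x \in Y = false by rewrite (disjointFr dXY xX).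
set a := #|half_edges_in M i :\: D|%SET.
have h1 := @maps_into_step D w X Y (X :\ x)%SET (fun y => Y :\ y)%SET x hw xX.
apply: le_trans (h1 _) _.
  move=> eta [eK _ _] _ /forall_inP h; apply/forall_inP => z; rewrite !inE => /andP[zx zX].
  by rewrite (inj_eq perm_inj) zx h.
apply: (@le_trans _ _ (\sum_(y in Y :\ x) t ^+ j * expect (fun eta => w eta * (eta x == y)%:R))).
  apply: ler_sum => y; rewrite !inE => /andP[yx yY].
  have yD : y \notin D by have := YS' _ yY; rewrite !inE => /andP[].
  have yi : community (tag y) == i by have := YS' _ yY; rewrite !inE => /andP[].
  have xi : community (tag x) == i by have := Xi' _ xX; rewrite inE.
  have ca : (a = 2 + #|half_edges_in M i :\: (x |: (y |: D))|%SET)%N.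
    rewrite /a (cardsD1 x) (cardsD1 y (_ :\ x)) !inE xD yD yx xi yi /= addnA.
    congr (_ + _)%N.
    by apply: eq_card => z; rewrite !inE; case: (z == x); case: (z == y).
  apply: IH (weight_onS x y hw) _ _ _ _ _ t0 _.
  - by move: jX; rewrite (cardsD1 x X) xX add1n ltnS.
  - rewrite -setI_eq0; apply/eqP/setP => z; rewrite !inE.
    case: (z == x); case zy: (z == y); rewrite ?andbF //=.
      by rewrite (eqP zy) (disjointFl dXY yY).
    by case zX : (z \in X) => //=; rewrite (disjointFr dXD zX).
  - rewrite -setI_eq0; apply/eqP/setP => z; rewrite !inE.
    by case zX : (z \in X); rewrite ?andbF //= (disjointFr dXY zX) !andbF.
  - apply/fintype.subsetP => z; rewrite !inE => /andP[zy zY].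
    have := YS' _ zY; rewrite !inE => /andP[zD ->]; rewrite (negPf zy) (negPf zD) /= !orbF andbT.
    by apply: contraFneq xY => <-.
  - by apply: fintype.subset_trans Xi; apply: subD1set.
  - move=> l lj; have [g1 g2] := ht l.+1 lj; rewrite -/a ca in g1 g2; split; first by clear -g1; lia.
    have cY : (#|Y| = 1 + #|Y :\ y|)%N by rewrite (cardsD1 y) yY.
    move: g2; rewrite cY !natrD -natr1; lra.
rewrite -mulr_sumr exprSr -mulrA ler_wpM2l ?exprn_ge0 // (expect_partner_sum _ _ hw).
have YS1 : (Y :\ x)%SET \subset (half_edges_in M i :\: D)%SET.
  by apply: fintype.subset_trans YS; apply: subD1set.
have := partner_in_le hw xD YS1; rewrite -/a.
have [g1 g2] := ht 0%N isT; rewrite -/a muln0 add0n mulr0 !subr0 in g1 g2.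
have a1 : 0 < a.-1%:R :> R by rewrite ltr0n; clear -g1; lia.
have aE : a%:R - 1 = a.-1%:R :> R by rewrite -subn1 natrB //; clear -g1; lia.
rewrite aE in g2; move=> h; rewrite -(ler_pM2l a1); apply: le_trans h _.
rewrite [X in _ <= X]mulrA ler_wpM2r // mulrC; apply: le_trans g2.
by rewrite ler_nat subset_leq_card // subD1set.
Qed.

End PatternProbability.

(** * Binomial and exponential estimates for the union bounds *)

Section Numeric.
Variable R : realType.

Lemma expR_half_le2 : expR (1 / 2) <= 2 :> R.
Proof.
have h := @expR_ge1Dx R (- (1 / 2)); rewrite expRN in h.
have p := expR_gt0 (1 / 2 : R).
have : (1 + - (1 / 2)) * expR (1 / 2) <= 1 :> R.
  by rewrite -[X in _ <= X](mulVf (lt0r_neq0 p)) ler_wpM2r // ltW.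
lra.
Qed.

Lemma succ_expn_le k : (k.+1 ^ k <= 4 * k ^ k)%N.
Proof.
case: k => // k; rewrite -(ler_nat R) natrM !natrX.
have k0 : 0 < k.+1%:R :> R by [].
have -> : k.+2%:R = (1 + k.+1%:R^-1) * k.+1%:R :> R.
  by rewrite mulrDl mul1r mulVf ?lt0r_neq0 // natr1.
rewrite exprMn ler_wpM2r ?exprn_ge0 //.
apply: (@le_trans _ _ (expR k.+1%:R^-1 ^+ k.+1)).
  by rewrite lerXn2r ?nnegrE ?addr_ge0 ?invr_ge0 ?expR_ge0 // expR_ge1Dx.
rewrite -expRM_natl mulfV ?lt0r_neq0 //.
have -> : expR 1 = expR (1 / 2) * expR (1 / 2) :> R by rewrite -expRD; congr expR; lra.
have := expR_half_le2; have := expR_gt0 (1 / 2 : R); nra.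
Qed.

Lemma expn_self_le_fact k : (k ^ k <= 4 ^ k * k`!)%N.
Proof.
elim: k => // k IH; rewrite expnS factS expnS.
have := succ_expn_le k; move: IH; set a := (k ^ k)%N; set b := (k.+1 ^ k)%N.
set c := (4 ^ k)%N; set d := (k`!)%N; nia.
Qed.

Lemma bin_expn_le n k : ('C(n, k) * k ^ k <= (4 * n) ^ k)%N.
Proof.
have h1 : ('C(n, k) * k`! <= n ^ k)%N.
  rewrite bin_ffact; elim: k => // k IH; rewrite ffactnSr expnSr leq_mul ?leq_subr //.
have := expn_self_le_fact k; rewrite expnMn.
move: h1; set a := 'C(n, k); set b := (k`!)%N; set c := (n ^ k)%N; set d := (k ^ k)%N.
by set e := (4 ^ k)%N; nia.
Qed.

(** Going from m to m + 1 multiplies the power by at most 4 a (m + 1), by [succ_expn_le]. *)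
Lemma linear_pow_anti (a : R) (i j : nat) : 0 <= a -> (0 < i <= j)%N -> 4 * a * j%:R <= 1 ->
  (a * j%:R) ^+ j <= (a * i%:R) ^+ i.
Proof.
move=> a0 /andP[i0 ij]; rewrite -(subnKC ij); elim: (j - i)%N => [|n IH]; first by rewrite addn0.
rewrite addnS => h; apply: le_trans (IH _); last first.
  by apply: le_trans h; rewrite ler_wpM2l ?mulr_ge0 // ler_nat.
set m := (i + n)%N in h *; have m0 : (0 < m)%N by rewrite addn_gt0 i0.
rewrite exprMn exprMn -!natrX.
have h1 : (m.+1 ^ m.+1)%:R <= (4 * m.+1 * m ^ m)%N%:R :> R.
  by rewrite ler_nat expnS; have := succ_expn_le m; nia.
apply: (@le_trans _ _ (a ^+ m.+1 * (4 * m.+1 * m ^ m)%N%:R)).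
  by rewrite ler_wpM2l ?exprn_ge0.
rewrite exprS !natrM; have h2 : 0 <= a ^+ m * (m ^ m)%:R by rewrite mulr_ge0 ?exprn_ge0.
by have := ler_wpM2r h2 h; rewrite mul1r; apply: le_trans; rewrite le_eqVlt; apply/orP; left;
  apply/eqP; ring.
Qed.

Lemma sum_half_pow n : \sum_(k < n) k%:R * (1 / 2) ^+ k <= 2 :> R.
Proof.
have h : \sum_(k < n) k%:R * (1 / 2) ^+ k = 2 - 2 * (n%:R + 1) * (1 / 2) ^+ n :> R.
  elim: n => [|n IH]; first by rewrite big_ord0 expr0; ring.
  by rewrite big_ord_recr /= IH exprS -natr1; field.
rewrite h gerBl mulr_ge0 // ?mulr_ge0 ?exprn_ge0 // addr_ge0 //.
Qed.

(** A single term of the Vandermonde sum. *)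
Lemma bin_mul_le a b c d : ('C(a, b) * 'C(c, d) <= 'C(a + c, b + d))%N.
Proof.
rewrite -binomial.Vandermonde (bigD1 (inord b)) //= inordK ?ltnS ?leq_addr //.
by rewrite addKn leq_addr.
Qed.

(** This is how degrees at least 3 help the union bound: the number of vertex sets of a given size
    is at most the cube root of the number of half-edge sets of the corresponding size. *)
Lemma bin_cube_le n k N s : (3 * k <= s)%N -> (3 * (n - k) <= N - s)%N -> (k <= n)%N ->
  (s <= N)%N -> ('C(n, k) ^ 3 <= 'C(N, s))%N.
Proof.
move=> h1 h2 kn sN; have h3 := bin_mul_le n k n k; have h4 := bin_mul_le (n + n) (k + k) n k.
have h5 := bin_mul_le (n + n + n) (k + k + k) (N - (n + n + n)) (s - (k + k + k)).
have e1 : (n + n + n + (N - (n + n + n)) = N)%N by lia.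
have e2 : (k + k + k + (s - (k + k + k)) = s)%N by lia.
rewrite e1 e2 in h5; apply: leq_trans h5.
have : (0 < 'C(N - (n + n + n), s - (k + k + k)))%N by rewrite bin_gt0; lia.
have : ('C(n, k) ^ 3 <= 'C(n + n + n, k + k + k))%N.
  apply: leq_trans h4; rewrite !expnS expn0 muln1 mulnA leq_mul //.
by set a := 'C(n + n + n, _); set b := 'C(N - _, _); set c := (_ ^ 3)%N; nia.
Qed.

Lemma closed_rate_bin m q : (q <= m)%N ->
  closed_rate R (2 * m) (2 * q) * 'C(2 * m, 2 * q)%:R = 'C(m, q)%:R.
Proof.
elim: q m => [|q IH] m qm; first by rewrite !bin0 mulr1.
case: m qm => // m qm.
rewrite !mulnS /= !add2n /= subn2 /= -/(_ * _)%N.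
have e1 : ((2 * q).+2 * 'C((2 * m).+2, (2 * q).+2) = (2 * m).+2 * 'C((2 * m).+1, (2 * q).+1))%N.
  by rewrite -mul_bin_diag.
have e2 : ((2 * q).+1 * 'C((2 * m).+1, (2 * q).+1) = (2 * m).+1 * 'C(2 * m, 2 * q))%N.
  by rewrite -mul_bin_diag.
have e3 : (q.+1 * 'C(m.+1, q.+1) = m.+1 * 'C(m, q))%N by rewrite -mul_bin_diag.
have := IH m qm; move: e1 e2 e3.
set A := 'C((2 * m).+2, _); set B := 'C((2 * m).+1, _); set C := 'C(2 * m, _).
set D := 'C(m.+1, _); set E := 'C(m, q) => e1 e2 e3 e4.
have {}e1 : (2 * q.+1)%:R * A%:R = (2 * m.+1)%:R * B%:R :> R by rewrite -!natrM !mulnS !add2n e1.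
have {}e2 : (2 * q).+1%:R * B%:R = (2 * m).+1%:R * C%:R :> R by rewrite -!natrM e2.
have {}e3 : q.+1%:R * D%:R = m.+1%:R * E%:R :> R by rewrite -!natrM e3.
have n1 : q.+1%:R != 0 :> R by rewrite pnatr_eq0.
have n2 : (2 * m).+1%:R != 0 :> R by rewrite pnatr_eq0.
apply: (mulfI n1); rewrite e3 -e4; set r := closed_rate _ _ _.
transitivity ((2 * q).+1%:R / (2 * m).+1%:R * r * (q.+1%:R * A%:R)); first by ring.
have -> : q.+1%:R * A%:R = m.+1%:R * B%:R :> R.
  by move: e1; rewrite !natrM; lra.
have -> : (2 * q).+1%:R / (2 * m).+1%:R * r * (m.+1%:R * B%:R) =
    m.+1%:R * r / (2 * m).+1%:R * ((2 * q).+1%:R * B%:R) by ring.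
by rewrite e2; field.
Qed.

Lemma closed_rate_odd m q : closed_rate R m (2 * q).+1 = 0.
Proof.
elim: q m => // q IH m; rewrite mulnS add2n -[LHS]/(_ * closed_rate R (m - 2) (2 * q).+1).
by rewrite IH mulr0.
Qed.

(** For even k, [closed_rate] is C(m/2, k/2) / C(m, k), and C(m/2, k/2)^2 <= C(m, k). A set is thus
    closed with probability at most C(m, k)^(-1/2), which beats the cube root of [bin_cube_le]. *)
Lemma closed_rate_sq m k : ~~ odd m -> (k <= m)%N ->
  closed_rate R m k ^+ 2 * 'C(m, k)%:R <= 1.
Proof.
move=> om km; have e := odd_double_half m; rewrite (negPf om) add0n -mul2n in e.
have ek := odd_double_half k; rewrite -mul2n in ek.
case ok: (odd k) in ek; first by rewrite -ek add1n closed_rate_odd expr0n mul0r.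
rewrite add0n in ek; rewrite -e -ek in km *; set a := m./2 in km *; set b := k./2 in km *.
have ba : (b <= a)%N by lia.
have h := closed_rate_bin ba.
have c0 : 0 < 'C(2 * a, 2 * b)%:R :> R by rewrite ltr0n bin_gt0.
rewrite -(ler_pM2r c0) mul1r.
have -> : closed_rate R (2 * a) (2 * b) ^+ 2 * 'C(2 * a, 2 * b)%:R * 'C(2 * a, 2 * b)%:R =
    'C(a, b)%:R ^+ 2 by rewrite -h; ring.
by rewrite -natrX ler_nat expnS expn1 !mul2n -!addnn bin_mul_le.
Qed.

Definition few_subsets (n d : nat) : nat := \sum_(j < d.+1) 'C(n, j).

Lemma card_few_subsets (T : finType) (A : {set T}) d :
  #|[set B : {set T} | (B \subset A) && (#|B| <= d)%N]%SET| = few_subsets #|A| d.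
Proof.
rewrite -sum1_card /few_subsets.
rewrite (partition_big (fun B : {set T} => inord #|B| : 'I_d.+1) predT) //=.
apply: eq_bigr => j _; rewrite -cards_draws -sum1_card; apply: eq_bigl => B.
rewrite !inE; case: (B \subset A) => //=; apply/andP/eqP => [[h /eqP e]|e].
  by rewrite -e inordK.
by have := ltn_ord j; rewrite ltnS -e => h; split=> //; apply/eqP/val_inj; rewrite /= inordK.
Qed.

(** For j <= d one has z^d <= z^j, and the full sum is the expansion of (1 + z)^n. *)
Lemma few_subsets_le n d (z : R) : 0 < z <= 1 ->
  (few_subsets n d)%:R * z ^+ d <= expR (z * n%:R).
Proof.
move=> /andP[z0 z1]; apply: (@le_trans _ _ ((1 + z) ^+ n)); last first.
  have h0 : 0 <= 1 + z by lra.
  by rewrite mulrC expRM_natl lerXn2r ?nnegrE ?expR_ge0 // expR_ge1Dx.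
rewrite exprDn /few_subsets natr_sum mulr_suml.
have h j : (j <= d)%N -> 'C(n, j)%:R * z ^+ d <= 'C(n, j)%:R * z ^+ j :> R.
  by move=> jd; rewrite ler_wpM2l // ler_wiXn2l // ltW.
apply: (@le_trans _ _ (\sum_(j < d.+1) 'C(n, j)%:R * z ^+ j)).
  by apply: ler_sum => j _; apply: h; rewrite -ltnS.
have z0' := ltW z0.
rewrite (eq_bigr (fun i : 'I_n.+1 => 'C(n, i)%:R * z ^+ i)); last first.
  by move=> i _; rewrite expr1n mul1r mulr_natl.
rewrite -!(big_mkord predT (fun i => 'C(n, i)%:R * z ^+ i)).
have [dn|nd] := leqP d n.
  rewrite [X in _ <= X](big_cat_nat _ (n := d.+1)) //= lerDl sumr_ge0 // => i _.
  by rewrite mulr_ge0 ?exprn_ge0.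
rewrite (big_cat_nat _ (n := n.+1)) //=; last by rewrite ltnS ltnW.
rewrite [X in _ + X]big_nat_cond [X in _ + X]big1 ?addr0 // => i.
by rewrite andbT => /andP[h1 _]; rewrite bin_small ?mul0r.
Qed.

Lemma few_subsets_exp (t : R) : 0 < t <= 1 -> exists2 e : R, 0 < e &
  forall n d : nat, d%:R <= e * n%:R -> (few_subsets n d)%:R <= expR (t * n%:R).
Proof.
move=> /andP[t0 t1]; pose z := t / 2; have z0 : 0 < z by rewrite /z divr_gt0.
have z1 : z < 1 by rewrite /z; lra.
have l0 : 0 < - ln z by rewrite oppr_gt0 ln_lt0 // z0 z1.
exists (t / 2 / - ln z); first by rewrite !divr_gt0.
move=> n d h; have := @few_subsets_le n d z; rewrite z0 (ltW z1) => /(_ isT) h1.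
have -> : t * n%:R = z * n%:R + t / 2 * n%:R by rewrite /z; field.
rewrite expRD; apply: (@le_trans _ _ (expR (z * n%:R) * (z ^+ d)^-1)).
  by rewrite ler_pdivlMr ?exprn_gt0.
rewrite ler_wpM2l ?expR_ge0 //.
rewrite -[z in X in X <= _](lnK (_ : z \in Num.pos)) ?posrE // -expRM_natl -expRN ler_expR.
by rewrite -mulrN mulrC -ler_pdivlMl // mulrC; apply: le_trans h _; rewrite le_eqVlt; apply/orP;
  left; apply/eqP; ring.
Qed.

Lemma bin_le_few n s x d : (x <= s <= n)%N -> (s - x <= d)%N ->
  ('C(n, s) <= 'C(n, x) * few_subsets n d)%N.
Proof.
move=> /andP[xs sn] sd.
have e : ('C(n, s) * 'C(s, x) = 'C(n, x) * 'C(n - x, s - x))%N.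
  have f0 k : (0 < k`!)%N by apply: fact_gt0.
  have h1 := bin_fact sn; have h2 := bin_fact xs; have h3 := bin_fact (leq_trans xs sn).
  have h4 := @bin_fact (n - x) (s - x) (leq_sub2r x sn).
  rewrite (_ : n - x - (s - x) = n - s)%N in h4; last by lia.
  apply/eqP; rewrite -(eqn_pmul2r (f0 x)) -(eqn_pmul2r (f0 (s - x)%N)) -(eqn_pmul2r (f0 (n - s)%N)).
  apply/eqP; transitivity (n`!)%N.
    by rewrite -h1 -h2; ring.
  by rewrite -h3 -h4; ring.
have h1 : ('C(n - x, s - x) <= 'C(n, s - x))%N by rewrite leq_bin2l ?leq_subr.
have h2 : ('C(n, s - x) <= few_subsets n d)%N.
  have sd' : (s - x < d.+1)%N by [].
  by rewrite /few_subsets (bigD1 (Ordinal sd')) //= leq_addr.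
have h3 : (0 < 'C(s, x))%N by rewrite bin_gt0.
apply: (@leq_trans ('C(n, s) * 'C(s, x))); first by rewrite leq_pmulr.
by rewrite e leq_mul // (leq_trans h1).
Qed.

Lemma bin_ge_expn2 n k : (2 * k <= n)%N -> (2 ^ k <= 'C(n, k))%N.
Proof.
elim: k n => [|k IH] n h; first by rewrite bin0.
case: n h => // n h; have := mul_bin_diag n.+1 k.
have : (2 ^ k <= 'C(n, k))%N by apply: IH; lia.
rewrite expnS; set a := 'C(n, k); set b := 'C(n.+1, k.+1); set c := (2 ^ k)%N.
move=> h1 h2; have : (k.+1 * (2 * c) <= k.+1 * b)%N.
  by rewrite -h2 mulnA [(_ * 2)%N]mulnC leq_mul.
by rewrite leq_pmul2l.
Qed.

End Numeric.

(** * Union bound for small sets *)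

Section UnionBound.
Variables (R : realType) (M : two_community).
Hypothesis degree_ge3 : forall v : vertex M, (3 <= degree v)%N.
Local Notation H := (half_edge M).
Local Notation V := (vertex M).
Local Notation expect := (@expect R M).

Lemma exists_le_sum (T : finType) (P : pred T) :
  [exists x, P x]%:R <= \sum_x (P x)%:R :> R.
Proof.
case: (boolP [exists x, P x]) => [/existsP[x Px]|_]; last by rewrite sumr_ge0.
by rewrite (bigD1 x) //= Px lerDl sumr_ge0.
Qed.

Definition boundary (eta : {perm H}) (S : {set V}) : {set H} :=
  [set x : H | (tag x \in S) && (tag (eta x) \notin S)]%SET.

Lemma boundary_sub eta S : boundary eta S \subset halves S.
Proof. by apply/fintype.subsetP => x; rewrite !inE => /andP[]. Qed.

Lemma closed_boundary eta S : valid eta -> closed_under (halves S :\: boundary eta S)%SET eta.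
Proof.
move=> [eK _ _]; apply/forall_inP => x; rewrite !inE => /andP[h xS].
by move: h; rewrite xS /= negbK eK => yS; rewrite xS yS.
Qed.

Lemma card_halves_ge (S : {set V}) : (3 * #|S| <= #|halves S|)%N.
Proof.
rewrite -[#|halves S|]sum1_card mulnC -sum_nat_const.
rewrite (partition_big (fun x : H => tag x) (mem S)) /=; last by move=> x; rewrite inE.
apply: leq_sum => v vS; apply: leq_trans (degree_ge3 v) _.
rewrite -(card_fiber v) -sum1_card; apply: eq_leq.
by apply: eq_bigl => x; rewrite !inE andb_idl // => /eqP ->.
Qed.

Lemma halves_eq0 (S : {set V}) : S != finset.set0 -> (0 < #|halves S|)%N.
Proof. by rewrite -card_gt0 => h; apply: leq_trans (card_halves_ge S); rewrite muln_gt0. Qed.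

Lemma sum_sets_by_card (A : {set V}) (F : nat -> R) :
  \sum_(S : {set V} | S \subset A) F #|S| = \sum_(k < #|A|.+1) 'C(#|A|, k)%:R * F k.
Proof.
rewrite (partition_big (fun S : {set V} => inord #|S| : 'I_#|A|.+1) predT) //=.
apply: eq_bigr => k _.
rewrite (eq_bigl (fun S => S \in [set B : {set V} | (B \subset A) && (#|B| == k)]%SET)).
  rewrite (eq_bigr (fun=> F k)); last by move=> S; rewrite inE => /andP[_ /eqP ->].
  by rewrite sumr_const cards_draws mulr_natl.
move=> S; rewrite inE; case SA: (S \subset A) => //=.
have h : (#|S| < #|A|.+1)%N by rewrite ltnS subset_leq_card.
apply/eqP/eqP => [<-|e]; first by rewrite inordK.
by apply/val_inj; rewrite /= e inordK // -e.
Qed.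

Variable rho : R.
Hypothesis rho01 : 0 < rho <= 1.
Hypothesis balanced : forall i, rho * (nhalf M)%:R <= (nhalf_in M i)%:R.
Local Notation N := ((nhalf M)%:R : R).

(** In [bad_small_le] the number 62 rounds up 4 * 46 / 3, from 3 |V| <= N. Three of the four powers
    pay for choosing the vertex set, at three vertices per surplus pair, and the fourth belongs to
    that pair. *)
Definition small_factor : R := (62 / rho) ^+ 4.

(** With less than one ninth of its half-edges on the boundary, [S] has at least 4/9 as many inner
    pairs as half-edges, hence at least 4/3 pairs per vertex. Each pair costs a factor of order
    |halves S| / N, against about N / |S| choices per vertex: the surplus third gives the decay. *)
Definition bad_small eta (S : {set V}) : bool :=
  [&& S != finset.set0, 8 * small_factor * #|halves S|%:R <= N &
    (9 * #|boundary eta S| < #|halves S|)%N].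

Let rho_gt0 : 0 < rho. Proof. by case/andP: rho01. Qed.
Let N_gt0 : 0 < N. Proof. exact: nhalf_gt0. Qed.

Lemma small_factor_ge : 62 / rho <= small_factor /\ 62 <= 62 / rho.
Proof.
have /andP[r0 r1] := rho01.
have h : 62 <= 62 / rho by rewrite ler_pdivlMr // ler_piMr.
split=> //; rewrite /small_factor exprS ler_peMr //; first by lra.
by rewrite exprn_ege1 //; lra.
Qed.

Lemma expect_bad_small (S : {set V}) : S != finset.set0 ->
  8 * small_factor * #|halves S|%:R <= N ->
  expect (fun eta => (bad_small eta S)%:R) <=
  (46 * #|S|%:R / (rho * N)) ^+ (#|S| + (#|S| + 2) %/ 3).
Proof.
move=> S0 hs; have [C1 C2] := small_factor_ge; have rN : 0 < rho * N by rewrite mulr_gt0.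
have kp : (0 < #|S|)%N by rewrite card_gt0.
have sk := card_halves_ge S; have sp := halves_eq0 S0.
move es : (#|halves S|)%N hs sk sp => s hs sk sp.
have s0 : 0 < s%:R :> R by rewrite ltr0n.
have s1 : 1 <= s%:R :> R by rewrite ler1n.
have hsr : 8 * 62 * s%:R <= rho * N.
  have h : 8 * (62 / rho) * s%:R <= N.
    by apply: le_trans hs; rewrite ler_wpM2r // ler_pM2l.
  have := ler_wpM2l (ltW rho_gt0) h.
  by rewrite (_ : rho * (8 * (62 / rho) * s%:R) = 8 * 62 * s%:R) //; field; rewrite lt0r_neq0.
(* The number of inner pairs, 4 s / 9 rounded up. *)
pose J := ((4 * s + 8) %/ 9)%N.
have J1 : (4 * s <= 9 * J)%N by rewrite /J; clear; lia.
have J2 : (9 * J <= 12 * s)%N by rewrite /J; clear -sp; lia.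
pose m := (minn (nhalf_in M false) (nhalf_in M true) - s)%N.
have mN i : (m + s <= nhalf_in M i)%N \/ m = 0%N by rewrite /m; clear; case: i; lia.
have mr : rho * N / 2 <= m%:R.
  have h : rho * N <= (minn (nhalf_in M false) (nhalf_in M true))%:R.
    by rewrite /minn; case: ifP => _; apply: balanced.
  have hle : (s <= minn (nhalf_in M false) (nhalf_in M true))%N.
    by rewrite -(ler_nat R); apply: le_trans h; lra.
  rewrite /m natrB //; lra.
have m0 : (0 < m)%N by rewrite -(ltr0n R); apply: lt_le_trans mr; rewrite divr_gt0.
pose t := 2 * s%:R / (rho * N).
have t1 : t <= 1 by rewrite /t ler_pdivrMr //; lra.
have t0 : 0 <= t by rewrite /t divr_ge0 ?mulr_ge0 // ltW.
have step1 : expect (fun eta => (bad_small eta S)%:R) <= 2 ^+ s * t ^+ J.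
  pose Q (X : {set H}) := (X \subset halves S) && (8 * s <= 9 * #|X|)%N.
  apply: (@le_trans _ _ (\sum_(X : {set H} | Q X) t ^+ J)).
    apply: (@le_trans _ _ (\sum_(X : {set H} | Q X) expect (fun eta => 1 * (closed_under X eta)%:R))).
      rewrite -expect_sum; apply: expect_le => eta ve.
      case: (boolP (bad_small eta S)) => [/and3P[_ _ hb]|_]; last first.
        by rewrite sumr_ge0 // => X _; rewrite mul1r.
      have hQ : Q (halves S :\: boundary eta S)%SET.
        rewrite /Q finset.subsetDl cardsD (finset.setIidPr (boundary_sub eta S)).
        by move: hb; rewrite es; clear; lia.
      by rewrite (bigD1 _ hQ) /= closed_boundary // mulr1 lerDl sumr_ge0 // => X _; rewrite mul1r.
    apply: ler_sum => X /andP[XS Xs].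
    have Xle : (#|X| <= s)%N by rewrite -es subset_leq_card.
    apply: (@le_trans _ _ (t ^+ uphalf #|X| * expect (fun=> 1))).
      apply: (closed_le (@weight_on0 R M) (erefl _) _ _ m0).
      - by rewrite -setI_eq0 finset.setI0.
      - move=> i; rewrite finset.setD0 card_half_edges_in; have := mN i; move: Xle m0.
        by clear; lia.
      - rewrite ler_pdivrMr ?ltr0n //; apply: (@le_trans _ _ (t * (rho * N / 2))).
          rewrite /t (_ : _ * _ = s%:R) ?ler_nat //.
          by field; rewrite !lt0r_neq0.
        by rewrite ler_wpM2l.
    rewrite expect_cst mulr1 ler_wiXn2l //.
    have e1 : (#|X| <= 2 * uphalf #|X|)%N by rewrite mul2n -leq_uphalf_double.
    by rewrite /J; clear -Xs e1; lia.
  rewrite sumr_const -[(t ^+ J) *+ _]mulr_natl ler_wpM2r ?exprn_ge0 // -natrX ler_nat.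
  rewrite -es -(card_powerset (halves S)) subset_leq_card //.
  by apply/fintype.subsetP => X; rewrite !inE => /andP[].
apply: le_trans step1 _.
(* Since 2^9 <= 5^4, the 2^s choices of the closed part cost a factor 5 per pair. *)
have h5 : (2 ^ s <= 5 ^ J)%N.
  rewrite -(leq_exp2r _ _ (isT : 0 < 4)%N) -!expnM mulnC.
  apply: (@leq_trans (2 ^ (9 * J))); first by rewrite leq_pexp2l // mulnC.
  by rewrite [(J * 4)%N]mulnC !expnM leq_exp2r // /J; clear -sp; lia.
pose a := 23 / (rho * N).
have a0 : 0 <= a by rewrite divr_ge0 // ltW.
have Js : s%:R <= 9 / 4 * J%:R :> R.
  by move: J1; rewrite -(ler_nat R) !natrM; lra.
have Js2 : J%:R <= 12 / 9 * s%:R :> R.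
  by move: J2; rewrite -(ler_nat R) !natrM; lra.
apply: (@le_trans _ _ ((a * J%:R) ^+ J)).
  apply: (@le_trans _ _ (5 ^+ J * t ^+ J)).
    by rewrite ler_wpM2r ?exprn_ge0 // -!natrX ler_nat.
  have t5 : 0 <= 5 * t := mulr_ge0 (ler0n _ 5) t0.
  have aJ : 0 <= a * J%:R := mulr_ge0 a0 (ler0n _ _).
  rewrite -exprMn lerXn2r ?nnegrE //.
  rewrite /t /a (_ : 5 * (2 * s%:R / (rho * N)) = 10 * s%:R / (rho * N)); last by ring.
  rewrite (_ : 23 / (rho * N) * J%:R = 23 * J%:R / (rho * N)); last by ring.
  rewrite ler_wpM2r ?invr_ge0 ?(ltW rN) //.
  by have : 0 <= J%:R :> R by []; lra.
(* The exponent [J], which depends on the degrees, is traded for one that depends only on |S|, by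
   monotonicity of the power. *)
set u := ((#|S| + 2) %/ 3)%N.
apply: (@le_trans _ _ ((a * (#|S| + u)%:R) ^+ (#|S| + u))).
  apply: linear_pow_anti => //.
    by rewrite /u; move: J1 sk kp; clear; lia.
  rewrite /a (_ : 4 * (23 / (rho * N)) * J%:R = 92 * J%:R / (rho * N)); last by ring.
  by rewrite ler_pdivrMr //; lra.
have aS : 0 <= a * (#|S| + u)%:R := mulr_ge0 a0 (ler0n _ _).
have bS : 0 <= 46 * #|S|%:R / (rho * N) by rewrite divr_ge0 ?mulr_ge0 // ltW.
rewrite lerXn2r ?nnegrE //.
rewrite /a (_ : 23 / (rho * N) * (#|S| + u)%:R = 23 * (#|S| + u)%:R / (rho * N)); last by ring.
rewrite ler_wpM2r ?invr_ge0 ?(ltW rN) //.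
have : (#|S| + u <= 2 * #|S|)%N by rewrite /u; move: kp; clear; lia.
by rewrite -(ler_nat R) natrM; lra.
Qed.

Lemma bad_small_le : expect (fun eta => [exists S, bad_small eta S]%:R) <= 16 * small_factor / N.
Proof.
have [C1 C2] := small_factor_ge; have rN : 0 < rho * N by rewrite mulr_gt0.
set C := small_factor in C1 *; have C0 : 0 < C by lra.
pose f k := if (0 < k)%N && (8 * C * (3 * k%:R) <= N) then
   (46 * k%:R / (rho * N)) ^+ (k + (k + 2) %/ 3) else 0 : R.
apply: (@le_trans _ _ (\sum_(S : {set V} | S \subset [set: V]%SET) f #|S|)).
  apply: (@le_trans _ _ (expect (fun eta => \sum_S (bad_small eta S)%:R))).
    by apply: expect_le => eta _; apply: exists_le_sum.
  rewrite expect_sum [X in _ <= X](eq_bigl predT); last by move=> S; rewrite finset.subsetT.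
  apply: ler_sum => S _; rewrite /f card_gt0; case: ifP => [/andP[S0 _]|h].
    case: (boolP (8 * C * #|halves S|%:R <= N)) => hs; first exact: expect_bad_small.
    apply: (@le_trans _ _ (expect (fun=> 0))); last first.
      by rewrite expect_cst exprn_ge0 // divr_ge0 ?mulr_ge0 // ltW.
    by apply: expect_le => eta _; rewrite /bad_small (negPf hs) andbF.
  rewrite -[X in _ <= X](@expect_cst R M); apply: expect_le => eta _.
  suff -> : bad_small eta S = false by [].
  apply/negbTE/negP => /and3P[S0 hs _]; move: h; rewrite S0 /= => /negP; apply.
  have c8 : 0 <= 8 * C := mulr_ge0 (ler0n _ 8) (ltW C0).
  rewrite -/C in hs; apply: le_trans hs; rewrite ler_wpM2l // -natrM ler_nat.
  exact: card_halves_ge.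
rewrite sum_sets_by_card cardsT.
have nN : 3 * #|V|%:R <= N.
  rewrite -natrM ler_nat -card_half_edge.
  have := card_halves_ge [set: V]%SET; rewrite cardsT => /leq_trans; apply.
  exact: max_card.
have c8N : 0 <= 8 * C / N := divr_ge0 (mulr_ge0 (ler0n _ 8) (ltW C0)) (ltW N_gt0).
apply: (@le_trans _ _ (\sum_(k < #|V|.+1) 8 * C / N * (k%:R * (1 / 2) ^+ k))); last first.
  rewrite -mulr_sumr; have h := sum_half_pow R #|V|.+1.
  by have := ler_wpM2l c8N h; lra.
apply: ler_sum => -[k kV] _ /=; rewrite /f; case: ifP => [/andP[k0 hk]|_]; last first.
  by rewrite mulr0; apply: mulr_ge0 => //; rewrite mulr_ge0 // exprn_ge0.
set u := ((k + 2) %/ 3)%N.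
have hk' : C * k%:R / N <= 1 / 8 by rewrite ler_pdivrMr //; move: hk; have : 0 <= k%:R :> R by []; nra.
(* The first k factors are spent on the number of vertex sets; the [u] remaining ones give the decay
   in N. *)
have h1 : 'C(#|V|, k)%:R * (46 * k%:R / (rho * N)) ^+ k <= (62 / rho) ^+ k.
  have -> : (46 * k%:R / (rho * N)) ^+ k = k%:R ^+ k * (46 / (rho * N)) ^+ k.
    by rewrite -exprMn; congr (_ ^+ _); ring.
  have := bin_expn_le R #|V| k; rewrite -(ler_nat R) natrM !natrX mulrA => h.
  apply: (@le_trans _ _ ((4 * #|V|)%N%:R ^+ k * (46 / (rho * N)) ^+ k)).
    by rewrite ler_wpM2r // exprn_ge0 // divr_ge0 // ltW.
  have e : (4 * #|V|)%N%:R * (46 / (rho * N)) = 184 * #|V|%:R / N / rho.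
    by rewrite natrM; field; rewrite !lt0r_neq0.
  have b : 184 * #|V|%:R / N <= 62 by rewrite ler_pdivrMr //; have := N_gt0; lra.
  have b0 : 0 <= 184 * #|V|%:R / N by apply: divr_ge0 (mulr_ge0 _ _) (ltW N_gt0).
  rewrite -exprMn e lerXn2r ?nnegrE ?(divr_ge0 b0 (ltW rho_gt0)) //.
    by rewrite divr_ge0 // ltW.
  by rewrite ler_pM2r ?invr_gt0.
rewrite exprD mulrA; apply: (@le_trans _ _ ((62 / rho) ^+ k * (46 * k%:R / (rho * N)) ^+ u)).
  by rewrite ler_wpM2r // exprn_ge0 // divr_ge0 ?mulr_ge0 // ltW.
apply: (@le_trans _ _ ((C * k%:R / N) ^+ u)).
  apply: (@le_trans _ _ ((62 / rho) ^+ (3 * u) * (62 * k%:R / (rho * N)) ^+ u)).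
    apply: ler_pM; rewrite ?exprn_ge0 ?divr_ge0 ?mulr_ge0 ?(ltW rN) ?(ltW rho_gt0) //.
      by rewrite ler_weXn2l //; [lra|rewrite /u; clear; lia].
    have b46 : 0 <= 46 * k%:R / (rho * N) := divr_ge0 (mulr_ge0 (ler0n _ _) (ler0n _ _)) (ltW rN).
    have b62 : 0 <= 62 * k%:R / (rho * N) := divr_ge0 (mulr_ge0 (ler0n _ _) (ler0n _ _)) (ltW rN).
    rewrite lerXn2r ?nnegrE //.
    by rewrite ler_pM2r ?invr_gt0 // ler_wpM2r // ler_nat.
  rewrite exprM -exprMn le_eqVlt; apply/orP; left; apply/eqP; congr (_ ^+ _).
  by rewrite /C /small_factor; field; rewrite !lt0r_neq0.
have uS : u = u.-1.+1 by rewrite /u; move: k0; clear; lia.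
have q0 : 0 <= C * k%:R / N := divr_ge0 (mulr_ge0 (ltW C0) (ler0n _ _)) (ltW N_gt0).
rewrite uS exprS; apply: (@le_trans _ _ (C * k%:R / N * (1 / 8) ^+ u.-1)).
  by rewrite ler_wpM2l // lerXn2r ?nnegrE.
have -> : 8 * C / N * (k%:R * (1 / 2) ^+ k) = C * k%:R / N * (8 * (1 / 2) ^+ k) by ring.
rewrite ler_wpM2l //.
have -> : (1 / 8) ^+ u.-1 = 8 * (1 / 8) ^+ u :> R by rewrite [in RHS]uS exprS; field.
rewrite ler_pM2l // (_ : 1 / 8 = (1 / 2) ^+ 3 :> R); last by field.
rewrite -exprM; apply: ler_wiXn2l; [lra|lra|rewrite /u; clear; lia].
Qed.

End UnionBound.

(** * Union bounds for sets of positive density in one community *)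

Section MiddleSets.
Variables (R : realType) (M : two_community).
Hypothesis degree_ge3 : forall v : vertex M, (3 <= degree v)%N.
Local Notation H := (half_edge M).
Local Notation V := (vertex M).
Local Notation expect := (@expect R M).
Variable i : bool.

Definition side : {set V} := [set v : V | community v == i]%SET.

Local Notation n := (nhalf_in M i).

Lemma halves_side : halves side = half_edges_in M i.
Proof. by apply/setP => x; rewrite !inE. Qed.

Lemma halves_side_sub (S : {set V}) : S \subset side -> halves S \subset half_edges_in M i.
Proof.
by move=> /fintype.subsetP h; apply/fintype.subsetP => x; rewrite inE => /h; rewrite !inE.
Qed.

Lemma card_side : (3 * #|side| <= n)%N.
Proof. by rewrite -card_half_edges_in -halves_side card_halves_ge. Qed.

Lemma card_halves_compl (S : {set V}) : S \subset side ->
  (3 * (#|side| - #|S|) <= n - #|halves S|)%N.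
Proof.
move=> h; have := card_halves_ge degree_ge3 (side :\: S)%SET.
rewrite cardsD (finset.setIidPr h) => /leq_trans; apply.
rewrite -card_half_edges_in -halves_side -(finset.setIidPr (halves_side_sub h)) -halves_side -cardsD.
by rewrite subset_leq_card //; apply/fintype.subsetP => x; rewrite !inE => /andP[-> ->].
Qed.

Definition bad_middle (lo : R) (d : nat) (eta : {perm H}) (S : {set V}) : bool :=
  [&& S \subset side, lo <= #|halves S|%:R, (2 * #|halves S| <= n)%N & (#|boundary eta S| <= d)%N].

Lemma even_side : ~~ odd n.
Proof. exact: (@community_even M i). Qed.

(** With K a binomial coefficient on half-edges, there are at most K^(1/3) vertex sets and each is
    closed with probability at most K^(-1/2), up to [few_subsets] for the removed boundary. The net
    gain K^(-1/6), where K is exponentially large, explains the sixth powers. *)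
Lemma closed_rate_middle (S D : {set V}) (lo E : R) (d : nat) (x : nat) : S \subset side ->
  lo <= #|halves S|%:R -> (2 * #|halves S| <= n)%N ->
  (#|halves S| - d <= x <= #|halves S|)%N -> d%:R <= lo / 2 -> 0 <= E ->
  (few_subsets n d)%:R ^+ 2 <= E ^+ 6 * expR (lo / 4) ->
  'C(#|side|, #|S|)%:R * closed_rate R n x <= E.
Proof.
move=> Ss hlo h2 /andP[x1 x2] hd E0 hE.
set s := #|halves S| in hlo h2 x1 x2.
have sn : (s <= n)%N by clear -h2; lia.
have hc : ('C(#|side|, #|S|) ^ 3 <= 'C(n, s))%N.
  apply: bin_cube_le => //; first exact: card_halves_ge.
    exact: card_halves_compl.
  exact: subset_leq_card.
have hb : ('C(n, s) <= 'C(n, x) * few_subsets n d)%N.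
  by apply: bin_le_few; [rewrite x2 sn|clear -x1; lia].
have h2x : (2 ^ x <= 'C(n, x))%N by apply: bin_ge_expn2; clear -h2 x2; lia.
have r0 := closed_rate_ge0 R n x.
have hr := closed_rate_sq R even_side (leq_trans x2 sn).
set r := closed_rate R n x in r0 hr *; set c := 'C(#|side|, #|S|) in hc *.
set B := few_subsets n d in hb hE *; set K := 'C(n, x) in hb h2x hr.
have K0 : 0 < K%:R :> R by rewrite ltr0n bin_gt0 (leq_trans x2).
have hK : expR (lo / 4) <= K%:R.
  apply: (@le_trans _ _ (2 ^+ x)); last by rewrite -natrX ler_nat.
  apply: (@le_trans _ _ (expR (1 / 2) ^+ x)); last first.
    by rewrite lerXn2r ?nnegrE ?expR_ge0 // expR_half_le2.
  rewrite -expRM_natl ler_expR.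
  have : s%:R <= x%:R + d%:R :> R by rewrite -natrD ler_nat; clear -x1; lia.
  by lra.
rewrite -(ler_pXn2r (isT : 0 < 6)%N) ?nnegrE ?mulr_ge0 // exprMn.
rewrite -(ler_pM2r K0); apply: (@le_trans _ _ (B%:R ^+ 2)); last first.
  by apply: le_trans hE _; rewrite ler_wpM2l // exprn_ge0.
have c6 : c%:R ^+ 6 <= (K%:R * B%:R) ^+ 2 :> R.
  rewrite -natrM -!natrX ler_nat (_ : 6 = 3 * 2)%N // expnM leq_exp2r //.
  exact: leq_trans hc hb.
apply: (@le_trans _ _ ((K%:R * B%:R) ^+ 2 * r ^+ 6 * K%:R)).
  by rewrite ler_wpM2r ?(ltW K0) // ler_wpM2r // exprn_ge0.
have -> : (K%:R * B%:R) ^+ 2 * r ^+ 6 * K%:R = B%:R ^+ 2 * (r ^+ 2 * K%:R) ^+ 3 by ring.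
rewrite ler_piMr ?exprn_ge0 // exprn_ile1 // mulr_ge0 ?exprn_ge0 // ltW.
Qed.

Lemma expect_bad_middle (lo E : R) (d : nat) (S : {set V}) :
  d%:R <= lo / 2 -> 0 <= E ->
  (few_subsets n d)%:R ^+ 2 <= E ^+ 6 * expR (lo / 4) -> S \subset side ->
  'C(#|side|, #|S|)%:R * expect (fun eta => (bad_middle lo d eta S)%:R) <= (few_subsets n d)%:R * E.
Proof.
move=> hd E0 hE Ss.
case: (boolP ((lo <= #|halves S|%:R) && (2 * #|halves S| <= n)%N)) => [/andP[h1 h2]|h]; last first.
  apply: (@le_trans _ _ ('C(#|side|, #|S|)%:R * expect (fun=> 0))); last first.
    by rewrite expect_cst mulr0 mulr_ge0.
  rewrite ler_wpM2l //; apply: expect_le => eta _; rewrite /bad_middle.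
  by move: h; rewrite negb_and => /orP[/negPf->|/negPf->]; rewrite /= ?andbF.
pose Q (D : {set H}) := (D \subset half_edges_in M i) && (#|D| <= d)%N && (D \subset halves S).
have hS := halves_side_sub Ss.
apply: (@le_trans _ _ ('C(#|side|, #|S|)%:R * \sum_(D : {set H} | Q D)
   expect (fun eta => 1 * (closed_under (halves S :\: D)%SET eta)%:R))).
  rewrite ler_wpM2l // -expect_sum; apply: expect_le => eta ve.
  case: (boolP (bad_middle lo d eta S)) => [/and4P[_ _ _ hb]|_]; last first.
    by rewrite sumr_ge0 // => X _; rewrite mul1r.
  have hQ : Q (boundary eta S).
    by rewrite /Q hb boundary_sub andbT (fintype.subset_trans (boundary_sub _ _)).
  by rewrite (bigD1 _ hQ) /= closed_boundary // mulr1 lerDl sumr_ge0 // => X _; rewrite mul1r.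
apply: (@le_trans _ _ (\sum_(D : {set H} | Q D) E)).
  rewrite mulr_sumr; apply: ler_sum => D /andP[/andP[D1 D2] D3].
  have cX : #|(halves S :\: D)%SET| = (#|halves S| - #|D|)%N by rewrite cardsD (finset.setIidPr D3).
  have := @closed_in_le R M _ finset.set0 (fun=> 1) (halves S :\: D)%SET i (@weight_on0 R M) cX.
  rewrite finset.setD0 card_half_edges_in expect_cst mulr1 => /(_ _) h.
  apply: (@le_trans _ _ ('C(#|side|, #|S|)%:R * closed_rate R n (#|halves S| - #|D|))).
    rewrite ler_wpM2l // h //; apply: fintype.subset_trans hS; exact: finset.subsetDl.
  apply: (@closed_rate_middle S finset.set0 lo E d) => //.
  by clear -D2; lia.
rewrite sumr_const -[E *+ _]mulr_natl ler_wpM2r // ler_nat.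
rewrite -card_half_edges_in -card_few_subsets subset_leq_card //.
by apply/fintype.subsetP => D; rewrite !inE => /andP[->].
Qed.

Lemma bad_middle_le (c e : R) (d : nat) : 0 < c <= 1 -> e <= c / 2 ->
  (forall n d : nat, d%:R <= e * n%:R -> (few_subsets n d)%:R <= expR (c / 64 * n%:R)) ->
  d%:R <= e * n%:R ->
  expect (fun eta => [exists S, bad_middle (c * n%:R) d eta S]%:R) <= n%:R * expR (- (c / 48 * n%:R)).
Proof.
move=> /andP[c0 c1] ec he hd1; set N := n%:R in hd1 *; have N0 : 0 <= N by [].
have hd2 : d%:R <= c * N / 2.
  by apply: le_trans hd1 _; rewrite mulrAC ler_wpM2r.
have hB := he n d hd1; rewrite -/N in hB.
(* The exponent is chosen so that c/4 - 6 (7c/192) = 2 (c/64), as [hE] requires; after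
   multiplication by [few_subsets] the rate c/64 - 7c/192 = -c/48 remains. *)
pose E := expR (- (7 * c / 192 * N)).
have E0 : 0 <= E by apply: expR_ge0.
have hE : (few_subsets n d)%:R ^+ 2 <= E ^+ 6 * expR (c * N / 4).
  apply: (@le_trans _ _ (expR (c / 64 * N) ^+ 2)).
    by rewrite lerXn2r ?nnegrE ?expR_ge0.
  rewrite /E -!expRM_natl -expRD ler_expR; lra.
apply: (@le_trans _ _ (\sum_(S : {set V} | S \subset side) expect (fun eta => (bad_middle (c * N) d eta S)%:R))).
  rewrite -expect_sum; apply: expect_le => eta _; apply: le_trans (exists_le_sum R _) _.
  rewrite [X in _ <= X]big_mkcond; apply: ler_sum => S _; case: ifP => // h.
  by rewrite /bad_middle h.
(* Division by the binomial coefficient makes all sizes contribute equally, so only the number of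
   sizes matters. *)
pose f k := ('C(#|side|, k)%:R)^-1 * ((few_subsets n d)%:R * E).
apply: (@le_trans _ _ (\sum_(S : {set V} | S \subset side) f #|S|)).
  apply: ler_sum => S Ss; rewrite /f.
  have b0 : 0 < 'C(#|side|, #|S|)%:R :> R by rewrite ltr0n bin_gt0 subset_leq_card.
  by rewrite [X in _ <= X]mulrC ler_pdivlMr // mulrC expect_bad_middle.
rewrite sum_sets_by_card /f.
rewrite (eq_bigr (fun=> (few_subsets n d)%:R * E)); last first.
  move=> k _; rewrite mulrA divff ?mul1r // pnatr_eq0 -lt0n bin_gt0; exact: (ltn_ord k).
rewrite sumr_const card_ord -[_ *+ _]mulr_natl.
have hn : (#|side|.+1 <= n)%N.
  have := card_side; have := nhalf_in_gt0 M i; clear; lia.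
apply: ler_pM => //; first by rewrite mulr_ge0.
  by rewrite ler_nat.
apply: (@le_trans _ _ (expR (c / 64 * N) * E)); first by rewrite ler_wpM2r.
by rewrite /E -expRD ler_expR; lra.
Qed.

(** For [L] inside a community, these are the half-edges that prevent [L] from being one class of a
    bipartition of that community. *)
Definition crossing_or_inside (eta : {perm H}) (L : {set V}) : {set H} :=
  [set x : H | (tag x \in L) && ((tag (eta x) \in L) || (x \in crossing eta))]%SET.

Definition bad_half (d : nat) (eta : {perm H}) (L : {set V}) : bool :=
  [&& L \subset side, (499 * n <= 1000 * #|halves L|)%N & (#|crossing_or_inside eta L| <= d)%N].

(** Partners of the half-edges of [L] are revealed one by one; each falls outside [L] with
    conditional probability close to 1/2. Stopping after 3n/8 reveals keeps the ratio below 127/250,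
    because |halves L| >= 499n/1000. The number of reveals still exceeds n/3, which beats the at
    most 2^(n/3) vertex sets. *)
Lemma expect_bad_half (d : nat) (L : {set V}) : L \subset side -> (1000 <= n)%N -> (100 * d <= n)%N ->
  expect (fun eta => (bad_half d eta L)%:R) <=
  (few_subsets n d)%:R * (127 / 250) ^+ ((3 * n) %/ 8).
Proof.
move=> Ls hn hd; set t := 127 / 250; have t0 : 0 <= t :> R by rewrite /t; lra.
case: (leqP (499 * n) (1000 * #|halves L|)) => hs; last first.
  apply: (@le_trans _ _ (expect (fun=> 0))); last by rewrite expect_cst mulr_ge0 ?exprn_ge0.
  by apply: expect_le => eta _; rewrite /bad_half [(499 * n <= _)%N]leqNgt hs /= andbF.
pose Q (D : {set H}) := (D \subset half_edges_in M i) && (#|D| <= d)%N.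
have hL := halves_side_sub Ls.
pose Y := (half_edges_in M i :\: halves L)%SET.
apply: (@le_trans _ _ (\sum_(D : {set H} | Q D)
   expect (fun eta => 1 * (maps_into (halves L :\: D)%SET Y eta)%:R))).
  rewrite -expect_sum; apply: expect_le => eta ve.
  case: (boolP (bad_half d eta L)) => [/and3P[_ _ hb]|_]; last first.
    by rewrite sumr_ge0 // => X _; rewrite mul1r.
  have hQ : Q (crossing_or_inside eta L).
    rewrite /Q hb andbT; apply: fintype.subset_trans hL.
    by apply/fintype.subsetP => x; rewrite !inE => /andP[].
  have hm : maps_into (halves L :\: crossing_or_inside eta L)%SET Y eta.
    apply/forall_inP => x; rewrite !inE => /andP[h xL].
    move: h; rewrite xL /= negb_or negbK => /andP[-> /eqP ->] /=.
    by have /fintype.subsetP/(_ x) := hL; rewrite !inE; apply.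
  by rewrite (bigD1 _ hQ) /= hm mulr1 lerDl sumr_ge0 // => X _; rewrite mul1r.
apply: (@le_trans _ _ (\sum_(D : {set H} | Q D) t ^+ ((3 * n) %/ 8))); last first.
  rewrite sumr_const -[_ *+ _]mulr_natl ler_wpM2r ?exprn_ge0 // ler_nat.
  rewrite -card_half_edges_in -card_few_subsets subset_leq_card //.
  by apply/fintype.subsetP => D; rewrite !inE.
apply: ler_sum => D /andP[D1 D2].
apply: (@le_trans _ _ (t ^+ ((3 * n) %/ 8) * expect (fun=> 1))); last by rewrite expect_cst mulr1.
have sX : (#|halves L| - d <= #|halves L :\: D|%SET)%N.
  rewrite cardsD; have := subset_leq_card (finset.subsetIr (halves L) D).
  by move: D2; clear; lia.
have cY : #|Y| = (n - #|halves L|)%N.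
  by rewrite /Y cardsD card_half_edges_in (finset.setIidPr hL).
have hln : (#|halves L| <= n)%N by rewrite -card_half_edges_in subset_leq_card.
apply: (@maps_into_le R M _ finset.set0 _ _ _ i t (@weight_on0 R M)) => //.
- by move: sX hs hd hn; clear; lia.
- by rewrite -setI_eq0 finset.setI0.
- rewrite -setI_eq0; apply/eqP/setP => x; rewrite !inE.
  by case: (tag x \in L); rewrite ?andbF.
- by rewrite finset.setD0; apply: finset.subsetDl.
- by apply: fintype.subset_trans hL; apply: finset.subsetDl.
move=> l hl; rewrite finset.setD0 card_half_edges_in cY.
have l8 : (8 * l + 8 <= 3 * n)%N by move: hl; clear; lia.
split; first by move: l8 hn; clear; lia.
rewrite natrB //.
have r1 : 499 * n%:R <= 1000 * #|halves L|%:R :> R by rewrite -!natrM ler_nat.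
have r2 : 8 * l%:R + 8 <= 3 * n%:R :> R by rewrite -!natrM -natrD ler_nat.
have r3 : 1000 <= n%:R :> R by rewrite ler_nat.
by rewrite /t; lra.
Qed.

Lemma bad_half_le (e : R) (d : nat) : (1000 <= n)%N -> e <= 1 / 100 ->
  (forall n d : nat, d%:R <= e * n%:R -> (few_subsets n d)%:R <= expR (2 / 500 * n%:R) :> R) ->
  d%:R <= e * n%:R ->
  expect (fun eta => [exists L, bad_half d eta L]%:R) <= 2 * expR (- (n%:R / 100)).
Proof.
move=> hn e100 he hd1; set N := n%:R in hd1 *; have N0 : 0 <= N by [].
have hd2 : (100 * d <= n)%N.
  rewrite -(ler_nat R) natrM; have : d%:R <= 1 / 100 * N.
    by apply: le_trans hd1 _; rewrite ler_wpM2r.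
  by rewrite -/N; lra.
have hB := he n d hd1; rewrite -/N in hB.
set t : R := 127 / 250; have t0 : 0 <= t by rewrite /t; lra.
set j := ((3 * n) %/ 8)%N.
apply: (@le_trans _ _ (\sum_(L : {set V} | L \subset side) expect (fun eta => (bad_half d eta L)%:R))).
  rewrite -expect_sum; apply: expect_le => eta _; apply: le_trans (exists_le_sum R _) _.
  rewrite [X in _ <= X]big_mkcond; apply: ler_sum => S _; case: ifP => // h.
  by rewrite /bad_half h.
apply: (@le_trans _ _ (\sum_(L : {set V} | L \subset side) expR (2 / 500 * N) * t ^+ j)).
  apply: ler_sum => L Ls; apply: le_trans (expect_bad_half Ls hn hd2) _.
  apply: ler_wpM2r; [exact: exprn_ge0|exact: hB].
rewrite sumr_const (eq_card (B := mem (powerset side))); last by move=> S; rewrite !inE.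
rewrite card_powerset -[_ *+ _]mulr_natl natrX.

have vj : (#|side| <= j)%N by have := card_side; move: hn; rewrite /j; clear; lia.
(* Writing 127/250 as half of 127/125 lets |side| of the halvings cancel the number of vertex sets;
   about n/24 of them remain for the decay. *)
have [q [q0 q1 qt]] : exists q : R, [/\ 0 <= q, q <= 1 + 2 / 125 & t = 2^-1 * q].
  by exists (127 / 125); rewrite /t; split; lra.
have -> : t ^+ j = 2 ^- #|side| * 2 ^- (j - #|side|) * q ^+ j.
  by rewrite -!exprVn -exprD subnKC // -exprMn qt.
rewrite (_ : 2 ^+ _ * _ = (2 ^+ #|side| * 2 ^- #|side|) * (expR (2 / 500 * N) * 2 ^- (j - #|side|) * q ^+ j)); last by ring.
rewrite divff ?mul1r ?expf_neq0 //.
have a1 : q ^+ j <= expR (3 / 500 * N).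
  apply: (@le_trans _ _ (expR (2 / 125) ^+ j)).
    by rewrite lerXn2r ?nnegrE ?expR_ge0 // (le_trans q1) // expR_ge1Dx.
  rewrite -expRM_natl ler_expR.
  have : 8 * j%:R <= 3 * N :> R by rewrite -!natrM ler_nat /j; clear; lia.
  by lra.
have a2 : 2 ^- (j - #|side|) <= expR (1 / 2 - N / 48).
  apply: (@le_trans _ _ (expR (- (1 / 2)) ^+ (j - #|side|))).
    rewrite expRN exprVn lef_pV2 ?posrE ?exprn_gt0 ?expR_gt0 //.
    by rewrite lerXn2r ?nnegrE ?expR_ge0 // expR_half_le2.
  rewrite -expRM_natl ler_expR.
  have : N <= 24 * (j - #|side|)%:R + 24 :> R.
    by rewrite -natrM -natrD ler_nat; have := card_side; rewrite /j; clear; lia.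
  by lra.
apply: (@le_trans _ _ (expR (2 / 500 * N) * expR (1 / 2 - N / 48) * expR (3 / 500 * N))).
  have p2 : 0 <= 2 ^- (j - #|side|) :> R by rewrite invr_ge0 exprn_ge0.
  apply: ler_pM; [exact: mulr_ge0 (expR_ge0 _) p2|exact: exprn_ge0| |exact: a1].
  by apply: ler_wpM2l; [exact: expR_ge0|exact: a2].
rewrite -!expRD; apply: (@le_trans _ _ (expR (1 / 2) * expR (- (N / 100)))).
  by rewrite -expRD ler_expR; lra.
by rewrite ler_wpM2r ?expR_ge0 // expR_half_le2.
Qed.

End MiddleSets.

(** * Expansion and non-bipartiteness outside the bad events *)

Section GoodGraph.
Variables (R : realType) (M : two_community) (eta : {perm half_edge M}).
Hypothesis eta_valid : valid eta.
Local Notation H := (half_edge M).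
Local Notation V := (vertex M).
Local Notation N := ((nhalf M)%:R : R).
Variables (rho e : R) (d : bool -> nat).
Hypothesis rho01 : 0 < rho <= 1.
Hypothesis e01 : 0 < e <= 1.
Hypothesis balanced : forall i, rho * (nhalf M)%:R <= (nhalf_in M i)%:R.
Hypothesis hd : forall i, e * (nhalf_in M i)%:R < (d i)%:R + 1.
Hypothesis hp : forall i, (noutgoing M)%:R <= e * (nhalf_in M i)%:R / 2.
Local Notation C := (small_factor rho).
Local Notation c := ((16 * small_factor rho)^-1).
Hypothesis no_small : forall S, ~~ bad_small rho eta S.
Hypothesis no_middle : forall i S, ~~ bad_middle i (c * (nhalf_in M i)%:R) (d i) eta S.
Hypothesis no_half : forall i L, ~~ bad_half i (d i) eta L.

(** The value 1/9 serves small sets. For the others e n_i half-edges are found in one community, at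
    most half of them are lost to crossings, and n_i >= rho N. *)
Definition expansion : R := Num.min (1 / 9) (e * rho / 2).

Let rho_gt0 : 0 < rho. Proof. by case/andP: rho01. Qed.
Let e_gt0 : 0 < e. Proof. by case/andP: e01. Qed.
Let N_gt0 : 0 < N. Proof. exact: nhalf_gt0. Qed.
Let C_ge : 62 <= C. Proof. by have [h1 h2] := small_factor_ge rho01; apply: le_trans h1. Qed.
Let C_gt0 : 0 < C. Proof. by apply: lt_le_trans C_ge. Qed.
Let c_gt0 : 0 < c. Proof. by rewrite invr_gt0 mulr_gt0. Qed.
Let eK : forall x, eta (eta x) = x. Proof. by case: eta_valid. Qed.

Lemma expansion01 : 0 < expansion <= 1.
Proof.
rewrite /expansion lt_min !divr_gt0 ?mulr_gt0 //= ge_min; apply/orP; left; lra.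
Qed.

Lemma c_small : c <= 1 / 500.
Proof.
have h : 0 < 16 * C by rewrite mulr_gt0.
by rewrite -[X in X <= _]mul1r ler_pdivrMr //; have := C_ge; lra.
Qed.

(* A set whose inner boundary is large in one community keeps half of it after
   the crossing half-edges are removed. *)
Lemma from_side i (A B : {set H}) : e * (nhalf_in M i)%:R <= #|A|%:R ->
  A :\: B \subset (crossing eta :&: half_edges_in M i)%SET ->
  expansion * N <= #|B|%:R.
Proof.
move=> hA /subset_leq_card hAB; have [_ _ hc] := eta_valid; rewrite hc in hAB.
have h1 : (#|A| <= #|B| + noutgoing M)%N.
  have := cardsID B A; have := subset_leq_card (finset.subsetIr A B).
  by move: hAB; clear; lia.
rewrite -(ler_nat R) natrD in h1.
have h2 := hp i; have h3 := balanced i.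
have h4 : e * (rho * N) <= e * (nhalf_in M i)%:R by rewrite ler_pM2l.
apply: (@le_trans _ _ (e * rho / 2 * N)); last by lra.
by rewrite ler_wpM2r ?(ltW N_gt0) // /expansion ge_min lexx orbT.
Qed.

Lemma boundary_side i (S : {set V}) : S \subset side M i ->
  c * (nhalf_in M i)%:R <= #|halves S|%:R -> (2 * #|halves S| <= nhalf_in M i)%N ->
  e * (nhalf_in M i)%:R <= #|boundary eta S|%:R.
Proof.
move=> h1 h2 h3; have := no_middle i S; rewrite /bad_middle h1 h2 h3 /= -ltnNge => h.
by apply: le_trans (ltW (hd i)) _; rewrite natr1 ler_nat.
Qed.

Lemma card_split (S : {set V}) : #|halves S| =
  (#|halves (S :&: side M false)| + #|halves (S :&: side M true)|)%N.
Proof.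
rewrite -(cardsID (half_edges_in M false) (halves S)); congr (_ + _)%N.
  by apply: eq_card => x; rewrite !inE.
by apply: eq_card => x; rewrite !inE andbC; case: (community _).
Qed.

Lemma halves_le_N (S : {set V}) : #|halves S|%:R <= N.
Proof. by rewrite ler_nat -card_half_edge max_card. Qed.

Lemma is_expander : expander eta expansion.
Proof.
move=> S hS; have /andP[ex0 _] := expansion01.
have [->|S0] := eqVneq S finset.set0.
  rewrite (_ : halves _ = finset.set0) ?cards0 ?mulr0 //.
  by apply/setP => x; rewrite !inE.
have sN := halves_le_N S.
have [hs|hs] := lerP (8 * C * #|halves S|%:R) N.
  have := no_small S; rewrite /bad_small S0 hs /= -leqNgt => h.
  apply: (@le_trans _ _ (1 / 9 * #|halves S|%:R)).
    by rewrite ler_wpM2r // /expansion ge_min lexx.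
  have : (#|halves S| <= 9 * #|boundary eta S|)%N by [].
  by rewrite -(ler_nat R) natrM /boundary; lra.
(* A set that is not small holds a positive share of some community, and its boundary there
   suffices. *)
have [i hi] : exists i, c * (nhalf_in M i)%:R <= #|halves (S :&: side M i)|%:R.
  have h : (nhalf_in M false)%:R + (nhalf_in M true)%:R <
      16 * C * (#|halves (S :&: side M false)|%:R + #|halves (S :&: side M true)|%:R) :> R.
    rewrite -nhalfE -natrD -card_split; apply: lt_le_trans hs _.
    rewrite ler_wpM2r //; have := C_gt0; lra.
  have [h1|h1] := lerP (c * (nhalf_in M false)%:R) #|halves (S :&: side M false)|%:R.
    by exists false.
  have C16 : 0 < 16 * C by apply: mulr_gt0.
  exists true; rewrite leNgt; apply/negP => h2.
  have h3 := ler_wpM2l (ltW C16) (lerD (ltW h1) (ltW h2)).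
  have e1 (x : R) : 16 * C * (c * x) = x by rewrite mulrA divff ?mul1r // lt0r_neq0.
  by rewrite !mulrDr !e1 in h3; move: h; rewrite mulrDr; lra.
have b1 : e * (nhalf_in M i)%:R <= #|boundary eta (S :&: side M i)%SET|%:R.
  apply: boundary_side => //; first exact: finset.subsetIr.
  by have := hS i; congr (2 * _ <= _)%N; apply: eq_card => x; rewrite !inE.
apply: (@le_trans _ _ (expansion * N)); first by rewrite ler_wpM2l // ltW.
apply: from_side b1 _; apply/fintype.subsetP => x; rewrite !inE.
by case: (tag x \in S); case: (tag (eta x) \in S) => //=; case: eqP => // ->; case: eqP.
Qed.

(** If [U] fills more than half of a community, its boundary is counted from the complement in that
    community. When the complement is negligible, one of the two classes of [U] has nearly half of
    the community, and [no_half] supplies half-edges joining that class to itself. *)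
Lemma is_non_bipartite : non_bipartite eta expansion.
Proof.
move=> U L; have /andP[ex0 _] := expansion01.
set B := [set x : H | _]%SET.
have UN := halves_le_N U.
have hEN : expansion * N <= #|B|%:R -> expansion * #|halves U|%:R <= #|B|%:R.
  by apply: le_trans; rewrite ler_wpM2l // ltW.
have cI i : #|halves U :&: half_edges_in M i|%SET = #|halves (U :&: side M i)|.
  by apply: eq_card => x; rewrite !inE.
case: (boolP [forall i, (2 * #|halves U :&: half_edges_in M i|%SET <= nhalf_in M i)%N]) => [/forallP h|].
  apply: le_trans (is_expander h) _; rewrite ler_nat subset_leq_card //.
  by apply/fintype.subsetP => x; rewrite !inE => /andP[-> ->].
rewrite negb_forall => /existsP[i]; rewrite -ltnNge cI => hi; apply: hEN.
pose K := (side M i :\: U)%SET.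
have KS : K \subset side M i by apply: finset.subsetDl.
have cK : (#|halves K| + #|halves (U :&: side M i)| = nhalf_in M i)%N.
  rewrite -card_half_edges_in addnC -(cardsID (halves U) (half_edges_in M i)); congr (_ + _)%N.
    by apply: eq_card => x; rewrite !inE andbC.
  by apply: eq_card => x; rewrite !inE.
have [hK|hK] := lerP (c * (nhalf_in M i)%:R) #|halves K|%:R.
  have b1 : e * (nhalf_in M i)%:R <= #|boundary eta K|%:R.
    by apply: boundary_side => //; move: hi cK; clear; lia.
  (* Edges between the complement and [U] are found by their end outside [U], so [B] is replaced by
     its image under [eta]. *)
  rewrite -(card_imset (mem B) (@perm_inj _ eta)).
  apply: from_side b1 _; apply/fintype.subsetP => x; rewrite inE => /andP[xB].
  rewrite !inE => /andP[/andP[xU /eqP xi] h]; rewrite xi eqxx andbT.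
  move: h; rewrite negb_and negbK => /orP[h|//].
  case/negP: xB; apply/imsetP; exists (eta x); last by rewrite eK.
  by rewrite inE eK h xU.
have part (P : {set V}) : (P == L) || (P == ~: L)%SET ->
    (499 * nhalf_in M i <= 1000 * #|halves (U :&: P :&: side M i)|)%N -> expansion * N <= #|B|%:R.
  move=> hP h; set Li := (U :&: P :&: side M i)%SET in h.
  have := no_half i Li; rewrite /bad_half h andTb finset.subsetIr /= -ltnNge => hd'.
  have hA : e * (nhalf_in M i)%:R <= #|crossing_or_inside eta Li|%:R.
    by apply: le_trans (ltW (hd i)) _; rewrite natr1 ler_nat.
  apply: from_side hA _; apply/fintype.subsetP => x; rewrite inE => /andP[xB].
  rewrite !inE => /andP[/andP[/andP[xU xP] xi]]; rewrite xi andbT => /orP[|//].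
  move=> /andP[/andP[yU yP] _]; case/negP: xB; rewrite inE xU yU /=.
  case/orP: hP xP yP => /eqP ->; first by move=> -> ->.
  by rewrite !inE => /negPf -> /negPf ->.
have cs := c_small.
have hU : 499 / 500 * (nhalf_in M i)%:R <= #|halves (U :&: side M i)|%:R :> R.
  have : #|halves K|%:R + #|halves (U :&: side M i)|%:R = (nhalf_in M i)%:R :> R by rewrite -natrD cK.
  have : c * (nhalf_in M i)%:R <= 1 / 500 * (nhalf_in M i)%:R by rewrite ler_wpM2r.
  move: hK; lra.
have hUn : (499 * nhalf_in M i <= 500 * #|halves (U :&: side M i)|)%N.
  by rewrite -(ler_nat R) !natrM; lra.
have sp : (#|halves (U :&: L :&: side M i)| + #|halves (U :&: ~: L :&: side M i)| =
    #|halves (U :&: side M i)|)%N.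
  rewrite -(cardsID (halves L) (halves (U :&: side M i))); congr (_ + _)%N.
    by apply: eq_card => x; rewrite !inE; case: (tag x \in L); rewrite ?andbT ?andbF.
  by apply: eq_card => x; rewrite !inE; case: (tag x \in L); rewrite ?andbT ?andbF.
case: (leqP (499 * nhalf_in M i) (1000 * #|halves (U :&: L :&: side M i)|)) => h1.
  by apply: part h1; rewrite eqxx.
apply: (part (~: L)%SET); first by rewrite eqxx orbT.
by move: h1 sp hUn; clear; lia.
Qed.

End GoodGraph.

(** * Good graphs with high probability *)

Section GoodGraphProbability.
Variable R : realType.

Lemma mulr_expRN_le (a x : R) : 0 < a -> 0 < x -> x * expR (- (a * x)) <= 2 / a ^+ 2 / x.
Proof.
move=> a0 x0; have ax0 : 0 < a * x by rewrite mulr_gt0.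
have h := @expR_ge1Dxn R (a * x) 1 (ltW ax0).
have h2 : (a * x) ^+ 2 / 2 <= expR (a * x) by rewrite (_ : 2 = 2`!%:R) //; lra.
rewrite expRN ler_pdivlMr // mulrAC ler_pdivrMr ?expR_gt0 // mulrC.
have -> : 2 / a ^+ 2 * expR (a * x) = expR (a * x) * (2 / a ^+ 2) by rewrite mulrC.
rewrite mulrA ler_pdivlMr ?exprn_gt0 //.
by rewrite exprMn in h2; lra.
Qed.

Lemma expander_whp (rho : R) : 0 < rho <= 1 -> exists phi e K : R,
  [/\ 0 < phi <= 1, 0 < e, 0 < K & forall M : two_community,
    (forall v : vertex M, (3 <= degree v)%N) ->
    (forall i, rho * (nhalf M)%:R <= (nhalf_in M i)%:R) ->
    (forall i, (1000 <= nhalf_in M i)%N) ->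
    (noutgoing M)%:R <= e * (nhalf M)%:R ->
    expect (fun eta : {perm half_edge M} => (~~ `[< expander eta phi /\ non_bipartite eta phi >])%:R) <= K / (nhalf M)%:R].
Proof.
move=> rho01; have /andP[r0 r1] := rho01.
set C := small_factor rho; have C62 : 62 <= C.
  by have [h1 h2] := small_factor_ge rho01; apply: le_trans h1.
have C0 : 0 < C by apply: lt_le_trans C62.
pose c := (16 * C)^-1; have c0 : 0 < c by rewrite invr_gt0 mulr_gt0.
have c1 : c <= 1.
  have C16 : 0 < 16 * C by apply: mulr_gt0.
  by rewrite /c -[X in X <= _]mul1r ler_pdivrMr //; lra.
have [|e2 e20 he2] := @few_subsets_exp R (c / 64); first by apply/andP; split; lra.
have [|e3 e30 he3] := @few_subsets_exp R (2 / 500); first by apply/andP; split; lra.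
pose e := Num.min (Num.min e2 (c / 2)) (Num.min e3 (1 / 100)).
have e0 : 0 < e by rewrite /e !lt_min e20 e30 !divr_gt0.
have le2 : e <= e2 by rewrite /e !ge_min lexx.
have lec : e <= c / 2 by rewrite /e !ge_min lexx orbT.
have le3 : e <= e3 by rewrite /e !ge_min lexx !orbT.
have le1 : e <= 1 / 100 by rewrite /e !ge_min lexx !orbT.
have e1 : e <= 1 by lra.
clearbody e; exists (expansion rho e), (e * rho / 2).
have ex01 : 0 < expansion rho e <= 1 by apply: expansion01; rewrite ?e0.
pose K := 16 * C + 2 * (2 / (c / 48) ^+ 2 / rho) + 2 * (200 / rho).
exists K; split=> //.
- by rewrite divr_gt0 ?mulr_gt0.
- have t1 : 0 < 2 / (c / 48) ^+ 2 / rho by do 2!apply: divr_gt0 => //; rewrite exprn_gt0 // divr_gt0.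
  have t2 : 0 < 200 / rho by rewrite divr_gt0.
  by rewrite /K; lra.
move=> M deg3 bal big hp; pose N := (nhalf M)%:R : R.
have N0 : 0 < N by apply: nhalf_gt0.
pose d i := Num.truncn (e * (nhalf_in M i)%:R).
have dP i : (d i)%:R <= e * (nhalf_in M i)%:R < (d i)%:R + 1.
  by rewrite natr1; apply: truncn_itv; rewrite mulr_ge0 // ltW.
pose bad (eta : {perm half_edge M}) := [exists S, bad_small rho eta S]%:R +
  ([exists S, bad_middle false (c * (nhalf_in M false)%:R) (d false) eta S]%:R +
   [exists S, bad_middle true (c * (nhalf_in M true)%:R) (d true) eta S]%:R) +
  ([exists L, bad_half false (d false) eta L]%:R + [exists L, bad_half true (d true) eta L]%:R) : R.
apply: (@le_trans _ _ (expect bad)).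
  apply: expect_le => eta ve.
  have b0 : 0 <= bad eta by rewrite /bad !addr_ge0.
  case: (boolP `[< _ >]) => // /asboolP h /=; rewrite leNgt; apply/negP => hb; apply: h.
  have nb (b : bool) : (b%:R < 1 :> R) -> ~~ b by case: b => //; rewrite ltxx.
  have nat0 (b : bool) : 0 <= b%:R :> R by [].
  have hs : ~~ [exists S, bad_small rho eta S].
    by apply: nb; apply: le_lt_trans hb; rewrite /bad -!addrA lerDl !addr_ge0.
  have hm i : ~~ [exists S, bad_middle i (c * (nhalf_in M i)%:R) (d i) eta S].
    apply: nb; apply: le_lt_trans hb; rewrite /bad.
    by case: i; rewrite -!addrA; [rewrite addrCA addrC -!addrA addrCA lerDl|rewrite addrCA lerDl];
      rewrite !addr_ge0.
  have hh i : ~~ [exists L, bad_half i (d i) eta L].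
    apply: nb; apply: le_lt_trans hb; rewrite /bad.
    by case: i; rewrite [X in _ <= X]addrC ?lerDl -?addrA ?[X in _ <= X + _]addrC;
      rewrite ?lerDr ?lerDl ?addr_ge0 // [X in _ <= X]addrCA lerDl !addr_ge0.
  have e01 : 0 < e <= 1 by rewrite e0.
  have hd i : e * (nhalf_in M i)%:R < (d i)%:R + 1 by case/andP: (dP i).
  have hp' i : (noutgoing M)%:R <= e * (nhalf_in M i)%:R / 2.
    apply: le_trans hp _; have := ler_wpM2l (ltW e0) (bal i); lra.
  have ns S : ~~ bad_small rho eta S by move: hs; rewrite negb_exists => /forallP.
  have nm i S : ~~ bad_middle i (c * (nhalf_in M i)%:R) (d i) eta S.
    by move: (hm i); rewrite negb_exists => /forallP.
  have nh i L : ~~ bad_half i (d i) eta L by move: (hh i); rewrite negb_exists => /forallP.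
  split.
    move=> S hS; exact: (is_expander ve rho01 e01 bal hd hp' ns nm hS).
  exact: (is_non_bipartite ve rho01 e01 bal hd hp' ns nm nh).
have hS := bad_small_le deg3 rho01 bal.
have hM i : expect (fun eta : {perm half_edge M} => [exists S, bad_middle i (c * (nhalf_in M i)%:R) (d i) eta S]%:R)
    <= 2 / (c / 48) ^+ 2 / rho / N.
  have n0 : 0 < (nhalf_in M i)%:R :> R by rewrite ltr0n nhalf_in_gt0.
  apply: (@le_trans _ _ ((nhalf_in M i)%:R * expR (- (c / 48 * (nhalf_in M i)%:R)))).
    have c01 : 0 < c <= 1 by rewrite c0 c1.
    have he n k : k%:R <= e * n%:R -> (few_subsets n k)%:R <= expR (c / 64 * n%:R).
      by move=> hk; apply: he2; apply: le_trans hk _; rewrite ler_wpM2r.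
    have /andP[hdi _] := dP i.
    exact: (@bad_middle_le R M deg3 i c e (d i) c01 lec he hdi).
  have c48 : 0 < c / 48 by rewrite divr_gt0.
  apply: le_trans (mulr_expRN_le c48 n0) _.
  have K0 : 0 <= 2 / (c / 48) ^+ 2 := divr_ge0 (ler0n _ 2) (exprn_ge0 _ (ltW c48)).
  have rN : 0 < rho * N by apply: mulr_gt0.
  apply: (@le_trans _ _ (2 / (c / 48) ^+ 2 * (rho * N)^-1)); last first.
    by rewrite le_eqVlt; apply/orP; left; apply/eqP; field; rewrite !lt0r_neq0.
  by apply: ler_wpM2l => //; rewrite lef_pV2 ?posrE // bal.
have hH i : expect (fun eta : {perm half_edge M} => [exists L, bad_half i (d i) eta L]%:R) <= 200 / rho / N.
  have n0 : 0 < (nhalf_in M i)%:R :> R by rewrite ltr0n nhalf_in_gt0.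
  apply: (@le_trans _ _ (2 * expR (- ((nhalf_in M i)%:R / 100)))).
    have he n k : k%:R <= e * n%:R -> (few_subsets n k)%:R <= expR (2 / 500 * n%:R) :> R.
      by move=> hk; apply: he3; apply: le_trans hk _; rewrite ler_wpM2r.
    have /andP[hdi _] := dP i.
    exact: (@bad_half_le R M deg3 i e (d i) (big i) le1 he hdi).
  rewrite expRN ler_pdivrMr ?expR_gt0 // mulrC.
  have h1 := @expR_ge1Dx R ((nhalf_in M i)%:R / 100).
  have h2 := bal i; rewrite -/N in h2.
  have rN : 0 < rho * N by apply: mulr_gt0.
  rewrite (_ : _ * (200 / rho / N) = expR ((nhalf_in M i)%:R / 100) * 200 / (rho * N)); last first.
    by field; rewrite !lt0r_neq0.
  rewrite ler_pdivlMr //.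
  have := expR_gt0 ((nhalf_in M i)%:R / 100 : R); lra.
rewrite /bad !expectD; apply: le_trans (lerD (lerD hS (lerD (hM false) (hM true))) (lerD (hH false) (hH true))) _.
rewrite -/N -/C /K le_eqVlt; apply/orP; left; apply/eqP; ring.
Qed.

End GoodGraphProbability.

(** * The annealed walk and the variance of the crossing probability *)

Section AnnealedWalk.
Variables (R : realType) (M : two_community).
Hypothesis degree_ge3 : forall v : vertex M, (3 <= degree v)%N.
Local Notation H := (half_edge M).
Local Notation expect := (@expect R M).
Local Notation p := (noutgoing M).
Implicit Types (w A : {perm H} -> R) (D T : {set H}).

Definition survive (t : nat) (x : H) (eta : {perm H}) : R := 1 - crossed R eta t x.

Lemma survive01 t x eta : 0 <= survive t x eta <= 1.
Proof. by have /andP[h1 h2] := crossed01 R eta degree_ge3 t x; rewrite /survive; lra. Qed.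

Lemma survive0 x eta : survive 0 x eta = 1.
Proof. by rewrite /survive subr0. Qed.

Lemma surviveS t x eta : survive t.+1 x eta =
  if x \in crossing eta then 0
  else (\sum_(z | neighbors z (eta x)) survive t z eta) / (hdeg (eta x))%:R.
Proof.
rewrite /survive /=; case: ifP => _; first by rewrite subrr.
have e1 : 1 = step eta (fun=> (1 : R)) x by rewrite step_cst.
by rewrite {1}e1 !stepE /kern -mulrBl -sumrB.
Qed.

Variables (i : bool) (L Delta : nat).
Local Notation n := (nhalf_in M i).
Hypothesis degree_le : forall v : vertex M, (degree v <= Delta)%N.
Hypothesis Ln : (L < n)%N.

(** [L] caps the number of half-edges already revealed. Conditionally on them, the next half-edge
    crosses with probability at least [rate] and at most p/(n - L), and its partner sits at an
    already visited vertex with probability at most [collision]; [theta] bounds both accidents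
    together. *)
Definition rate : R := Num.max 0 ((p%:R - L%:R) / n%:R).
Definition lambda : R := 1 - rate.
Definition collision : R := (Delta * L)%N%:R / (n - L)%N%:R.
Definition theta : R := p%:R / (n - L)%N%:R + collision.

Let a_gt0 : 0 < (n - L)%N%:R :> R. Proof. by rewrite ltr0n subn_gt0. Qed.
Let n_gt0 : 0 < n%:R :> R. Proof. by rewrite ltr0n (leq_ltn_trans _ Ln). Qed.

Lemma lambda01 : 0 <= lambda <= 1.
Proof.
rewrite /lambda /rate subr_ge0 ge_max ler01 /= ler_pdivrMr // mul1r gerBl le_max lexx andbT.
rewrite lerBlDr; apply: ler_wpDr => //; rewrite ler_nat; exact: noutgoing_le.
Qed.

Lemma collision_ge0 : 0 <= collision.
Proof. by rewrite divr_ge0. Qed.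

Definition touched T (y : H) := [exists z in T, tag z == tag y].

Lemma card_touched T : (#|[set y | touched T y]%SET| <= Delta * #|T|)%N.
Proof.
have -> : [set y | touched T y]%SET = (\bigcup_(z in T) [set y : H | tag y == tag z])%SET.
  apply/setP => y; rewrite inE; apply/exists_inP/bigcupP => -[z zT].
    by move=> /eqP e; exists z => //; rewrite inE e.
  by rewrite inE => /eqP e; exists z => //; rewrite e.
rewrite mulnC -sum_nat_const.
apply: (big_ind2 (fun (A : {set H}) m => (#|A| <= m)%N)); first by rewrite cards0.
  by move=> A a B b hA hB; apply: leq_trans (leq_card_setU _ _) (leq_add _ _).
by move=> z _; rewrite card_fiber.
Qed.

Lemma card_available D : (#|D| < L)%N -> (n - L <= #|half_edges_in M i :\: D|%SET.-1)%N.
Proof.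
move=> h; rewrite cardsD card_half_edges_in; have := subset_leq_card (finset.subsetIr (half_edges_in M i) D).
by move: h; clear; lia.
Qed.

Lemma touched_le D T w x : weight_on D w -> x \notin D -> (#|T| <= L)%N -> (#|D| < L)%N ->
  expect (fun eta => w eta *
    (eta x \in [set y in half_edges_in M i :\: D | touched T y]%SET)%:R) <= collision * expect w.
Proof.
move=> hw xD hT hD; set X := [set y in _ | _]%SET.
have XS : X \subset (half_edges_in M i :\: D)%SET.
  by apply/fintype.subsetP => y; rewrite inE => /andP[].
have h := partner_in_le hw xD XS; have w0 := weight_ge0 hw.
have e0 : 0 <= expect (fun eta => w eta * (eta x \in X)%:R).
  by apply: expect_ge0 => eta _; case: hw => h0 _ _; rewrite mulr_ge0.
rewrite /collision mulrAC ler_pdivlMr // mulrC.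
apply: le_trans (le_trans h _).
  by rewrite ler_wpM2r // ler_nat card_available.
rewrite ler_wpM2r // ler_nat; apply: leq_trans (leq_mul (leqnn _) hT).
apply: leq_trans (card_touched T); rewrite subset_leq_card //.
by apply/fintype.subsetP => y; rewrite !inE => /andP[_ ->].
Qed.

Lemma partner_outside D w x eta : weight_on D w -> x \notin D -> valid eta -> w eta != 0 ->
  eta x \notin D.
Proof.
move=> [_ _ hc] xD ve nz; have [eK _ _] := ve; apply: contra xD => h.
by rewrite -(eK x) hc.
Qed.

Definition fresh D T : {set H} := [set y in half_edges_in M i :\: D | ~~ touched T y]%SET.

Lemma stay_le D w x : weight_on D w -> x \in (half_edges_in M i :\: D)%SET -> (#|D| < L)%N ->
  expect (fun eta => w eta * (x \notin crossing eta)%:R) <= lambda * expect w.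
Proof.
move=> hw xD hD; have w0 := weight_ge0 hw.
have h := crossing_ge hw xD.
have e1 : expect (fun eta => w eta * (x \notin crossing eta)%:R) +
    expect (fun eta => w eta * (x \in crossing eta)%:R) = expect w.
  rewrite -expectD; apply: eq_expect => eta _; rewrite -mulrDr.
  by case: (x \in _); rewrite ?add0r ?addr0 mulr1.
set c := expect (fun eta => w eta * (x \in crossing eta)%:R) in h e1.
have c0 : 0 <= c by apply: expect_ge0 => eta _; case: hw => h0 _ _; rewrite mulr_ge0.
suff : rate * expect w <= c by rewrite /lambda; lra.
rewrite /rate; case: (lerP 0 ((p%:R - L%:R) / n%:R)) => hr; last by rewrite mul0r.
have pL : 0 <= (p%:R - L%:R : R) by move: hr; rewrite pmulr_lge0 // invr_gt0.
rewrite mulrAC ler_pdivrMr // mulrC.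
apply: (@le_trans _ _ (#|half_edges_in M i :\: D|%:R * c)); last first.
  by rewrite mulrC ler_wpM2l // ler_nat -card_half_edges_in subset_leq_card // finset.subsetDl.
apply: le_trans h; rewrite mulrC ler_wpM2r // lerD2l lerN2 ler_nat ltnW //.
Qed.

(** One step of the upper recursion: [A] vanishes on a crossing, is at most 1 on a collision, and is
    controlled by [b] when the partner is fresh. *)
Lemma reveal_le D T w A x (b : R) : weight_on D w -> x \in (half_edges_in M i :\: D)%SET ->
  (#|T| <= L)%N -> (#|D| < L)%N -> 0 <= b ->
  (forall eta, valid eta -> 0 <= A eta <= 1) ->
  (forall eta, valid eta -> x \in crossing eta -> A eta = 0) ->
  (forall y, y \in fresh D T ->
    expect (fun eta => w eta * (eta x == y)%:R * A eta) <= b * expect (fun eta => w eta * (eta x == y)%:R)) ->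
  expect (fun eta => w eta * A eta) <= (lambda * b + collision) * expect w.
Proof.
move=> hw xD hT hD b0 hA hc hb; have w0 := weight_ge0 hw.
have wp : forall eta, 0 <= w eta by case: hw.
have /andP[xD' xi] : (x \notin D) && (community (tag x) == i) by move: xD; rewrite !inE.
set X := [set y in half_edges_in M i :\: D | touched T y]%SET.
have h1 : expect (fun eta => w eta * A eta) <=
    expect (fun eta => w eta * (eta x \in X)%:R) +
    \sum_(y in fresh D T) expect (fun eta => w eta * (eta x == y)%:R * A eta).
  rewrite -expect_sum -expectD; apply: expect_le => eta ve.
  have s0 : 0 <= \sum_(y in fresh D T) w eta * (eta x == y)%:R * A eta.
    by apply: sumr_ge0 => y _; rewrite !mulr_ge0 //; case/andP: (hA _ ve).
  have [->|nz] := eqVneq (w eta) 0.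
    rewrite !mul0r add0r sumr_ge0 // => y _; rewrite !mul0r //.
  case: (boolP (x \in crossing eta)) => hx.
    have e0 : w eta * A eta = 0 by rewrite hc ?mulr0.
    by rewrite e0 addr_ge0 ?mulr_ge0.
  have yD : eta x \in (half_edges_in M i :\: D)%SET.
    rewrite !inE (partner_outside hw xD' ve nz) /=.
    by move: hx; rewrite inE negbK (eqP xi).
  case ht : (touched T (eta x)).
    rewrite (_ : eta x \in X); last by rewrite inE yD ht.
    rewrite mulr1 -[X in X <= _]addr0 lerD // ler_piMr //; by case/andP: (hA _ ve).
  have yG : eta x \in fresh D T by rewrite inE yD ht.
  rewrite (bigD1 (eta x)) //= eqxx mulr1 addrCA lerDl addr_ge0 ?mulr_ge0 //.
  by apply: sumr_ge0 => y _; rewrite !mulr_ge0 //; case/andP: (hA _ ve).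
apply: le_trans h1 _; rewrite mulrDl addrC; apply: lerD; last exact: touched_le.
apply: (@le_trans _ _ (\sum_(y in fresh D T) b * expect (fun eta => w eta * (eta x == y)%:R))).
  exact: ler_sum.
rewrite -mulr_sumr (expect_partner_sum _ _ hw) [lambda * b]mulrC -mulrA ler_wpM2l //.
apply: le_trans (stay_le hw xD hD); apply: expect_le => eta _.
rewrite ler_wpM2l // ler_nat; case: (boolP (eta x \in fresh D T)) => //.
by rewrite !inE (eqP xi) negbK => /andP[/andP[_ ->]].
Qed.

(** One step of the lower recursion: crossings and collisions are given up, at cost [theta]. *)
Lemma reveal_ge D T w A x (b : R) : weight_on D w -> x \in (half_edges_in M i :\: D)%SET ->
  (#|T| <= L)%N -> (#|D| < L)%N -> 0 <= b ->
  (forall eta, valid eta -> 0 <= A eta) ->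
  (forall y, y \in fresh D T ->
    b * expect (fun eta => w eta * (eta x == y)%:R) <= expect (fun eta => w eta * (eta x == y)%:R * A eta)) ->
  (1 - theta) * b * expect w <= expect (fun eta => w eta * A eta).
Proof.
move=> hw xD hT hD b0 hA hb; have w0 := weight_ge0 hw.
have wp : forall eta, 0 <= w eta by case: hw.
have /andP[xD' xi] : (x \notin D) && (community (tag x) == i) by move: xD; rewrite !inE.
set X := [set y in half_edges_in M i :\: D | touched T y]%SET.
have h1 : \sum_(y in fresh D T) expect (fun eta => w eta * (eta x == y)%:R * A eta) <=
    expect (fun eta => w eta * A eta).
  rewrite -expect_sum; apply: expect_le => eta ve.
  have -> : \sum_(y in fresh D T) w eta * (eta x == y)%:R * A eta =
      w eta * A eta * \sum_(y in fresh D T) (eta x == y)%:R.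
    by rewrite mulr_sumr; apply: eq_bigr => y _; ring.
  rewrite ler_piMr ?mulr_ge0 ?hA // big_mkcond (bigD1 (eta x)) //= eqxx big1 ?addr0.
    by case: ifP.
  by move=> y /negPf h; rewrite eq_sym h; case: ifP.
apply: le_trans (le_trans (ler_sum _ hb) h1).
rewrite -mulr_sumr (expect_partner_sum _ _ hw) [_ * b]mulrC -mulrA ler_wpM2l //.
have h2 : expect w <= expect (fun eta => w eta * (eta x \in fresh D T)%:R) +
    (expect (fun eta => w eta * (x \in crossing eta)%:R) + expect (fun eta => w eta * (eta x \in X)%:R)).
  rewrite -!expectD; apply: expect_le => eta ve.
  have [->|nz] := eqVneq (w eta) 0; first by rewrite !mul0r !addr0.
  rewrite -!mulrDr -[X in X <= _]mulr1 ler_wpM2l // -!natrD -[1]/(1%:R) ler_nat.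
  rewrite !inE (partner_outside hw xD' ve nz) (eqP xi) /=.
  by case: (_ == i); case: (touched _ _).
have h3 : expect (fun eta => w eta * (x \in crossing eta)%:R) <= p%:R / (n - L)%N%:R * expect w.
  rewrite mulrAC ler_pdivlMr // mulrC; apply: le_trans (crossing_le hw xD).
  apply: ler_wpM2r.
    by apply: expect_ge0 => eta _; rewrite mulr_ge0.
  by rewrite ler_nat (leq_trans (card_available hD)) // leq_pred.
have h4 : expect (fun eta => w eta * (eta x \in X)%:R) <= collision * expect w by apply: touched_le.
rewrite /theta; lra.
Qed.

Lemma next_state D T x y z : x \in D :|: T -> D \subset T -> y \in fresh D T -> x \in T ->
  neighbors z y -> z \in (half_edges_in M i :\: (x |: (y |: D)))%SET /\
  (forall x', x' \in T -> x' != y /\ x' != z).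
Proof.
move=> _ DT; rewrite !inE => /andP[/andP[yD /eqP yi] yt] xT /andP[zy /eqP zt].
have nt x' : x' \in T -> x' != y /\ x' != z.
  move=> x'T; split; apply: contraNneq yt => e; apply/exists_inP; exists x' => //;
  by rewrite e // zt.
split=> //; rewrite zt yi eqxx andbT (negPf zy) /=.
have [_ h] := nt _ xT; rewrite eq_sym (negPf h) /=.
by apply/negP => /(fintype.subsetP DT) zT; have [_] := nt _ zT; rewrite eqxx.
Qed.

Lemma card_next D x y : (#|(x |: (y |: D))%SET| <= #|D| + 2)%N.
Proof.
have h1 := leq_card_setU [set x]%SET (y |: D)%SET; have h2 := leq_card_setU [set y]%SET D.
rewrite !cards1 in h1 h2; apply: leq_trans h1 _.
by apply: leq_trans (leq_add (leqnn 1%N) h2) _; rewrite addn2.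
Qed.

Lemma sum_neighbors (y : H) (c : R) : \sum_(z | neighbors z y) c = c * (hdeg y)%:R.
Proof.
rewrite sumr_const -[LHS]mulr_natr; congr (_ * _%:R).
rewrite /hdeg -cardsE; apply: eq_card => z.
have e : neighbors z y = neighbors y z by rewrite /neighbors eq_sym; congr (_ && _); rewrite eq_sym.
by rewrite !inE -e.
Qed.

Lemma expect_survive t w x y F D T : y \in fresh D T -> community (tag x) = i ->
  expect (fun eta => w eta * (eta x == y)%:R * (survive t.+1 x eta * F eta)) =
  (\sum_(z | neighbors z y) expect (fun eta => w eta * (eta x == y)%:R * (survive t z eta * F eta)))
    / (hdeg y)%:R.
Proof.
move=> yf xi; rewrite mulrC -expect_sum -expectZ; apply: eq_expect => eta _.
case: eqP => [e|_]; last by rewrite !mulr0 !mul0r big1 ?mulr0 // => z _; rewrite mul0r.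
have nc : x \in crossing eta = false.
  by rewrite inE e xi; move: yf; rewrite !inE => /andP[/andP[_ ->]].
by rewrite surviveS nc e mulr1 -mulr_sumr -mulr_suml; ring.
Qed.

Lemma expect_survive_le t w x y F D T (b : R) : y \in fresh D T -> community (tag x) = i ->
  (forall z, neighbors z y -> expect (fun eta => w eta * (eta x == y)%:R * (survive t z eta * F eta)) <=
     b * expect (fun eta => w eta * (eta x == y)%:R)) ->
  expect (fun eta => w eta * (eta x == y)%:R * (survive t.+1 x eta * F eta)) <=
  b * expect (fun eta => w eta * (eta x == y)%:R).
Proof.
move=> yf xi h; have hd := hdeg_gt0 R degree_ge3 y.
rewrite (expect_survive _ _ _ yf xi) ler_pdivrMr //.
by apply: le_trans (ler_sum _ h) _; rewrite sum_neighbors.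
Qed.

Lemma expect_survive_ge t w x y D T (b : R) : y \in fresh D T -> community (tag x) = i ->
  (forall z, neighbors z y -> b * expect (fun eta => w eta * (eta x == y)%:R) <=
     expect (fun eta => w eta * (eta x == y)%:R * survive t z eta)) ->
  b * expect (fun eta => w eta * (eta x == y)%:R) <=
  expect (fun eta => w eta * (eta x == y)%:R * survive t.+1 x eta).
Proof.
move=> yf xi h; have hd := hdeg_gt0 R degree_ge3 y.
have -> : expect (fun eta => w eta * (eta x == y)%:R * survive t.+1 x eta) =
    expect (fun eta => w eta * (eta x == y)%:R * (survive t.+1 x eta * 1)).
  by apply: eq_expect => eta _; rewrite mulr1.
rewrite (expect_survive _ _ _ yf xi) ler_pdivlMr // -sum_neighbors.
apply: ler_sum => z zy; apply: le_trans (h _ zy) _.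
by apply: expect_le => eta _; rewrite mulr1.
Qed.

Lemma mem_in_community D x : x \in (half_edges_in M i :\: D)%SET -> community (tag x) = i.
Proof. by rewrite !inE => /andP[_ /eqP]. Qed.

Lemma survive_crossing t x eta : x \in crossing eta -> survive t.+1 x eta = 0.
Proof. by rewrite surviveS => ->. Qed.

Lemma fresh_next D T x y z : x \in T -> D \subset T -> y \in fresh D T ->
  neighbors z y -> z \in (half_edges_in M i :\: (x |: (y |: D)))%SET.
Proof.
move=> xT DT yf zy; have xDT : x \in D :|: T by rewrite inE xT orbT.
by have [] := next_state xDT DT yf xT zy.
Qed.

Lemma one_walk_le t D w x : weight_on D w -> x \in (half_edges_in M i :\: D)%SET ->
  (#|D| + 2 * t < L)%N ->
  expect (fun eta => w eta * survive t x eta) <= (lambda ^+ t + t%:R * collision) * expect w.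
Proof.
have /andP[l0 l1] := lambda01; have c0 := collision_ge0.
elim: t D w x => [|t IH] D w x hw xD hL.
  rewrite expr0 mul0r addr0 mul1r; apply: expect_le => eta _; by rewrite survive0 mulr1.
have w0 := weight_ge0 hw; have xi := mem_in_community xD.
pose T := (x |: D)%SET; set b := lambda ^+ t + t%:R * collision.
have b0 : 0 <= b by rewrite addr_ge0 ?mulr_ge0 // exprn_ge0.
apply: (@le_trans _ _ ((lambda * b + collision) * expect w)); last first.
  rewrite ler_wpM2r // /b exprS mulrDr -natr1 [(t%:R + 1) * _]mulrDl mul1r -addrA lerD2l lerD2r.
  by rewrite ler_piMl // mulr_ge0.
apply: (@reveal_le D T w (survive t.+1 x) x) => //.
- rewrite /T; apply: leq_trans (leq_card_setU _ _) _; rewrite cards1; move: hL; clear; lia.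
- by move: hL; clear; lia.
- by move=> eta _; apply: survive01.
- by move=> eta _; apply: survive_crossing.
move=> y yf.
have xT : x \in T by rewrite !inE eqxx.
have DT : D \subset T by apply: finset.subsetUr.
have -> : expect (fun eta => w eta * (eta x == y)%:R * survive t.+1 x eta) =
    expect (fun eta => w eta * (eta x == y)%:R * (survive t.+1 x eta * 1)).
  by apply: eq_expect => eta _; rewrite mulr1.
apply: (expect_survive_le yf xi) => z zy.
have -> : expect (fun eta => w eta * (eta x == y)%:R * (survive t z eta * 1)) =
    expect (fun eta => w eta * (eta x == y)%:R * survive t z eta).
  by apply: eq_expect => eta _; rewrite mulr1.
apply: (IH (x |: (y |: D))%SET (fun eta => w eta * (eta x == y)%:R)); [exact: weight_onS|exact: fresh_next xT DT yf zy|].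
by have := card_next D x y; move: hL; clear; lia.
Qed.

Lemma one_walk_ge t D w x : weight_on D w -> x \in (half_edges_in M i :\: D)%SET ->
  (#|D| + 2 * t < L)%N -> theta <= 1 ->
  (1 - theta) ^+ t * expect w <= expect (fun eta => w eta * survive t x eta).
Proof.
move=> + + + h1; elim: t D w x => [|t IH] D w x hw xD hL.
  by rewrite expr0 mul1r; apply: expect_le => eta _; rewrite survive0 mulr1.
have xi := mem_in_community xD; pose T := (x |: D)%SET.
have b0 : 0 <= (1 - theta) ^+ t by rewrite exprn_ge0 // subr_ge0.
rewrite exprS; apply: (@reveal_ge D T w (survive t.+1 x) x) => //.
- rewrite /T; apply: leq_trans (leq_card_setU _ _) _; rewrite cards1; move: hL; clear; lia.
- by move: hL; clear; lia.
- by move=> eta _; case/andP: (survive01 t.+1 x eta).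
move=> y yf; apply: (expect_survive_ge yf xi) => z zy.
have xT : x \in T by rewrite !inE eqxx.
have DT : D \subset T by apply: finset.subsetUr.
apply: (IH (x |: (y |: D))%SET (fun eta => w eta * (eta x == y)%:R)); [exact: weight_onS|exact: fresh_next xT DT yf zy|].
by have := card_next D x y; move: hL; clear; lia.
Qed.

(** The start of the second walk is put in [T], so the first walk avoids its vertex or pays a
    collision. When the first walk has ended, what it revealed is part of the weight under which the
    second one runs. *)
Lemma two_walks_le t s D w x x' : weight_on D w -> x \in (half_edges_in M i :\: D)%SET ->
  x' \in (half_edges_in M i :\: D)%SET -> x != x' -> (#|D| + 2 * (t + s) + 2 < L)%N ->
  expect (fun eta => w eta * (survive t x eta * survive s x' eta)) <=
    (lambda ^+ (t + s) + (t + s)%:R * collision) * expect w.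
Proof.
have /andP[l0 l1] := lambda01; have c0 := collision_ge0.
elim: t D w x => [|t IH] D w x hw xD x'D xx hL.
  rewrite add0n; apply: le_trans (one_walk_le hw x'D _); last by move: hL; clear; lia.
  by apply: expect_le => eta _; rewrite survive0 mul1r.
have w0 := weight_ge0 hw; have xi := mem_in_community xD.
pose T := (x' |: (x |: D))%SET; set b := lambda ^+ (t + s) + (t + s)%:R * collision.
have b0 : 0 <= b by rewrite addr_ge0 ?mulr_ge0 // exprn_ge0.
apply: (@le_trans _ _ ((lambda * b + collision) * expect w)); last first.
  rewrite ler_wpM2r // /b addSn exprS mulrDr -natr1 [((t + s)%:R + 1) * _]mulrDl mul1r -addrA lerD2l lerD2r.
  by rewrite ler_piMl // mulr_ge0.
apply: (@reveal_le D T w (fun eta => survive t.+1 x eta * survive s x' eta) x) => //.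
- rewrite /T; apply: leq_trans (leq_card_setU _ _) _; rewrite cards1.
  have [] := leq_card_setU [set x]%SET D; rewrite cards1.
  by move: hL; clear; lia.
- by move: hL; clear; lia.
- move=> eta _; have /andP[a1 a2] := survive01 t.+1 x eta.
  by have /andP[a3 a4] := survive01 s x' eta; rewrite mulr_ge0 //= mulr_ile1.
- by move=> eta _ h; rewrite survive_crossing // mul0r.
move=> y yf.
have xT : x \in T by rewrite !inE eqxx orbT.
have x'T : x' \in T by rewrite !inE eqxx.
have DT : D \subset T by rewrite finset.subsetU // finset.subsetUr orbT.
have xDT : x \in D :|: T by rewrite inE xT orbT.
apply: (expect_survive_le yf xi) => z zy.
have [_ /(_ _ x'T) [h1 h2]] := next_state xDT DT yf xT zy.
apply: (IH (x |: (y |: D))%SET (fun eta => w eta * (eta x == y)%:R)); [exact: weight_onS|exact: fresh_next xT DT yf zy| | by rewrite eq_sym|].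
  by move: x'D; rewrite !inE (negPf h1) [x' == x]eq_sym (negPf xx).
by have := card_next D x y; move: hL; clear; lia.
Qed.

(** The square of the probability in a fixed graph is the probability for two independent walks in
    that graph. At a fresh vertex they take different exits with probability at least 1/2; [Q]
    bounds them while together and [P] after separation. The expected time together is bounded,
    hence the excess over lambda^(2t) is only 2 [rate], up to collisions. *)
Lemma square_le t D w x : weight_on D w -> x \in (half_edges_in M i :\: D)%SET ->
  (#|D| + 4 * t + 2 < L)%N ->
  expect (fun eta => w eta * survive t x eta ^+ 2) <=
    (lambda ^+ (2 * t) + 2 * rate + 2 * t.+1%:R * collision) * expect w.
Proof.
have /andP[l0 l1] := lambda01; have c0 := collision_ge0.
have r0 : 0 <= rate by move: l1; rewrite /lambda; lra.
elim: t D w x => [|t IH] D w x hw xD hL.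
  apply: (@le_trans _ _ (1 * expect w)).
    by rewrite mul1r; apply: expect_le => eta _; rewrite survive0 expr1n mulr1.
  by rewrite ler_wpM2r ?(weight_ge0 hw) // muln0 expr0; lra.
have w0 := weight_ge0 hw; have xi := mem_in_community xD.
pose T := (x |: D)%SET.
pose P := lambda ^+ (t + t) + (t + t)%:R * collision.
pose Q := lambda ^+ (2 * t) + 2 * rate + 2 * t.+1%:R * collision.
have p0 : 0 <= lambda ^+ (t + t) by apply: exprn_ge0.
have P0 : 0 <= P by rewrite addr_ge0 ?mulr_ge0.
have t1 : t.+1%:R = t%:R + 1 :> R by rewrite -[t.+1]addn1 natrD.
have QE : Q = P + 2 * rate + 2 * collision.
  by rewrite /Q /P mul2n -addnn t1 natrD; ring.
have hPQ : P <= Q by rewrite QE; lra.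
apply: (@le_trans _ _ ((lambda * ((Q + P) / 2) + collision) * expect w)); last first.
  rewrite ler_wpM2r // QE /P.
  have -> : lambda ^+ (2 * t.+1) = lambda ^+ 2 * lambda ^+ (t + t).
    by rewrite -exprD; congr (_ ^+ _); clear; lia.
  rewrite natrD -[t.+2]addn2 natrD.
  have h1 : lambda * lambda ^+ (t + t) - lambda ^+ 2 * lambda ^+ (t + t) <= rate.
    have -> : lambda * lambda ^+ (t + t) - lambda ^+ 2 * lambda ^+ (t + t) =
      rate * (lambda * lambda ^+ (t + t)) by rewrite {1 2 3 4 5}/lambda; ring.
    by rewrite ler_piMr // mulr_ile1 // exprn_ile1.
  have h2 : lambda * rate <= rate by rewrite ler_piMl.
  have h3 : lambda * (2 * t%:R * collision) <= 2 * t%:R * collision.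
    by rewrite ler_piMl // !mulr_ge0.
  have h4 : lambda * collision <= collision by rewrite ler_piMl.
  nra.
apply: (@reveal_le D T w (fun eta => survive t.+1 x eta ^+ 2) x) => //.
- rewrite /T; apply: leq_trans (leq_card_setU _ _) _; rewrite cards1; move: hL; clear; lia.
- by move: hL; clear; lia.
- by rewrite divr_ge0 // addr_ge0 // (le_trans P0).
- move=> eta _; have /andP[a1 a2] := survive01 t.+1 x eta.
  by rewrite exprn_ge0 //= exprn_ile1.
- by move=> eta _ h; rewrite survive_crossing // expr0n.
move=> y yf; set W := expect (fun eta => w eta * (eta x == y)%:R).
have hw' := weight_onS x y hw.
have W0 : 0 <= W := weight_ge0 hw'.
have xT : x \in T by rewrite !inE eqxx.
have DT : D \subset T by apply: finset.subsetUr.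
have hd := hdeg_gt0 R degree_ge3 y.
have hd2 : 2 <= (hdeg y)%:R :> R by rewrite -[2]/(2%:R) ler_nat; apply: hdeg_ge2.
rewrite (expect_survive _ _ _ yf xi) ler_pdivrMr //.
rewrite -[X in _ <= X]sum_neighbors; apply: ler_sum => z zy.
have -> : expect (fun eta => w eta * (eta x == y)%:R * (survive t z eta * survive t.+1 x eta)) =
   expect (fun eta => w eta * (eta x == y)%:R * (survive t.+1 x eta * survive t z eta)).
  by apply: eq_expect => eta _; rewrite [survive t z eta * _]mulrC.
rewrite (expect_survive _ _ _ yf xi) ler_pdivrMr //.
have hz := fresh_next xT DT yf zy; have hD := card_next D x y.
rewrite (bigD1 z) //=.
have q1 : expect (fun eta => w eta * (eta x == y)%:R * (survive t z eta * survive t z eta)) <= Q * W.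
  by apply: IH hw' hz _; move: hL hD; clear; lia.
have q2 : \sum_(z' | neighbors z' y && (z' != z))
    expect (fun eta => w eta * (eta x == y)%:R * (survive t z' eta * survive t z eta)) <=
    ((hdeg y)%:R - 1) * (P * W).
  have -> : ((hdeg y)%:R - 1) * (P * W) = \sum_(z' | neighbors z' y && (z' != z)) (P * W).
    have := sum_neighbors y (P * W); rewrite (bigD1 z) //= => e.
    by apply: (@addrI _ (P * W)); rewrite e; ring.
  apply: ler_sum => z' /andP[z'y zz].
  apply: two_walks_le hw' (fresh_next xT DT yf z'y) hz zz _.
  by move: hL hD; clear; lia.
apply: le_trans (lerD q1 q2) _.
(* The two exits coincide with probability 1/hdeg <= 1/2, so the mean of [Q] and [P] dominates. *)
rewrite -subr_ge0; have -> : (Q + P) / 2 * W * (hdeg y)%:R - (Q * W + ((hdeg y)%:R - 1) * (P * W)) =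
  ((hdeg y)%:R - 2) * ((Q - P) / 2 * W) by field.
by rewrite mulr_ge0 ?subr_ge0 // mulr_ge0 // divr_ge0 // subr_ge0.
Qed.

Lemma rate_le_theta : rate <= theta.
Proof.
have c0 := collision_ge0; rewrite /rate ge_max; apply/andP; split.
  by rewrite addr_ge0 // divr_ge0.
apply: (@le_trans _ _ (p%:R / (n - L)%N%:R)); last by rewrite lerDl.
apply: (@le_trans _ _ (p%:R / n%:R)).
  by rewrite ler_wpM2r ?invr_ge0 // lerBlDr lerDl.
by rewrite ler_wpM2l // lef_pV2 ?posrE // ler_nat leq_subr.
Qed.

(* Second moment method: two walks from [x] decouple once they separate. *)
Lemma crossed_variance t x : community (tag x) = i -> (4 * t + 2 < L)%N -> theta <= 1 ->
  expect (fun eta => (crossed R eta t x - (1 - lambda ^+ t)) ^+ 2) <=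
    2 * rate + 2 * t.+1%:R * collision + 2 * (lambda ^+ t - (1 - theta) ^+ t).
Proof.
move=> xi hL h1; have hw := weight_on0 R M.
have xD : x \in (half_edges_in M i :\: finset.set0)%SET by rewrite !inE xi eqxx.
have /andP[l0 l1] := lambda01.
have s1 := square_le (t := t) hw xD; rewrite cards0 add0n expect_cst mulr1 in s1.
have s2 := one_walk_ge (t := t) hw xD; rewrite cards0 add0n expect_cst mulr1 in s2.
have {}s1 := s1 hL; have {}s2 : (1 - theta) ^+ t <= expect (fun eta => 1 * survive t x eta).
  by apply: s2 => //; move: hL; clear; lia.
have -> : expect (fun eta => (crossed R eta t x - (1 - lambda ^+ t)) ^+ 2) =
   expect (fun eta => 1 * survive t x eta ^+ 2) +
   (- (2 * lambda ^+ t) * expect (fun eta => 1 * survive t x eta) + (lambda ^+ t) ^+ 2).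
  rewrite -[(lambda ^+ t) ^+ 2](@expect_cst R M) -expectZ -!expectD; apply: eq_expect => eta _.
  rewrite /survive; ring.
rewrite -exprM [(t * 2)%N]mulnC.
have lt0 : 0 <= lambda ^+ t by apply: exprn_ge0.
have lt1 : lambda ^+ t <= 1 by apply: exprn_ile1.
have s3 : 2 * lambda ^+ t * (1 - theta) ^+ t <= 2 * lambda ^+ t * expect (fun eta => 1 * survive t x eta).
  by rewrite ler_wpM2l // mulr_ge0.
have s4 : lambda ^+ t * (lambda ^+ t - (1 - theta) ^+ t) <= lambda ^+ t - (1 - theta) ^+ t.
  rewrite ler_piMl // subr_ge0.
  have h := rate_le_theta.
  by apply: lerXn2r; rewrite ?nnegrE ?subr_ge0 // /lambda; lra.
have e2 : lambda ^+ (2 * t) = lambda ^+ t * lambda ^+ t by rewrite -exprD addnn -mul2n.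
rewrite e2 in s1 *; nra.
Qed.

End AnnealedWalk.

(** * Concentration of the crossing probability and rarity of second crossings *)

Section Tails.
Variables (R : realType) (M : two_community).
Hypothesis degree_ge3 : forall v : vertex M, (3 <= degree v)%N.
Local Notation H := (half_edge M).
Local Notation expect := (@expect R M).
Local Notation p := (noutgoing M).

Lemma card_crossing_valid (eta : {perm H}) : valid eta -> #|crossing eta| = (2 * p)%N.
Proof.
move=> [_ _ hc]; rewrite -(cardsID (half_edges_in M false)) hc mul2n -addnn; congr (_ + _)%N.
rewrite -(hc true); apply: eq_card => x; rewrite !inE andbC; congr (_ && _).
by case: (community _).
Qed.

Lemma prob_le (E F : pred {perm H}) : (forall eta, valid eta -> E eta -> F eta) ->
  prob R E <= prob R F.
Proof.
move=> h; rewrite !probE; apply: expect_le => eta ve; rewrite ler_nat.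
by case e: (E eta) => //; rewrite h.
Qed.

Lemma prob_ge0 (E : pred {perm H}) : 0 <= prob R E.
Proof. by rewrite probE; apply: expect_ge0. Qed.

Lemma prob_or (E F : pred {perm H}) : prob R (fun eta => E eta || F eta) <= prob R E + prob R F.
Proof.
rewrite !probE -expectD; apply: expect_le => eta _; rewrite -natrD ler_nat.
by case: (E eta); case: (F eta).
Qed.

Lemma markov_prob (F : {perm H} -> R) (c : R) : 0 < c -> (forall eta, valid eta -> 0 <= F eta) ->
  prob R (fun eta => c <= F eta) <= expect F / c.
Proof.
move=> c0 F0; rewrite ler_pdivlMr // probE mulrC -expectZ; apply: expect_le => eta ve.
by case: (boolP (c <= F eta)) => h; rewrite ?mulr1 // mulr0 F0.
Qed.

Lemma expr_sub_le (a b : R) t : 0 <= b -> b <= a -> a <= 1 -> a ^+ t - b ^+ t <= t%:R * (a - b).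
Proof.
move=> b0 ba a1; elim: t => [|t IH]; first by rewrite !expr0 subrr mul0r.
have -> : a ^+ t.+1 - b ^+ t.+1 = a * (a ^+ t - b ^+ t) + (a - b) * b ^+ t by rewrite !exprS; ring.
have -> : t.+1%:R * (a - b) = t%:R * (a - b) + (a - b) by rewrite -natr1 mulrDl mul1r.
apply: lerD.
  apply: le_trans IH; rewrite ler_piMl // subr_ge0.
  by apply: lerXn2r => //; rewrite nnegrE // (le_trans b0).
rewrite ler_piMr ?subr_ge0 // exprn_ile1 //; exact: le_trans ba a1.
Qed.

Lemma rate_le_alpha i L : (0 < nhalf_in M i)%N -> rate R M i L <= alpha_in R M i.
Proof.
move=> n0; rewrite /rate ge_max divr_ge0 //= ler_wpM2r ?invr_ge0 //.
by rewrite lerBlDr lerDl.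
Qed.

Lemma collision_bound i L Delta : (2 * L < nhalf_in M i)%N ->
  collision R M i L Delta <= 2 * (Delta * L)%N%:R / (nhalf_in M i)%:R.
Proof.
move=> h; have n0 : 0 < (nhalf_in M i)%:R :> R by rewrite ltr0n; move: h; clear; lia.
have m0 : 0 < (nhalf_in M i - L)%N%:R :> R by rewrite ltr0n; move: h; clear; lia.
rewrite /collision ler_pdivrMr // mulrAC ler_pdivlMr // [2 * _]mulrC -mulrA.
rewrite ler_wpM2l // -[2]/(2%:R) -natrM ler_nat; move: h; clear; lia.
Qed.

Lemma theta_bound i L Delta : (2 * L < nhalf_in M i)%N ->
  theta R M i L Delta <= 2 * alpha_in R M i + 2 * (Delta * L)%N%:R / (nhalf_in M i)%:R.
Proof.
move=> h; rewrite /theta; apply: lerD; last exact: collision_bound.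
have n0 : 0 < (nhalf_in M i)%:R :> R by rewrite ltr0n; move: h; clear; lia.
have m0 : 0 < (nhalf_in M i - L)%N%:R :> R by rewrite ltr0n; move: h; clear; lia.
rewrite /alpha_in ler_pdivrMr // mulrA mulrAC ler_pdivlMr // [2 * _]mulrC -mulrA.
rewrite ler_wpM2l // -[2]/(2%:R) -natrM ler_nat; move: h; clear; lia.
Qed.

Lemma theta_sub_rate i L Delta : (2 * L < nhalf_in M i)%N ->
  theta R M i L Delta - rate R M i L <= (2 * Delta + 3)%N%:R * L%:R / (nhalf_in M i)%:R.
Proof.
move=> h.
have n0 : 0 < (nhalf_in M i)%:R :> R by rewrite ltr0n; move: h; clear; lia.
have m0 : 0 < (nhalf_in M i - L)%N%:R :> R by rewrite ltr0n; move: h; clear; lia.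
have hc := collision_bound Delta h.
have hr : (p%:R - L%:R) / (nhalf_in M i)%:R <= rate R M i L by rewrite /rate le_max lexx orbT.
have h1 : p%:R / (nhalf_in M i - L)%N%:R - p%:R / (nhalf_in M i)%:R <= 2 * L%:R / (nhalf_in M i)%:R :> R.
  rewrite [leLHS](_ : _ = p%:R * L%:R / ((nhalf_in M i)%:R * (nhalf_in M i - L)%N%:R)); last first.
    rewrite natrB; last by move: h; clear; lia.
    have g : (nhalf_in M i)%:R - L%:R != 0 :> R.
      by rewrite -natrB ?gt_eqF //; move: h; clear; lia.
    by field; rewrite g gt_eqF.
  rewrite invfM mulrA mulrAC ler_wpM2r ?invr_ge0 //.
  rewrite ler_pdivrMr // -[2]/(2%:R) -!natrM ler_nat.
  apply: (@leq_trans (nhalf_in M i * L)); first by rewrite leq_mul2r noutgoing_le orbT.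
  by move: h; clear; nia.
have hg : (2 * Delta + 3)%N%:R * L%:R / (nhalf_in M i)%:R = 2 * (Delta * L)%N%:R / (nhalf_in M i)%:R +
    (2 * L%:R / (nhalf_in M i)%:R + L%:R / (nhalf_in M i)%:R) :> R.
  by rewrite natrD !natrM; field; rewrite gt_eqF.
rewrite hg /theta; move: hr hc h1; rewrite mulrBl; lra.
Qed.

(** Chebyshev's inequality around 1 - lambda^t, which is at most t alpha_i. The value 4t + 3 of [L]
    is the least one that [crossed_variance] allows. *)
Lemma crossed_whp i x t Delta (delta : R) : (forall v : vertex M, (degree v <= Delta)%N) ->
  community (tag x) = i -> (2 * (4 * t + 3) < nhalf_in M i)%N -> 0 < delta ->
  2 * alpha_in R M i + 2 * (Delta * (4 * t + 3))%N%:R / (nhalf_in M i)%:R <= 1 ->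
  prob R (fun eta : {perm H} => t%:R * alpha_in R M i + delta <= crossed R eta t x) <=
    (2 * alpha_in R M i + (8 * Delta + 6)%N%:R * (4 * t.+1 ^ 2)%N%:R / (nhalf_in M i)%:R) / delta ^+ 2.
Proof.
move=> hD xi hL d0 h1; set L := (4 * t + 3)%N in hL h1.
set n := nhalf_in M i in hL h1 *.
have Ln : (L < n)%N by move: hL; clear; lia.
have n0 : (0 < n)%N by move: Ln; clear; lia.
have n0' : 0 < n%:R :> R by rewrite ltr0n.
have t1 : theta R M i L Delta <= 1 by apply: le_trans (theta_bound Delta hL) h1.
have hv := crossed_variance degree_ge3 hD Ln xi (t := t) _ t1.
have {}hv := hv ltac:(rewrite /L; clear; lia).
have /andP[l0 l1] := lambda01 R Ln.
have hra := rate_le_alpha L n0.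
have hl : 1 - lambda R M i L ^+ t <= t%:R * alpha_in R M i.
  have := @expr_sub_le 1 (lambda R M i L) t l0 l1 (lexx _); rewrite expr1n => h.
  apply: le_trans h _; rewrite ler_wpM2l // /lambda; lra.
apply: (@le_trans _ _ (prob R (fun eta : {perm H} => delta ^+ 2 <= (crossed R eta t x - (1 - lambda R M i L ^+ t)) ^+ 2))).
  apply: prob_le => eta _ h; rewrite lerXn2r ?nnegrE ?(ltW d0) //; lra.
apply: le_trans (markov_prob _ _) _; first by rewrite exprn_gt0.
  by move=> eta _; apply: sqr_ge0.
rewrite ler_wpM2r ?invr_ge0 ?sqr_ge0 //; apply: le_trans hv _.
rewrite -addrA; apply: lerD; first by rewrite ler_wpM2l.
have hrt := rate_le_theta R Delta Ln.
have h2 : lambda R M i L ^+ t - (1 - theta R M i L Delta) ^+ t <=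
    t%:R * ((2 * Delta + 3)%N%:R * L%:R / n%:R).
  apply: le_trans (expr_sub_le t _ _ l1) _; rewrite ?subr_ge0 //; first by rewrite /lambda lerD2l lerN2.
  rewrite ler_wpM2l //; apply: le_trans (theta_sub_rate Delta hL); rewrite /lambda; lra.
have h3 : t.+1%:R * collision R M i L Delta <= t.+1%:R * (2 * (Delta * L)%N%:R / n%:R).
  by rewrite ler_wpM2l // collision_bound.
apply: (@le_trans _ _ (2 * (t.+1%:R * (2 * (Delta * L)%N%:R / n%:R)) + 2 * (t%:R * ((2 * Delta + 3)%N%:R * L%:R / n%:R)))).
  move: h2 h3; rewrite -mulrA; lra.
rewrite -[2]/(2%:R) !mulrA -!natrM -mulrDl -natrD ler_wpM2r ?invr_ge0 // ler_nat.
by rewrite /L; clear; nia.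
Qed.

(** After a sum over the crossing half-edge and its partner, the walk restarts next to the partner
    with a single edge revealed, and [one_walk_ge] bounds its crossing probability by J [Th]. *)
Lemma crossing_twice_le J L Delta (Th : R) : (forall v : vertex M, (degree v <= Delta)%N) ->
  (forall i, (L < nhalf_in M i)%N) -> (forall i, theta R M i L Delta <= Th) -> Th <= 1 ->
  (2 + 2 * J < L)%N ->
  expect (fun eta : {perm H} => \sum_(x in crossing eta) step eta (crossed R eta J) x) <= (2 * p)%:R * (J%:R * Th).
Proof.
move=> hD Ln hT T1 hJ.
have th0 : 0 <= Th.
  apply: le_trans (hT false); apply: le_trans (rate_le_theta R Delta (Ln false)).
  by rewrite /rate le_max lexx.
have far_sum (eta : {perm H}) (f : H -> R) : \sum_(x in crossing eta) f (eta x) =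
    \sum_x \sum_(y | community (tag y) != community (tag x)) (eta x == y)%:R * f y.
  rewrite big_mkcond; apply: eq_bigr => x _; rewrite inE; case: ifP => h.
    rewrite (bigD1 (eta x)) //= eqxx mul1r big1 ?addr0 // => y /andP[_ /negPf e].
    by rewrite eq_sym e mul0r.
  rewrite big1 // => y hy; case: eqP => [e|_]; last by rewrite mul0r.
  by move: hy; rewrite -e h.
have -> : (2 * p)%:R * (J%:R * Th) = \sum_x \sum_(y | community (tag y) != community (tag x))
    (J%:R * Th) * expect (fun eta : {perm H} => 1 * (eta x == y)%:R).
  rewrite -(@expect_cst R M (2 * p)%:R) mulrC -expectZ.
  have -> : expect (fun=> J%:R * Th * (2 * p)%:R) =
     expect (fun eta => J%:R * Th * \sum_(x in crossing eta) 1).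
    apply: eq_expect => eta ve; rewrite sumr_const (card_crossing_valid ve) //.
  rewrite expectZ.
  rewrite (@eq_expect _ _ _ (fun eta => \sum_x \sum_(y | community (tag y) != community (tag x)) (eta x == y)%:R * 1)).
    rewrite expect_sum mulr_sumr; apply: eq_bigr => x _.
    rewrite expect_sum mulr_sumr; apply: eq_bigr => y _; congr (_ * _).
    by apply: eq_expect => eta _; rewrite mulrC.
  by move=> eta _; rewrite -(far_sum eta (fun=> 1)).
rewrite (@eq_expect _ _ _ (fun eta => \sum_x \sum_(y | community (tag y) != community (tag x))
    (eta x == y)%:R * kern (crossed R eta J) y)); last first.
  by move=> eta _; rewrite -far_sum; apply: eq_bigr => x _; rewrite stepE.
rewrite expect_sum; apply: ler_sum => x _; rewrite expect_sum; apply: ler_sum => y yx.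
have hd := hdeg_gt0 R degree_ge3 y.
have -> : expect (fun eta : {perm H} => (eta x == y)%:R * kern (crossed R eta J) y) =
   (\sum_(z | neighbors z y) expect (fun eta => 1 * (eta x == y)%:R * crossed R eta J z)) / (hdeg y)%:R.
  rewrite -expect_sum mulrC -expectZ; apply: eq_expect => eta _.
  by rewrite -mulr_sumr /kern mul1r; ring.
rewrite ler_pdivrMr // -sum_neighbors; apply: ler_sum => z zy.
set i := community (tag y) in yx *; set W := expect (fun eta : {perm H} => 1 * (eta x == y)%:R).
have hw : @weight_on R M (x |: (y |: finset.set0))%SET (fun eta => 1 * (eta x == y)%:R).
  exact: (@weight_onS R M finset.set0 (fun=> 1) x y (weight_on0 R M)).
have W0 : 0 <= W := weight_ge0 hw.
have zD : z \in (half_edges_in M i :\: (x |: (y |: finset.set0)))%SET.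
  move: zy => /andP[zy /eqP zt]; rewrite !inE zt eqxx andbT orbF (negPf zy) orbF.
  by apply: contraNneq yx => e; rewrite -e zt.
have cD : (#|x |: (y |: finset.set0)|%SET + 2 * J < L)%N.
  apply: leq_ltn_trans hJ; rewrite leq_add2r.
  by apply: leq_trans (card_next _ _ _) _; rewrite cards0.
have h : (1 - theta R M i L Delta) ^+ J * W <= expect (fun eta : {perm H} => 1 * (eta x == y)%:R * survive R J z eta).
  exact: one_walk_ge hw zD cD (le_trans (hT i) T1).
have e : expect (fun eta => 1 * (eta x == y)%:R * crossed R eta J z) =
    W - expect (fun eta => 1 * (eta x == y)%:R * survive R J z eta).
  rewrite -[X in _ - X]mul1r -mulNr -expectZ -expectD; apply: eq_expect => eta _.
  by rewrite /survive; ring.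
have t0 : 0 <= 1 - theta R M i L Delta by rewrite subr_ge0 (le_trans (hT i)).
have th1 : 0 <= theta R M i L Delta.
  by apply: le_trans (rate_le_theta R Delta (Ln i)); rewrite /rate le_max lexx.
have h2 := @expr_sub_le 1 (1 - theta R M i L Delta) J t0 ltac:(lra) (lexx _).
rewrite expr1n in h2.
rewrite e; apply: (@le_trans _ _ (J%:R * theta R M i L Delta * W)).
  apply: (@le_trans _ _ ((1 - (1 - theta R M i L Delta) ^+ J) * W)).
    by rewrite mulrBl mul1r lerD2l lerN2.
  rewrite ler_wpM2r //; apply: le_trans h2 _; rewrite ler_wpM2l //; lra.
by rewrite ler_wpM2r // ler_wpM2l.
Qed.

End Tails.

(** * Crossing times and distance in a fixed graph *)

Section CrossingTimes.
Variables (R : realType) (M : two_community) (eta : {perm half_edge M}).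
Hypothesis degree_ge3 : forall v : vertex M, (3 <= degree v)%N.
Local Notation H := (half_edge M).
Local Notation N := ((nhalf M)%:R : R).
Local Notation P t := (nbrw_iter R eta t).
Local Notation crossed := (crossed R eta).
Local Notation onC := (fun y : H => (y \in crossing eta)%:R : R).

Lemma crossed_growth t x : crossed t.+1 x <= crossed t x + stepn eta t onC x.
Proof.
elim: t x => [|t IH] x; last rewrite -[crossed t.+2 x]/(if x \in crossing eta then 1 else step eta (crossed t.+1) x).
  by rewrite /= add0r; case: ifP => // _; rewrite step_cst.
have s0 : 0 <= stepn eta t.+1 onC x by apply: stepn_ge0.
case: ifP => h; first by rewrite /= h lerDl.
by rewrite [crossed t.+1 x]/= h -[stepn eta t.+1 onC x]/(step eta (stepn eta t onC) x) -stepD ler_step.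
Qed.

Lemma crossed_mono s t x : (s <= t)%N -> crossed s x <= crossed t x.
Proof.
have h u : forall x, crossed u x <= crossed u.+1 x.
  elim: u => [|u IH] y; first by case/andP: (crossed01 R eta degree_ge3 1 y).
  by rewrite /=; case: ifP => // _; apply: ler_step.
move/subnK <-; elim: (t - s)%N => // d IH; rewrite addSn; exact: le_trans IH (h _ _).
Qed.

(** A union bound over the times after [s]: flatness makes each of them cost at most b [omega]. *)
Lemma crossed_late s j x (b : R) :
  (forall u y, (s <= u)%N -> P u x y <= b / N) -> (#|crossing eta| = 2 * noutgoing M)%N ->
  crossed (s + j) x <= crossed s x + j%:R * (b * omega R M).
Proof.
move=> hb hc; elim: j => [|j IH]; first by rewrite addn0 mul0r addr0.
rewrite addnS; apply: le_trans (crossed_growth _ _) _.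
rewrite -natr1 [(j%:R + 1) * _]mulrDl mul1r addrA; apply: lerD => //.
rewrite stepn_nbrw_iter; apply: (@le_trans _ _ (\sum_y b / N * onC y)).
  by apply: ler_sum => y _; rewrite ler_wpM2r // hb // leq_addr.
by rewrite -mulr_sumr sum_crossing // /omega le_eqVlt; apply/orP; left; apply/eqP; ring.
Qed.

Lemma other_side_le i t x : community (tag x) = i ->
  \sum_(y in half_edges_in M (~~ i)) P t x y <= crossed t x.
Proof.
move=> xi; pose f (y : H) : R := (community (tag y) == ~~ i)%:R.
have fv : vconst f by move=> y z e; rewrite /f e.
have sf y : step eta f y = f (eta y).
  by rewrite stepE kernE // (avg_id fv) subrr mulr0 subr0.
have h s y : stepn eta s f y <= f y + crossed s y.
  elim: s y => [|s IH] y; first by rewrite /= addr0.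
  rewrite /=; case: ifP => hy.
    apply: (@le_trans _ _ 1); last by rewrite lerDr.
    rewrite -[leRHS](stepn_cst eta degree_ge3 s.+1 1 y) -/(stepn eta s.+1 f y).
    by apply: (@ler_stepn R M eta s.+1 f (fun=> 1)) => z; rewrite /f; case: (_ == _).
  apply: le_trans (ler_step eta _ IH) _; rewrite stepD sf lerD2r /f.
  by move: hy; rewrite inE => /negbFE /eqP ->.
have := h t x; rewrite stepn_nbrw_iter {2}/f xi.
rewrite (_ : (i == ~~ i) = false) ?add0r; last by case: (i).
apply: le_trans; rewrite big_mkcond le_eqVlt; apply/orP; left; apply/eqP.
by apply: eq_bigr => y _; rewrite half_edges_inE /f; case: (_ == _); rewrite ?mulr1 ?mulr0.
Qed.

Lemma dist_from_ge i t x : community (tag x) = i ->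
  (nhalf_in M (~~ i))%:R / N - crossed t x <= dist_from R eta x t.
Proof.
move=> xi; apply: (@le_trans _ _ (\sum_(y in half_edges_in M (~~ i)) (N^-1 - P t x y))).
  rewrite sumrB sumr_const card_half_edges_in -[N^-1 *+ _]mulr_natl.
  by rewrite lerD2l lerN2 other_side_le.
rewrite /dist_from [leRHS](bigID (fun y => y \in half_edges_in M (~~ i))) /=.
rewrite -[leLHS]addr0; apply: lerD.
  by apply: ler_sum => y _; rewrite le_max lexx orbT.
by apply: sumr_ge0 => y _; rewrite le_max lexx.
Qed.

(** The first step is conditioned upon and the positive part is convex. *)
Lemma dist_step t : dist R eta t.+1 <= dist R eta t.
Proof.
apply/bigmax_leP; split=> [|x _]; first exact: dist_ge0.
have nb0 z : 0 <= nbrw R eta x z := nbrw_ge0 R eta x z.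
have nb1 : \sum_z nbrw R eta x z = 1.
  rewrite -(sum_nbrw_iter R eta degree_ge3 1 x); apply: eq_bigr => z _ /=.
  rewrite (bigD1 z) //= eqxx mulr1 big1 ?addr0 // => y /negPf ->; exact: mulr0.
apply: (@le_trans _ _ (\sum_y \sum_z nbrw R eta x z * Num.max 0 (N^-1 - P t z y))).
  apply: ler_sum => y _; rewrite ge_max; apply/andP; split.
    by apply: sumr_ge0 => z _; rewrite mulr_ge0 // le_max lexx.
  have -> : N^-1 - P t.+1 x y = \sum_z nbrw R eta x z * (N^-1 - P t z y).
    under eq_bigr do rewrite mulrBr.
    by rewrite sumrB -mulr_suml nb1 mul1r.
  by apply: ler_sum => z _; rewrite ler_wpM2l // le_max lexx orbT.
have -> : dist R eta t = \sum_z nbrw R eta x z * dist R eta t by rewrite -mulr_suml nb1 mul1r.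
rewrite exchange_big /=; apply: ler_sum => z _.
rewrite -mulr_sumr ler_wpM2l //.
rewrite -/(dist_from R eta z t); exact: (@le_bigmax _ _ _ 0 (fun x => dist_from R eta x t)).
Qed.

Lemma dist_mono s t : (s <= t)%N -> dist R eta t <= dist R eta s.
Proof.
by move/subnK <-; elim: (t - s)%N => // d IH; rewrite addSn; apply: le_trans (dist_step _) IH.
Qed.

Lemma dist0_ge : 1 - N^-1 <= dist R eta 0.
Proof.
have [v _] := community_nonempty M true.
have d0 : (0 < degree v)%N by apply: leq_trans (degree_ge3 v).
pose x : H := Tagged (fun v => 'I_(degree v)) (Ordinal d0).
apply: (@le_trans _ _ (dist_from R eta x 0)); last first.
  exact: (@le_bigmax _ _ _ 0 (fun x => dist_from R eta x 0)).
have -> : 1 - N^-1 = \sum_(y | y != x) N^-1.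
  have e : \sum_(y : H) N^-1 = 1.
    rewrite sumr_const card_half_edge -[LHS]mulr_natl divff // pnatr_eq0 -lt0n -card_half_edge.
    by apply/card_gt0P; exists x.
  by rewrite (bigD1 x) //= in e; move: e; lra.
rewrite /dist_from [leRHS](bigD1 x) //= -[leLHS]add0r; apply: lerD.
  by rewrite le_max lexx.
apply: ler_sum => y yx; have e : (x == y) = false by rewrite eq_sym (negPf yx).
by rewrite /= e subr0 le_max lexx orbT.
Qed.

End CrossingTimes.

(** * Quantitative form of the asymptotic regime *)

Section Regime.
Variable R : realType.
Implicit Types (M : two_community) (rho phi C : R).

Local Notation lnN M := (ln ((nhalf M)%:R : R)).

(** Thresholds on one graph take the place of large [n]: constants can then be chosen before any
    sequence is given, as the uniformity in the theorem demands. [C] bounds alpha ln N. *)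
Definition regime rho Delta C (a1 Y1 : R) M :=
  [/\ forall v : vertex M, (3 <= degree v <= Delta)%N,
      forall i, rho * (nhalf M)%:R <= (nhalf_in M i)%:R,
      alpha R M <= a1, Y1 <= lnN M & alpha R M * lnN M <= C].

Lemma regime_weaken rho Delta C a1 a2 Y1 Y2 M : a2 <= a1 -> Y1 <= Y2 ->
  regime rho Delta C a2 Y2 M -> regime rho Delta C a1 Y1 M.
Proof. by move=> ha hY [h1 h2 h3 h4 h5]; split=> //; [apply: le_trans ha|apply: le_trans h4]. Qed.

Lemma alpha_in_gt0 M i : (forall v : vertex M, (3 <= degree v)%N) -> 0 < alpha_in R M i.
Proof.
move=> hd; rewrite divr_gt0 // ltr0n ?nhalf_in_gt0 //.
exact: leq_trans (noutgoing_ge2 M).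
Qed.

Lemma alpha_in_le M i : alpha_in R M i <= alpha R M.
Proof. by case: i; rewrite /alpha ?lerDr ?lerDl divr_ge0. Qed.

Lemma alpha_gt0 M : (forall v : vertex M, (3 <= degree v)%N) -> 0 < alpha R M.
Proof. by move=> hd; rewrite addr_gt0 // alpha_in_gt0. Qed.

Lemma omega_le_alpha M : (forall v : vertex M, (3 <= degree v)%N) -> omega R M <= alpha R M.
Proof.
move=> hd; have n0 i : 0 < (nhalf_in M i)%:R :> R by rewrite ltr0n nhalf_in_gt0.
rewrite /omega /alpha /alpha_in nhalfE -mulrA mulr_natl mulr2n.
by apply: lerD; rewrite ler_wpM2l // lef_pV2 ?posrE ?addr_gt0 // ?lerDl ?lerDr ltW.
Qed.

Lemma alpha_le_omega M rho : 0 < rho -> (forall v : vertex M, (3 <= degree v)%N) ->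
  (forall i, rho * (nhalf M)%:R <= (nhalf_in M i)%:R) -> rho * alpha R M <= omega R M.
Proof.
move=> r0 hd hb; have n0 i : 0 < (nhalf_in M i)%:R :> R by rewrite ltr0n nhalf_in_gt0.
have N0 : 0 < (nhalf M)%:R :> R by rewrite nhalfE addr_gt0.
have h i : rho * alpha_in R M i <= (noutgoing M)%:R / (nhalf M)%:R.
  rewrite /alpha_in mulrCA ler_wpM2l // -[leRHS]mul1r ler_pdivlMr // mulrAC ler_pdivrMr // mul1r.
  exact: hb.
have := h false; have := h true; rewrite /omega /alpha mulrDr -mulrA; lra.
Qed.

Lemma outgoing_le_alpha M i : (forall v : vertex M, (3 <= degree v)%N) ->
  (noutgoing M)%:R <= alpha R M * (nhalf_in M i)%:R.
Proof.
move=> hd; have n0 : 0 < (nhalf_in M i)%:R :> R by rewrite ltr0n nhalf_in_gt0.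
rewrite -ler_pdivrMr //; exact: alpha_in_le.
Qed.

Lemma ln_le_nhalf M : (forall v : vertex M, (3 <= degree v)%N) -> lnN M <= (nhalf M)%:R.
Proof.
move=> hd; have N0 : 0 < (nhalf M)%:R :> R by rewrite nhalf_gt0.
have := expR_ge1Dx (lnN M); rewrite lnK ?posrE //; lra.
Qed.

(* [N >= (ln N)^3 / 27], from [e^(y/3) >= y/3]. *)
Lemma ln_cube_le M : (forall v : vertex M, (3 <= degree v)%N) -> 0 <= lnN M ->
  lnN M ^+ 3 <= 27 * (nhalf M)%:R.
Proof.
move=> hd y0; have N0 : 0 < (nhalf M)%:R :> R by rewrite nhalf_gt0.
have e : (nhalf M)%:R = expR (lnN M / 3) ^+ 3 :> R.
  by rewrite -expRM_natl mulrC divfK // lnK ?posrE.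
have h : lnN M / 3 <= expR (lnN M / 3) by have := expR_ge1Dx (lnN M / 3); lra.
have : (lnN M / 3) ^+ 3 <= expR (lnN M / 3) ^+ 3.
  by apply: lerXn2r; rewrite ?nnegrE ?expR_ge0 ?divr_ge0.
rewrite -e expr_div_n; lra.
Qed.

Lemma burn_in_time M (g : R) : (forall v : vertex M, (3 <= degree v)%N) -> 0 < g <= 1 -> 1 <= lnN M ->
  exists m0 : nat, [/\ (0 < m0)%N, (1 - g) ^+ m0 * (nhalf M)%:R <= 1 & m0%:R <= 2 * lnN M / g].
Proof.
move=> hd /andP[g0 g1] y1; have N0 : 0 < (nhalf M)%:R :> R by rewrite nhalf_gt0.
have q0 : 0 <= lnN M / g by rewrite divr_ge0 ?ltW // (lt_le_trans _ y1).
have /andP[h1 h2] := truncn_itv q0; exists (Num.truncn (lnN M / g)).+1; split=> //.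
  have h : 1 - g <= expR (- g) by have := expR_ge1Dx (- g); lra.
  apply: (@le_trans _ _ (expR (- lnN M) * (nhalf M)%:R)); last first.
    by rewrite expRN lnK ?posrE // mulVf // lt0r_neq0.
  rewrite ler_wpM2r ?(ltW N0) //; apply: le_trans (lerXn2r _ _ _ h) _; rewrite ?nnegrE ?expR_ge0 ?subr_ge0 //.
  rewrite -expRM_natl ler_expR mulrN lerN2 -ler_pdivrMr //; exact: ltW.
have h3 : 1 <= lnN M / g by rewrite ler_pdivlMr // mul1r (le_trans g1).
rewrite -natr1 -mulrA; lra.
Qed.

Lemma expr_le_inv (u : R) l : 0 < u <= 1 -> (0 < l)%N -> (1 - u) ^+ l <= (l%:R * u)^-1.
Proof.
move=> /andP[u0 u1] l0; have lu : 0 < l%:R * u by rewrite mulr_gt0 // ltr0n.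
have h : 1 - u <= expR (- u) by have := expR_ge1Dx (- u); lra.
apply: le_trans (lerXn2r _ _ _ h) _; rewrite ?nnegrE ?expR_ge0 ?subr_ge0 //.
rewrite -expRM_natl mulrN expRN lef_pV2 ?posrE ?expR_gt0 //.
have := expR_ge1Dx (l%:R * u); lra.
Qed.

Definition good phi M (eta : {perm half_edge M}) := expander eta phi /\ non_bipartite eta phi.

Lemma good_whp rho : 0 < rho <= 1 -> exists phi : R, 0 < phi <= 1 /\
  forall (delta : R), 0 < delta -> exists a1 Y1 : R, 0 < a1 /\
    forall Delta C M, regime rho Delta C a1 Y1 M ->
      prob R (fun eta : {perm half_edge M} => ~~ `[< good phi eta >]) <= delta.
Proof.
move=> r01; have /andP[r0 r1] := r01.
have [m [phi [e [K [p01 e0 K0 h]]]]] : exists (m : nat) (phi e K : R), [/\ 0 < phi <= 1, 0 < e, 0 < K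
    & forall M, (forall v : vertex M, (3 <= degree v)%N) ->
      (forall i, rho * (nhalf M)%:R <= (nhalf_in M i)%:R) -> (forall i, (m <= nhalf_in M i)%N) ->
      (noutgoing M)%:R <= e * (nhalf M)%:R ->
      prob R (fun eta : {perm half_edge M} => ~~ `[< good phi eta >]) <= K / (nhalf M)%:R].
  exists 1000%N; exact: expander_whp r01.
exists phi; split=> // delta d0.
exists e, (K / delta + m%:R / rho); split=> // Delta C M [hd hb ha hY _].
have hd3 v : (3 <= degree (t := M) v)%N by case/andP: (hd v).
have N0 : 0 < (nhalf M)%:R :> R by rewrite nhalf_gt0.
have yN := le_trans hY (ln_le_nhalf hd3).
have k1 : 0 < K / delta by rewrite divr_gt0.
have k2 : 0 <= m%:R / rho by rewrite divr_ge0 ?(ltW r0).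
apply: le_trans (h M hd3 hb _ _) _.
- move=> i; rewrite -(ler_nat R); apply: le_trans (hb i).
  by rewrite mulrC -ler_pdivrMr //; apply: le_trans yN; rewrite lerDr; exact: ltW.
- apply: le_trans (outgoing_le_alpha false hd3) _.
  apply: ler_pM => //; first exact/ltW/alpha_gt0.
  by rewrite ler_nat /nhalf leq_addr.
rewrite ler_pdivrMr // mulrC -ler_pdivrMr //; apply: le_trans yN; by rewrite lerDl.
Qed.

Lemma gap_itv phi : 0 < phi <= 1 -> 0 < gap phi phi <= 1.
Proof.
move=> /andP[p0 p1]; have h0 : 0 < phi ^+ 2 * phi ^+ 4 by rewrite mulr_gt0 ?exprn_gt0.
have h : phi ^+ 2 * phi ^+ 4 <= 1 by rewrite mulr_ile1 ?exprn_ge0 ?exprn_ile1 ?(ltW p0).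
have h1 : 0 < (4096 : R)^-1 <= 1 by rewrite invr_gt0 ltr0n invf_le1 ?ltr0n // ler1n.
rewrite /gap; set c := (4096)^-1 in h1 *; case/andP: h1 => c0 c1.
by rewrite mulr_gt0 //= mulr_ile1 // ltW.
Qed.

Lemma tmix_from_le M (eta : {perm half_edge M}) x (eps q : R) (t : nat) :
  dist_from R eta x t < eps -> t%:R <= q -> (tmix_from eta x eps <= q%:E)%E.
Proof.
move=> h tq; apply: (@le_trans _ _ (t%:R%:E)); last by rewrite lee_fin.
by apply: ereal_inf_lbound; exists t.
Qed.

Lemma tmix_le M (eta : {perm half_edge M}) (eps q : R) (t : nat) :
  dist R eta t < eps -> t%:R <= q -> (tmix eta eps <= q%:E)%E.
Proof.
move=> h tq; apply: (@le_trans _ _ (t%:R%:E)); last by rewrite lee_fin.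
by apply: ereal_inf_lbound; exists t.
Qed.

Lemma tmix_from_ge M (eta : {perm half_edge M}) x (eps q : R) :
  (forall t : nat, t%:R < q -> eps <= dist_from R eta x t) -> (q%:E <= tmix_from eta x eps)%E.
Proof.
move=> h; apply: le_ereal_inf_tmp => _ [t ht <-]; rewrite lee_fin leNgt; apply/negP => /h.
by rewrite leNgt ht.
Qed.

Lemma tmix_ge M (eta : {perm half_edge M}) (eps q : R) :
  (forall t : nat, t%:R < q -> eps <= dist R eta t) -> (q%:E <= tmix eta eps)%E.
Proof.
move=> h; apply: le_ereal_inf_tmp => _ [t ht <-]; rewrite lee_fin leNgt; apply/negP => /h.
by rewrite leNgt ht.
Qed.

End Regime.

(** * Upper bound on the mixing time *)

Section UpperBound.
Variable R : realType.
Implicit Types (M : two_community) (rho phi C eps : R).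

Lemma upper_good rho phi eps C : 0 < rho <= 1 -> 0 < phi <= 1 -> 0 < eps < 1 -> 0 < C ->
  exists (k : nat) (b a1 : R), [/\ 0 < b, 0 < a1 &
    forall Delta M (eta : {perm half_edge M}), regime rho Delta C a1 1 M -> valid eta -> good phi eta ->
      \sum_(x in crossing eta) step eta (crossed R eta (2 * k.+1)) x <= (noutgoing M)%:R / 2 ->
      forall x, (tmix_from eta x eps <= (b / alpha R M)%:E)%E].
Proof.
move=> r01 p01 /andP[eps0 eps1] C0; have /andP[r0 r1] := r01; have /andP[p0 p1] := p01.
have g01 := gap_itv p01; have /andP[g0 g1] := g01; set g := gap phi phi in g01 g0 g1.
have /andP[ka0 ka1] := kappa01 g0; set ka := kappa phi phi in ka0 ka1; pose v : R := 1 - ka.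
have v0 : 0 < v by rewrite subr_gt0.
have v1 : v <= 1 by rewrite /v lerBlDr lerDl.
have fl1 := flat_ge1 r01; pose S : R := Num.sqrt (flat rho).
have S1 : 1 <= S by have := ler_wsqrtr fl1; rewrite sqrtr1.
have S0 : 0 < S by apply: lt_le_trans S1.
(* About c / alpha blocks are used; each geometric term is then at most 1/c, and together they
   contribute 3 S / c = 3 eps / 16. *)
pose c : R := 16 * S / eps; have c0 : 0 < c by rewrite divr_gt0 ?mulr_gt0.
(* [q1] is what 4 B^2 <= J omega (1 - kappa) / 2 asks of J, given drift^2 = 2 alpha and omega >= rho
   alpha; [q2] ensures alpha <= J omega / 4. *)
pose q1 := 20 * 20 / (rho * v ^+ 3); pose q2 := 4 / rho.
have q10 : 0 < q1 by rewrite /q1 divr_gt0 // mulr_gt0 // exprn_gt0.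
have q20 : 0 < q2 by rewrite divr_gt0.
have /andP[_ hk] := truncn_itv (ltW (addr_gt0 q10 q20)); set k := Num.truncn _ in hk.
pose J : R := (2 * k.+1)%N%:R.
have Jq : q1 + q2 <= J.
  by apply: (le_trans (ltW hk)); rewrite ler_nat mul2n -addnn leq_addr.
have J0 : 0 < J by apply: lt_le_trans Jq; rewrite addr_gt0.
have J1 : q1 <= J by apply: le_trans Jq; rewrite lerDl ltW.
have J2 : q2 <= J by apply: le_trans Jq; rewrite lerDr ltW.
have {}J1 : 20 * 20 <= J * rho * v ^+ 3 by rewrite -mulrA -ler_pdivrMr // mulr_gt0 ?exprn_gt0.
have {}J2 : 4 <= J * rho by rewrite -ler_pdivrMr.
(* [D1] brings the residual term 2B / (1 - kappa) below eps / (8 S). [D2] gives J omega / rho <=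
   drift, since alpha is drift^2 / 2 and hence of higher order. *)
pose D1 : R := eps * v ^+ 2 / (80 * S); pose D2 := 2 * rho / J.
have D10 : 0 < D1 by rewrite divr_gt0 ?mulr_gt0 ?exprn_gt0.
have D20 : 0 < D2 by rewrite divr_gt0 ?mulr_gt0.
(* The first term pays for the burn-in, where alpha ln N <= C enters; the others pay for the
   blocks. *)
pose b := 4 * C / g + J * c + J.
pose a1 := Num.min (phi ^+ 2 / 16) (Num.min (D1 ^+ 2 / 2) (Num.min (D2 ^+ 2 / 2) (Num.min (rho * v / J) (Num.min v 1)))).
exists k, b, a1; split.
- by rewrite !addr_gt0 ?mulr_gt0 ?invr_gt0.
- have z1 : 0 < phi ^+ 2 / 16 by rewrite divr_gt0 // exprn_gt0.
  have z2 : 0 < D1 ^+ 2 / 2 by rewrite divr_gt0 // exprn_gt0.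
  have z3 : 0 < D2 ^+ 2 / 2 by rewrite divr_gt0 // exprn_gt0.
  have z4 : 0 < rho * v / J by rewrite divr_gt0 // mulr_gt0.
  by rewrite /a1 !lt_min z1 z2 z3 z4 v0 ltr01.
move=> Delta M eta [hd hb ha y1 hC] hv [hexp hnb] hsum x.
have hd3 u : (3 <= degree (t := M) u)%N by case/andP: (hd u).
have al0 := alpha_gt0 R hd3; set al := alpha R M in ha hC al0 *.
move: ha; rewrite !le_min => /and5P[ha1 ha2 ha3 ha4 /andP[ha5 ha6]].
have hcard := card_crossing_valid hv; have [etaK _ _] := hv.
have om1 := omega_le_alpha R hd3; have om2 := alpha_le_omega r0 hd3 hb.
rewrite -/al in om1 om2; set om := omega R M in om1 om2.
have om0 : 0 < om by apply: lt_le_trans om2; rewrite mulr_gt0.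
have [m0 [_ burn hm0]] := burn_in_time hd3 g01 y1.
pose d := drift R eta; have dd : d ^+ 2 = 2 * al := drift2 R hcard.
have d0 : 0 <= d by apply: nrm_ge0.
have dD1 : d <= D1 by rewrite -(@ler_pXn2r _ 2) ?nnegrE ?(ltW D10) // dd; move: ha2; lra.
have dD2 : d <= D2 by rewrite -(@ler_pXn2r _ 2) ?nnegrE ?(ltW D20) // dd; move: ha3; lra.
have la0 : 0 < c / al by rewrite divr_gt0.
have /andP[hl1 hl2] := truncn_itv (ltW la0); set l := (Num.truncn (c / al)).+1 in hl2.
have l0 : 0 < l%:R :> R by rewrite ltr0n.
have hl3 : l%:R <= c / al + 1 by rewrite /l -natr1 lerD2r.
have phi01 : 0 <= phi <= 1 by rewrite ltW.
have few i : 16 * (noutgoing M)%:R <= phi ^+ 2 * (nhalf_in M i)%:R.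
  have n0 : 0 < (nhalf_in M i)%:R :> R by rewrite ltr0n nhalf_in_gt0.
  have h : alpha_in R M i <= phi ^+ 2 / 16 := le_trans (alpha_in_le R M i) ha1.
  move: h; rewrite /alpha_in ler_pdivrMr // => h.
  have -> : phi ^+ 2 * (nhalf_in M i)%:R = 16 * (phi ^+ 2 / 16 * (nhalf_in M i)%:R) by field.
  by rewrite ler_wpM2l.
pose t := (2 * m0 + 2 * k.+1 * l)%N.
have Jom : J * om <= J * al by rewrite ler_wpM2l // ltW.
have Jd : J * om / rho <= d.
  rewrite ler_pdivrMr //; apply: le_trans Jom _.
  have -> : J * al = d * (J * d / 2) by have -> : al = d ^+ 2 / 2 by [rewrite dd; field]; field.
  by rewrite ler_wpM2l //; move: dD2; rewrite /D2 ler_pdivlMr //; lra.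
have Jv : J * om / rho <= v.
  by rewrite ler_pdivrMr //; apply: le_trans Jom _; move: ha4; rewrite ler_pdivlMr //; clear; lra.
have hB : 4 * (5 * d / v) ^+ 2 <= J * om / 2 * v.
  have -> : 4 * (5 * d / v) ^+ 2 = 200 * al / v ^+ 2.
    by rewrite !exprMn exprVn dd; field; rewrite lt0r_neq0.
  rewrite ler_pdivrMr ?exprn_gt0 //.
  apply: (@le_trans _ _ ((J * rho * v ^+ 3) * al / 2)).
    have : 20 * 20 * al <= J * rho * v ^+ 3 * al by rewrite ler_wpM2r // ltW.
    by clear; lra.
  have -> : J * rho * v ^+ 3 * al / 2 = J * v ^+ 3 / 2 * (rho * al) by field.
  have -> : J * om / 2 * v * v ^+ 2 = J * v ^+ 3 / 2 * om by field.
  by rewrite ler_wpM2l // divr_ge0 // mulr_ge0 ?exprn_ge0 // ltW.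
have hX3 : 2 * (5 * d / v) / v <= eps / (8 * S).
  have -> : 2 * (5 * d / v) / v = 10 / v ^+ 2 * d by field; rewrite lt0r_neq0.
  have -> : eps / (8 * S) = 10 / v ^+ 2 * D1 by rewrite /D1; field; rewrite !lt0r_neq0.
  by rewrite ler_wpM2l // divr_ge0 // exprn_ge0 // ltW.
have hX3' : 2 * (5 * d / v) / v <= 1.
  apply: le_trans hX3 _; rewrite ler_pdivrMr ?mulr_gt0 // mul1r; move: eps1 S1; clear; lra.
have h : dist_from R eta x t <= S * (2 * (1 - J * om / 4) ^+ l + ka ^+ l + 2 * (5 * d / v) / v).
  exact: (dist_from_upper hd3 etaK hcard phi01 phi01 hexp hnb few r01 hb burn g0 x
  hsum Jd Jv hB hX3' (leqnn t)).
apply: (tmix_from_le (t := t)).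
  apply: le_lt_trans h _.
  have X1 : (1 - J * om / 4) ^+ l <= c^-1.
    have u0 : 0 < J * om / 4 <= 1.
      have w0 : 0 < J * om by rewrite mulr_gt0.
      have w1 : J * om <= v * rho by move: Jv; rewrite ler_pdivrMr.
      have w2 : v * rho <= 1 by rewrite mulr_ile1 // ltW.
      by apply/andP; split; move: w0 w1 w2; clear; lra.
    apply: le_trans (expr_le_inv u0 _) _ => //.
    have [u1 _] := andP u0; have lu0 : 0 < l%:R * (J * om / 4) by rewrite mulr_gt0.
    have al4 : al <= J * om / 4.
      have h2 : J * (rho * al) <= J * om by rewrite ler_wpM2l // ltW.
      have h3 : 4 * al <= J * rho * al by rewrite ler_wpM2r // ltW.
      by move: h2 h3; clear; lra.
    rewrite lef_pV2 ?posrE //.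
    have e1 : c = c / al * al by rewrite divfK // lt0r_neq0.
    by rewrite e1 ler_pM // ltW.
  have X2 : ka ^+ l <= c^-1.
    have v01 : 0 < v <= 1 by rewrite v0.
    have := expr_le_inv v01 (ltn0Sn (Num.truncn (c / al))); rewrite -/l.
    have -> : 1 - v = ka by rewrite /v; ring.
    have lv0 : 0 < l%:R * v by rewrite mulr_gt0.
    move=> /le_trans; apply; rewrite lef_pV2 ?posrE //.
    have e1 : c = c / al * al by rewrite divfK // lt0r_neq0.
    by rewrite e1 ler_pM // ltW.
  apply: (@le_lt_trans _ _ (S * (2 * c^-1 + c^-1 + eps / (8 * S)))).
    apply: ler_wpM2l; first exact: ltW S0.
    by apply: lerD; [apply: lerD; [rewrite ler_wpM2l|exact: X2]|exact: hX3].
  have -> : S * (2 * c^-1 + c^-1 + eps / (8 * S)) = 3 * eps / 16 + eps / 8.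
    by rewrite /c; field; rewrite !lt0r_neq0.
  by move: eps0; clear; lra.
rewrite ler_pdivlMr // /t natrD !natrM.
have h1 : m0%:R * al <= 2 * C / g.
  apply: (@le_trans _ _ (2 * ln (nhalf M)%:R / g * al)); first by rewrite ler_wpM2r // ltW.
  rewrite mulrAC -[2 * _ * al]mulrA ler_wpM2r ?invr_ge0 ?(ltW g0) // ler_wpM2l //.
  by rewrite mulrC.
have h2 : l%:R * al <= c + 1.
  apply: (@le_trans _ _ ((c / al + 1) * al)); first by rewrite ler_wpM2r // ltW.
  by rewrite mulrDl divfK ?lt0r_neq0 // mul1r lerD2l.
have h3 : J * (l%:R * al) <= J * (c + 1) by rewrite ler_wpM2l // ltW.
have -> : (2%:R * m0%:R + 2%:R * k.+1%:R * l%:R) * al = 2 * (m0%:R * al) + J * (l%:R * al) :> R.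
  by rewrite /J natrM; ring.
rewrite /b; have -> : 4 * C / g = 2 * (2 * C / g) by field; rewrite lt0r_neq0.
by move: h1 h3; clear; lra.
Qed.

Lemma upper_regime rho eps C : 0 < rho <= 1 -> 0 < eps < 1 -> 0 < C ->
  exists b : R, 0 < b /\ forall (delta : R) Delta, 0 < delta -> exists a1 Y1 : R, 0 < a1 /\
    forall M, regime rho Delta C a1 Y1 M -> forall x : half_edge M,
      prob R (fun eta : {perm half_edge M} => ~~ (tmix_from eta x eps <= (b / alpha R M)%:E)%E) <= delta.
Proof.
move=> r01 e01 C0; have [phi [p01 hgood]] := good_whp r01; have /andP[r0 r1] := r01.
have [k [b [a1 [b0 a10 hup]]]] := upper_good r01 p01 e01 C0.
exists b; split=> // delta Delta d0.
have [a2 [Y2 [a20 {}hgood]]] := hgood (delta / 2) (divr_gt0 d0 (ltr0Sn _ 1)).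
pose J := (2 * k.+1)%N; pose L := (2 * J + 3)%N.
(* With J [Th] <= delta/8, Markov's inequality at level p/2 leaves probability at most delta/2. *)
pose Th := Num.min 1 (delta / 8 / J%:R).
have J0 : 0 < J%:R :> R by rewrite ltr0n /J.
have Th0 : 0 < Th by rewrite lt_min ltr01 !divr_gt0.
pose Y1 := (2 * L).+1%:R / rho + 4 * (Delta * L)%N%:R / (rho * Th).
have Y10 : 0 <= 4 * (Delta * L)%N%:R / (rho * Th) by rewrite divr_ge0 ?mulr_ge0 // ltW.
have Y11 : 0 <= (2 * L).+1%:R / rho by rewrite divr_ge0 // ltW.
exists (Num.min a1 (Num.min a2 (Th / 4))), (Num.max 1 (Num.max Y1 Y2)); split.
  by rewrite !lt_min a10 a20 divr_gt0.
move=> M hreg x.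
have hreg1 : regime rho Delta C a1 1 M.
  by apply: regime_weaken hreg; rewrite ?ge_min ?le_max lexx.
have hreg2 : regime rho Delta C a2 Y2 M.
  by apply: regime_weaken hreg; rewrite ?ge_min ?le_max lexx ?orbT.
have hreg3 : regime rho Delta C (Th / 4) Y1 M.
  by apply: regime_weaken hreg; rewrite ?ge_min ?le_max lexx ?orbT.
case: hreg3 => hd hb ha hY _.
have hd3 u : (3 <= degree (t := M) u)%N by case/andP: (hd u).
have hdD u : (degree (t := M) u <= Delta)%N by case/andP: (hd u).
have yN := le_trans hY (ln_le_nhalf R hd3).
have N0 : 0 < (nhalf M)%:R :> R by rewrite nhalf_gt0.
have hL i : (2 * L < nhalf_in M i)%N.
  rewrite -(ler_nat R); apply: le_trans (hb i); rewrite mulrC -ler_pdivrMr //.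
  by apply: le_trans yN; rewrite lerDl.
have hT i : theta R M i L Delta <= Th.
  apply: le_trans (theta_bound R Delta (hL i)) _.
  have h1 : alpha_in R M i <= Th / 4 := le_trans (alpha_in_le R M i) ha.
  have n0 : 0 < (nhalf_in M i)%:R :> R by rewrite ltr0n nhalf_in_gt0.
  have h2 : 2 * (Delta * L)%N%:R / (nhalf_in M i)%:R <= Th / 2.
    have h3 : 4 * (Delta * L)%N%:R <= rho * (nhalf M)%:R * Th.
      rewrite mulrAC [_ * Th * _]mulrC -ler_pdivrMr ?mulr_gt0 //.
      by apply: le_trans yN; rewrite lerDr.
    rewrite ler_pdivrMr //; have : rho * (nhalf M)%:R * Th <= (nhalf_in M i)%:R * Th.
      by rewrite ler_wpM2r // ltW.
    move: h3; lra.
  lra.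
have T1 : Th <= 1 by rewrite ge_min lexx.
have hLn i : (L < nhalf_in M i)%N by apply: leq_ltn_trans (hL i); rewrite leq_pmull.
have p0 : 0 < (noutgoing M)%:R :> R by rewrite ltr0n; apply: leq_trans (noutgoing_ge2 M).
have hm : prob R (fun eta : {perm half_edge M} => (noutgoing M)%:R / 2 <=
    \sum_(x in crossing eta) step eta (crossed R eta J) x) <= delta / 2.
  apply: le_trans (markov_prob _ _) _; first by rewrite divr_gt0.
    move=> eta _; apply: sumr_ge0 => z _; apply: step_ge0 => y.
    by case/andP: (crossed01 R eta hd3 J y).
  rewrite ler_pdivrMr ?divr_gt0 //.
  apply: le_trans (crossing_twice_le hd3 hdD hLn hT T1 _) _; first by rewrite /L; clear; lia.
  rewrite natrM; have h : J%:R * Th <= delta / 8.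
    by rewrite mulrC -ler_pdivlMr // ge_min lexx orbT.
  have : (noutgoing M)%:R * (J%:R * Th) <= (noutgoing M)%:R * (delta / 8) by rewrite ler_wpM2l // ltW.
  lra.
apply: le_trans (prob_le R (F := fun eta : {perm half_edge M} => ~~ `[< good phi eta >] || ((noutgoing M)%:R / 2 <=
    \sum_(x in crossing eta) step eta (crossed R eta J) x)) _) _.
  move=> eta ve; apply: contraR; rewrite negb_or negbK -ltNge => /andP[/asboolP hg hs].
  exact: hup hreg1 ve hg (ltW hs) x.
apply: le_trans (prob_or R _ _) _.
have := hgood _ _ _ hreg2; lra.
Qed.

End UpperBound.

(** * Lower bound from a given half-edge, and absence of cutoff *)

Section LowerBound.
Variable R : realType.
Implicit Types (M : two_community) (rho phi C eps delta : R).

(* Up to the mixing time [4 m0] inside the communities the crossing probability is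
   controlled by its concentration; after it, by the flatness of the law of the walk. *)
Lemma dist_from_early rho phi M (eta : {perm half_edge M}) i x (T t m0 : nat) delta :
  (forall v : vertex M, (3 <= degree v)%N) -> valid eta -> good phi eta ->
  0 < phi <= 1 -> 0 < rho <= 1 -> (forall i, rho * (nhalf M)%:R <= (nhalf_in M i)%:R) ->
  (1 - gap phi phi) ^+ m0 * (nhalf M)%:R <= 1 -> community (tag x) = i ->
  crossed R eta (minn T (4 * m0)) x <= (minn T (4 * m0))%:R * alpha_in R M i + delta -> (t <= T)%N ->
  (nhalf_in M (~~ i))%:R / (nhalf M)%:R - flat rho * (T%:R * alpha R M) - delta <= dist_from R eta x t.
Proof.
move=> hd hv [hexp hnb] p01 r01 hb burn xi hc tT; have /andP[p0 p1] := p01.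
have al0 := alpha_gt0 R hd; have F1 := flat_ge1 r01; set F := flat rho in F1 *.
have F0 : 0 < F by apply: lt_le_trans F1.
apply: le_trans (dist_from_ge R eta hd t xi); rewrite -addrA lerD2l -opprD lerN2.
set s := minn T (4 * m0) in hc *.
have hs : s%:R * alpha_in R M i <= s%:R * alpha R M by rewrite ler_wpM2l // alpha_in_le.
have hT u : (u <= T)%N -> u%:R * alpha R M <= T%:R * alpha R M.
  by move=> h; rewrite ler_wpM2r ?(ltW al0) // ler_nat.
have hF a : 0 <= a -> a <= F * a by move=> a0; rewrite ler_peMl.
have [ts|st] := leqP t s.
  apply: le_trans (crossed_mono R eta hd x ts) _; apply: le_trans hc _; rewrite lerD2r.
  apply: le_trans hs _; apply: le_trans (hT s (geq_minl _ _)) _; apply: hF.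
  by rewrite mulr_ge0 // ltW.
have sm : s = (4 * m0)%N by move: st tT; rewrite /s; clear; lia.
have phi01 : 0 <= phi <= 1 by rewrite (ltW p0).
have [etaK _ _] := hv.
have hflat u y : (s <= u)%N -> nbrw_iter R eta u x y <= F / (nhalf M)%:R.
  by rewrite sm; exact: (nbrw_iter_le hd etaK phi01 phi01 hexp hnb r01 hb burn).
have := @crossed_late R M eta hd s (t - s) x F hflat (card_crossing_valid hv).
rewrite (subnKC (ltnW st)) => /le_trans; apply.
have h1 : (t - s)%:R * (F * omega R M) <= F * ((t - s)%:R * alpha R M).
  by rewrite mulrCA ler_wpM2l ?(ltW F0) // ler_wpM2l // omega_le_alpha.
have h2 : s%:R * alpha R M <= F * (s%:R * alpha R M) by apply: hF; rewrite mulr_ge0 // ltW.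
have h3 : F * (s%:R * alpha R M) + F * ((t - s)%:R * alpha R M) <= F * (T%:R * alpha R M).
  rewrite -mulrDr ler_wpM2l ?(ltW F0) // -mulrDl -natrD subnKC ?(ltnW st) //; exact: hT.
move: h1 h2 h3 hc hs; clear; lra.
Qed.

Lemma fraction_compl M i (r : R) : (forall v : vertex M, (3 <= degree v)%N) ->
  r = (nhalf_in M i)%:R / (nhalf M)%:R -> 1 - r = (nhalf_in M (~~ i))%:R / (nhalf M)%:R.
Proof.
move=> hd ->; have N0 : 0 < (nhalf M)%:R :> R by rewrite nhalf_gt0.
rewrite -[X in X - _](divff (lt0r_neq0 N0)) -mulrBl; congr (_ / _).
by rewrite nhalfE; case: (i); rewrite /=; ring.
Qed.

Lemma balanced_fraction M i (r : R) : (forall v : vertex M, (3 <= degree v)%N) ->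
  r = (nhalf_in M i)%:R / (nhalf M)%:R -> 0 < Num.min r (1 - r) <= 1 /\
  forall j, Num.min r (1 - r) * (nhalf M)%:R <= (nhalf_in M j)%:R.
Proof.
move=> hd rE; have r'E := fraction_compl hd rE.
have N0 : 0 < (nhalf M)%:R :> R by rewrite nhalf_gt0.
have n0 j : 0 < (nhalf_in M j)%:R :> R by rewrite ltr0n nhalf_in_gt0.
have r0 : 0 < r by rewrite rE divr_gt0.
have r1 : 0 < 1 - r by rewrite r'E divr_gt0.
split.
  by rewrite lt_min r0 r1 /= ge_min; apply/orP; left; move: r1; clear; lra.
move=> j; have [->|->] : j = i \/ j = ~~ i by case: (i); case: (j); [left|right|right|left].
  apply: (@le_trans _ _ (r * (nhalf M)%:R)); first by rewrite ler_wpM2r // ge_min lexx.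
  by rewrite rE divfK // lt0r_neq0.
apply: (@le_trans _ _ ((1 - r) * (nhalf M)%:R)); first by rewrite ler_wpM2r // ge_min lexx orbT.
by rewrite r'E divfK // lt0r_neq0.
Qed.

(** The constant uses [flat] at the true fraction min(r, 1 - r), while [rho] and [phi] enter only
    through the burn-in time and the thresholds. It therefore depends on eps and r alone. *)
Lemma lower_regime rho C delta Delta : 0 < rho <= 1 -> 0 < delta ->
  exists a1 Y1 : R, 0 < a1 /\ forall M, regime rho Delta C a1 Y1 M ->
    forall i (x : half_edge M) eps, community (tag x) = i ->
    forall r, r = (nhalf_in M i)%:R / (nhalf M)%:R -> prob R (fun eta : {perm half_edge M} =>
      ~~ ((((1 - r - eps) / flat (Num.min r (1 - r)) - delta) / alpha R M)%:E <= tmix_from eta x eps)%E)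
    <= delta.
Proof.
move=> r01 d0; have [phi [p01 hgood]] := good_whp r01; have /andP[r0 r1] := r01.
have [a2 [Y2 [a20 {}hgood]]] := hgood (delta / 2) (divr_gt0 d0 (ltr0Sn _ 1)).
have g01 := gap_itv p01; have /andP[g0 g1] := g01; set g := gap phi phi in g01 g0 g1.
(* The variance bound will be at most 2 [ka]; divided by delta^2 it must not exceed delta/2. The cap
   1/4 serves the smallness hypotheses of [crossed_whp]. *)
pose ka : R := Num.min (delta ^+ 3 / 4) (1 / 4).
have ka0 : 0 < ka by rewrite lt_min !divr_gt0 ?exprn_gt0.
have ka1 : ka <= delta ^+ 3 / 4 by rewrite ge_min lexx.
have ka2 : ka <= 1 / 4 by rewrite ge_min lexx orbT.
(* Here s + 1 <= 4 m0 + 1 <= 9 ln N / g, so the error terms are of order ln^2 N over n_i; [Q] tells,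
   through [ln_cube_le], how large ln N must be for them to stay below [ka]. *)
pose c9 : R := 9; have c90 : 0 <= c9 by rewrite /c9 ler0n.
pose Z : R := (8 * Delta + 6)%N%:R * (4 * (c9 / g) ^+ 2).
pose Q : R := 27 * Z / rho.
exists (Num.min a2 (ka / 2)), (Num.max (Num.max 1 (Q / ka)) Y2); split.
  by rewrite lt_min a20 divr_gt0.
move=> M hreg i x eps xi.
have hreg2 : regime rho Delta C a2 Y2 M.
  by apply: regime_weaken hreg; rewrite ?ge_min ?le_max lexx ?orbT.
case: hreg => hd hb; rewrite le_min !ge_max => /andP[_ ha] /andP[/andP[y1 hY] _] _.
have hd3 u : (3 <= degree (t := M) u)%N by case/andP: (hd u).
have hdD u : (degree (t := M) u <= Delta)%N by case/andP: (hd u).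
have N0 : 0 < (nhalf M)%:R :> R by rewrite nhalf_gt0.
have n0 j : 0 < (nhalf_in M j)%:R :> R by rewrite ltr0n nhalf_in_gt0.
have al0 := alpha_gt0 R hd3; move=> r rE.
pose a : R := (1 - r - eps) / flat (Num.min r (1 - r)).
have r'E := fraction_compl hd3 rE; have [rr01 hbr] := balanced_fraction hd3 rE.
set rr := Num.min r (1 - r) in a rr01 hbr *.
have F1 := flat_ge1 rr01; have F0 : 0 < flat rr by apply: lt_le_trans F1.
have [m0 [m00 burn hm0]] := burn_in_time hd3 g01 y1.
pose q : R := (a - delta) / alpha R M; pose T := Num.truncn q; pose s := minn T (4 * m0).
set y := ln (nhalf M)%:R in y1 hY hm0.
have y0 : 0 < y by apply: lt_le_trans y1.
have hs : s.+1%:R <= c9 * (y / g).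
  have h1 : s%:R <= 4 * m0%:R :> R by rewrite -natrM ler_nat geq_minr.
  have h2 : 1 <= y / g by rewrite ler_pdivlMr // mul1r (le_trans g1).
  have h3 : m0%:R <= 2 * (y / g) by rewrite mulrA.
  by rewrite -natr1 /c9; move: h1 h2 h3; clear; lra.
have hW : (8 * Delta + 6)%N%:R * (4 * s.+1 ^ 2)%N%:R <= ka * (nhalf_in M i)%:R.
  have h1 : (4 * s.+1 ^ 2)%N%:R <= 4 * (c9 / g) ^+ 2 * y ^+ 2.
    have -> : 4 * (c9 / g) ^+ 2 * y ^+ 2 = 4 * (c9 * (y / g)) ^+ 2 by rewrite /c9; field; rewrite lt0r_neq0.
    rewrite natrM natrX ler_wpM2l // lerXn2r ?nnegrE //.
    by rewrite mulr_ge0 // divr_ge0 ?(ltW y0) ?(ltW g0).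
  apply: (@le_trans _ _ (Z * y ^+ 2)); first by rewrite /Z -mulrA ler_wpM2l.
  have h2 : Q <= y * ka by rewrite -ler_pdivrMr.
  have h3 : 27 * Z <= y * ka * rho by rewrite -ler_pdivrMr.
  have h4 : rho * y ^+ 3 <= 27 * (nhalf_in M i)%:R.
    apply: (@le_trans _ _ (rho * (27 * (nhalf M)%:R))).
      by rewrite ler_wpM2l ?(ltW r0) // ln_cube_le // ltW.
    by rewrite mulrCA ler_wpM2l.
  have h5 : 27 * Z * y ^+ 2 <= y * ka * rho * y ^+ 2 by rewrite ler_wpM2r ?sqr_ge0.
  have h6 : ka * (rho * y ^+ 3) <= ka * (27 * (nhalf_in M i)%:R) by rewrite ler_wpM2l // ltW.
  have e6 : y * ka * rho * y ^+ 2 = ka * (rho * y ^+ 3) by ring.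
  by move: h5 h6; rewrite e6; clear; lra.
have hn : ((8 * Delta + 6) * (4 * s.+1 ^ 2) * 4 <= nhalf_in M i)%N.
  rewrite -(ler_nat R) !natrM -natrM; move: hW; rewrite natrM => hW.
  have : ka * (nhalf_in M i)%:R <= 1 / 4 * (nhalf_in M i)%:R by rewrite ler_wpM2r.
  by move: hW; rewrite !natrM; clear; lra.
have hcw : prob R (fun eta : {perm half_edge M} =>
    s%:R * alpha_in R M i + delta <= crossed R eta s x) <= delta / 2.
  apply: le_trans (crossed_whp hd3 hdD xi _ d0 _) _.
  - by move: hn; clear; nia.
  - have h1 := alpha_in_le R M i.
    have h2 : (Delta * (4 * s + 3))%N%:R * 4 <= (nhalf_in M i)%:R :> R.
      by rewrite -natrM ler_nat; move: hn; clear; nia.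
    have h3 : 2 * (Delta * (4 * s + 3))%N%:R / (nhalf_in M i)%:R <= 1 / 2 :> R.
      by rewrite ler_pdivrMr //; move: h2; clear; lra.
    by move: h1 h3 ha ka2; clear; lra.
  have h1 := alpha_in_le R M i.
  have h2 : (8 * Delta + 6)%N%:R * (4 * s.+1 ^ 2)%N%:R / (nhalf_in M i)%:R <= ka by rewrite ler_pdivrMr.
  rewrite ler_pdivrMr ?exprn_gt0 //.
  have e : delta / 2 * delta ^+ 2 = 2 * (delta ^+ 3 / 4) by field.
  by rewrite e; move: h1 h2 ha ka1; clear; lra.
apply: le_trans (prob_le R (F := fun eta : {perm half_edge M} => ~~ `[< good phi eta >] ||
    (s%:R * alpha_in R M i + delta <= crossed R eta s x)) _) _.
  move=> eta ve; apply: contraR; rewrite negb_or negbK -ltNge => /andP[/asboolP hg hc].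
  apply: tmix_from_ge => t tq.
  have q0 : 0 <= q by apply: le_trans (ltW tq).
  have /andP[q1 q2] := truncn_itv q0.
  have tT : (t <= T)%N by rewrite -ltnS -(ltr_nat R); apply: lt_trans tq q2.
  apply: le_trans (dist_from_early hd3 ve hg p01 rr01 hbr burn xi (ltW hc) tT).
  rewrite -r'E.
  have h1 : T%:R * alpha R M <= a - delta by rewrite -ler_pdivlMr.
  have h2 : flat rr * (T%:R * alpha R M) <= flat rr * (a - delta) by rewrite ler_wpM2l // ltW.
  have h3 : flat rr * a = 1 - r - eps by rewrite /a mulrC divfK // lt0r_neq0.
  have h4 : delta <= flat rr * delta by rewrite ler_peMl // ltW.
  by move: h2; rewrite mulrBr h3; move: h4; clear; lra.
apply: le_trans (prob_or R _ _) _.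
have := hgood _ _ _ hreg2; move: hcw; clear; lra.
Qed.

(** The bound 1 <= b rules out a division by zero; an infinite numerator gives an infinite ratio,
    which is also far from 1. *)
Lemma ratio_far (a b : \bar R) (m : nat) : (0 < m)%N ->
  ((8 * m)%:R%:E <= a)%E -> (1 <= b)%E -> (b <= (4 * m)%:R%:E)%E -> ((1 / 2)%:E < `|a / b - 1|)%E.
Proof.
move=> m0; case: b => [b| |] //; rewrite !lee_fin => + b1 b4.
have b0 : 0 < b by apply: lt_le_trans b1.
case: a => [a| |] //; rewrite ?lee_fin => ha.
  rewrite inver gt_eqF // -EFinM -EFinB abse_EFin lte_fin.
  have : 2 <= a / b.
    by rewrite ler_pdivlMr //; move: ha b4; rewrite !natrM; clear; lra.
  move=> h; apply: (@lt_le_trans _ _ (a / b - 1)); first by move: h; clear; lra.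
  exact: ler_norm.
by rewrite inver gt_eqF // mulyr gtr0_sg ?invr_gt0 // mul1e /= ltry.
Qed.

Lemma cutoff_regime rho C Delta : 0 < rho <= 1 -> 0 < C ->
  exists eps a1 Y1 : R, [/\ 0 < eps < 1, 0 < a1 & forall M, regime rho Delta C a1 Y1 M ->
    1 / 2 <= prob R (fun eta : {perm half_edge M} =>
      ((1 / 2)%:E < `|tmix eta eps / tmix eta (1 - eps) - 1|)%E)].
Proof.
move=> r01 C0; have [phi [p01 hgood]] := good_whp r01; have /andP[r0 r1] := r01.
have [a2 [Y2 [a20 {}hgood]]] := hgood (1 / 2) (divr_gt0 ltr01 (ltr0Sn _ 1)).
have g01 := gap_itv p01; have /andP[g0 g1] := g01; set g := gap phi phi in g01 g0 g1.
have /andP[k0 k1] := kappa01 g0; pose v : R := 1 - kappa phi phi.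
have v0 : 0 < v by rewrite subr_gt0.
have /andP[p0 p1] := p01; have F1 := flat_ge1 r01.
have F0 : 0 < flat rho by apply: lt_le_trans F1.
(* By [dist_lower] a double step loses at most z alpha of the slow mode. *)
pose z : R := 2 / rho + 32 / v.
have z0 : 0 < z by rewrite addr_gt0 ?divr_gt0.
pose E : R := expR (- (16 * z * C / g)).
have E0 : 0 < E := expR_gt0 _.
(* The first bound gives D(4 m0) < 1 - eps by flatness, the second D(8 m0) >= eps; [E] is a lower
   bound, uniform thanks to alpha ln N <= C, for the survival of the slow mode over 8 m0 steps. *)
pose eps : R := Num.min ((flat rho)^-1 / 2) (Num.min (rho / 2 * E) (1 / 2)).
have e0 : 0 < eps by rewrite !lt_min !divr_gt0 ?invr_gt0 // mulr_gt0 ?divr_gt0.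
have e1 : eps <= (flat rho)^-1 / 2 by rewrite ge_min lexx.
have e2 : eps <= rho / 2 * E by rewrite !ge_min lexx ?orbT.
have e3 : eps <= 1 / 2 by rewrite !ge_min lexx ?orbT.
pose a1 : R := Num.min a2 (Num.min (phi ^+ 2 / 16) (Num.min (rho * v / 8) (Num.min (v ^+ 2 / 128) (z^-1 / 2)))).
(* The threshold 1/eps yields N >= 1/eps, hence D(0) >= 1 - eps, so the denominator of the ratio is
   at least 1. *)
exists eps, a1, (Num.max (Num.max 1 eps^-1) Y2); split.
- by rewrite e0; move: e3; clear; lra.
- have z1 : 0 < phi ^+ 2 / 16 by rewrite divr_gt0 // exprn_gt0.
  have z2 : 0 < rho * v / 8 by rewrite divr_gt0 // mulr_gt0.
  have z3 : 0 < v ^+ 2 / 128 by rewrite divr_gt0 // exprn_gt0.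
  have z4 : 0 < z^-1 / 2 by rewrite divr_gt0 // invr_gt0.
  by rewrite /a1 !lt_min a20 z1 z2 z3 z4.
move=> M hreg.
have hreg2 : regime rho Delta C a2 Y2 M.
  by apply: regime_weaken hreg; rewrite ?ge_min ?le_max lexx ?orbT.
case: hreg => hd hb; rewrite !le_min !ge_max => /and5P[_ ha1 ha2 ha3 ha4] /andP[/andP[y1 hY] _] hC.
have hd3 u : (3 <= degree (t := M) u)%N by case/andP: (hd u).
have N0 : 0 < (nhalf M)%:R :> R by rewrite nhalf_gt0.
have al0 := alpha_gt0 R hd3; set al := alpha R M in ha1 ha2 ha3 ha4 hC al0.
have yN := le_trans hY (ln_le_nhalf R hd3).
have [m0 [m00 burn hm0]] := burn_in_time hd3 g01 y1.
have far (eta : {perm half_edge M}) : valid eta -> good phi eta ->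
    ((1 / 2)%:E < `|tmix eta eps / tmix eta (1 - eps) - 1|)%E.
  move=> ve [hexp hnb]; have [etaK _ _] := ve; have phi01 : 0 <= phi <= 1 by rewrite ltW.
  apply: (ratio_far m00).
  - apply: tmix_ge => t; rewrite ltr_nat => tm.
    have tm' : (t <= 2 * (4 * m0))%N by move: tm; clear; lia.
    apply: (le_trans _ (dist_mono R eta hd3 tm')).
    have few i : 16 * (noutgoing M)%:R <= phi ^+ 2 * (nhalf_in M i)%:R.
      have := outgoing_le_alpha R i hd3; rewrite -/al.
      have : al * (nhalf_in M i)%:R <= phi ^+ 2 / 16 * (nhalf_in M i)%:R by rewrite ler_wpM2r.
      by clear; lra.
    have hcard := card_crossing_valid ve; have dd := drift2 R hcard; rewrite -/al in dd.
    have om := omega_le_alpha R hd3; rewrite -/al in om.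
    have c1 : 2 * omega R M / rho <= v / 4.
      rewrite ler_pdivrMr //; have h : v / 4 * rho = 2 * (rho * v / 8) by field.
      by rewrite h; move: om ha2; clear; lra.
    have c2 : 16 * drift R eta ^+ 2 <= v ^+ 2 / 4 by rewrite dd; move: ha3; clear; lra.
    have h := dist_lower hd3 etaK hcard phi01 phi01 hexp hnb few r01 hb g0 (4 * m0) c1 c2.
    apply: (le_trans _ h); apply: (le_trans e2); rewrite ler_wpM2l ?divr_ge0 ?(ltW r0) //.
    have zal : z * al <= 1 / 2.
      have h1 : z * al <= z * (z^-1 / 2) by rewrite ler_wpM2l // ltW.
      by apply: (le_trans h1); rewrite mulrA divff ?lt0r_neq0.
    have zal0 : 0 <= z * al by rewrite mulr_ge0 ?ltW.
    have u1 : expR (- (2 * (z * al))) <= 1 - 2 * omega R M / rho - 16 * drift R eta ^+ 2 / (1 - kappa phi phi).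
      rewrite -/v dd; apply: (@le_trans _ _ (1 - z * al)).
        rewrite expRN; apply: (@le_trans _ _ (1 + 2 * (z * al))^-1).
          rewrite lef_pV2 ?posrE ?expR_gt0 ?expR_ge1Dx //; by move: zal0; clear; lra.
        rewrite -[leLHS]mul1r ler_pdivrMr; first by move: zal zal0; clear; nra.
        by move: zal0; clear; lra.
      have h1 : 2 * omega R M / rho <= 2 / rho * al.
        by rewrite mulrAC ler_wpM2l // divr_ge0 // ltW.
      have h2 : 16 * (2 * al) / v = 32 / v * al by field; rewrite lt0r_neq0.
      by rewrite h2 /z; move: h1; clear; lra.
    apply: (@le_trans _ _ (expR (- (2 * (z * al))) ^+ (4 * m0))); last first.
      by apply: lerXn2r; rewrite ?nnegrE ?expR_ge0 // (le_trans (expR_ge0 _) u1).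
    rewrite -expRM_natl ler_expR mulrN lerN2 natrM.
    have h1 : m0%:R * al <= 2 * C / g.
      apply: (@le_trans _ _ (2 * ln (nhalf M)%:R / g * al)); first by rewrite ler_wpM2r // ltW.
      rewrite mulrAC -[2 * _ * al]mulrA ler_wpM2r ?invr_ge0 ?(ltW g0) // ler_wpM2l //.
      by rewrite mulrC.
    have h2 : 8 * z * (m0%:R * al) <= 8 * z * (2 * C / g) by rewrite ler_wpM2l // mulr_ge0 // ltW.
    by move: h2; clear; lra.
  - apply: (tmix_ge (q := 1)) => t; rewrite ltrn1 => t0; have -> : t = 0%N by move: t0; clear; lia.
    apply: (le_trans _ (dist0_ge R eta hd3)); rewrite lerD2l lerN2 -[leRHS]invrK lef_pV2 ?posrE ?invr_gt0 //.
  apply: (tmix_le (t := (4 * m0)%N)) => //.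
  apply: le_lt_trans (dist_le hd3 etaK phi01 phi01 hexp hnb r01 hb burn (leqnn _)) _.
  have : 0 < (flat rho)^-1 by rewrite invr_gt0.
  by move: e1; clear; lra.
have h1 : 1 <= prob R (fun eta : {perm half_edge M} =>
      ((1 / 2)%:E < `|tmix eta eps / tmix eta (1 - eps) - 1|)%E) +
    prob R (fun eta : {perm half_edge M} => ~~ `[< good phi eta >]).
  apply: le_trans (prob_or R _ _); rewrite -[leLHS](@expect_cst R M) probE.
  apply: expect_le => eta ve; case: (pselect (good phi eta)) => hg.
    by rewrite far.
  by rewrite (asboolF hg) orbT.
have := hgood _ _ _ hreg2; move: h1; clear; lra.
Qed.

End LowerBound.

(** * From single graphs to sequences *)

Section Sequences.
Variable R : realType.

(** Applied to alpha ln N, it lets the upper constant depend on the sequence only through the upper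
    limit [k], with [|k| + 1] in the role of [C]. *)
Lemma eventually_le_limn_sup (u : nat -> R) (C : R) : (forall n, 0 <= u n) ->
  (\forall n \near \oo, u n <= C) -> \forall n \near \oo, u n <= `|limn_sup u| + 1.
Proof.
move=> u0 [n0 _ hn0].
(* Adding the finitely many first terms bounds the whole sequence, so that the suprema of its tails
   are genuine. *)
pose B := `|C| + \sum_(i < n0) u i.
have hB n : u n <= B.
  have [h|h] := leqP n0 n.
    apply: (le_trans (hn0 n h)); apply: le_trans (ler_norm C) _; rewrite lerDl.
    by apply: sumr_ge0 => i _.
  rewrite /B (bigD1 (Ordinal h)) //= addrCA lerDl addr_ge0 //.
  by apply: sumr_ge0 => i _.
have bu : bounded_fun (u : R^o^nat).
  exists B; split; first exact: num_real.
  by move=> x Bx n _ /=; rewrite ger0_norm // (le_trans (hB n)) // ltW.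
have hl := bounded_fun_has_lbound_sups bu.
have hi : has_inf (range (sups (u : R^o^nat))) by split=> //; exists (sups u 0%N); exists 0%N.
have [_ [m _ <-] hm] := inf_adherent (ltr01 : 0 < (1 : R)) hi.
rewrite -limn_supE // in hm; exists m => // n /= mn.
apply: (@le_trans _ _ (sups u m)); last first.
  by apply: (le_trans (ltW hm)); rewrite lerD2r ler_norm.
apply: ub_le_sup; last by exists n.
exact/has_ubound_sdrop/bounded_fun_has_ubound.
Qed.

Lemma near_upto (P : nat -> nat -> Prop) : (forall j, \forall n \near \oo, P j n) ->
  forall J, \forall n \near \oo, forall j, (j <= J)%N -> P j n.
Proof.
move=> h; elim=> [|J IH].
  by apply: filterS (h 0%N) => n hn j; rewrite leqn0 => /eqP ->.
apply: filterS2 IH (h J.+1) => n h1 h2 j; rewrite leq_eqVlt => /orP[/eqP ->|] //; exact: h1.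
Qed.

Lemma cvg0_of_le (u : nat -> R) : (forall n, 0 <= u n) ->
  (forall e, 0 < e -> \forall n \near \oo, u n <= e) -> u n @[n --> \oo] --> (0 : R).
Proof.
move=> u0 h; apply/cvgr0Pnorm_le => e e0; apply: filterS (h e e0) => n.
by rewrite ger0_norm.
Qed.

Variable M : nat -> two_community.
Hypothesis degree_ge3 : forall n (v : vertex (M n)), (3 <= degree v)%N.
Hypothesis nhalf_infty : ((nhalf (M n))%:R : R) @[n --> \oo] --> +oo.
Local Notation lnN n := (ln ((nhalf (M n))%:R : R)).
Local Notation al n := (alpha R (M n)).

Lemma near_ln_ge (Y : R) : \forall n \near \oo, Y <= lnN n.
Proof.
have /cvgryPge/(_ (expR Y)) h := nhalf_infty; apply: filterS h => n h.
rewrite -[Y]expRK ler_ln ?posrE ?expR_gt0 //.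
by apply: lt_le_trans h; apply: expR_gt0.
Qed.

Lemma alpha_ln_bounded :
  much_less (fun n => al n) (fun n => 1 / lnN n) \/ same_order (fun n => al n) (fun n => 1 / lnN n) ->
  exists C : R, 0 < C /\ \forall n \near \oo, al n * lnN n <= C.
Proof.
have e n : al n / (1 / lnN n) = al n * lnN n by rewrite div1r invrK.
case=> [h|[c [C [c0 C0 h]]]].
  exists 1; split=> //; have h1 : \forall n \near \oo, al n / (1 / lnN n) <= 1 := cvgr_le _ h 1 ltr01.
  by have [n0 _ hn0] := h1; exists n0 => // n hn; rewrite -e; apply: hn0.
exists C; split=> //; have [n0 _ hn0] := h; exists n0 => // n hn; rewrite -e.
by case/andP: (hn0 n hn).
Qed.

Lemma near_alpha_le (C a : R) : 0 < a -> (\forall n \near \oo, al n * lnN n <= C) ->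
  \forall n \near \oo, al n <= a.
Proof.
move=> a0 h; apply: filterS2 h (near_ln_ge (Num.max 1 (C / a))) => n hC.
rewrite ge_max => /andP[y1 y2]; have y0 : 0 < lnN n by apply: lt_le_trans y1.
rewrite -(ler_pM2r y0); apply: le_trans hC _.
by rewrite mulrC -ler_pdivrMr.
Qed.

Lemma near_balanced :
  same_order (fun n => (nhalf_in (M n) false)%:R : R) (fun n => (nhalf_in (M n) true)%:R) ->
  same_order (fun n => (nhalf_in (M n) true)%:R : R) (fun n => (nhalf (M n))%:R) ->
  exists rho : R, 0 < rho <= 1 /\
    \forall n \near \oo, forall i, rho * (nhalf (M n))%:R <= (nhalf_in (M n) i)%:R.
Proof.
move=> [c [C [c0 _ h]]] [c' [C' [c'0 _ h']]].
exists (Num.min 1 (Num.min c' (c * c'))); split.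
  by rewrite !lt_min ltr01 c'0 mulr_gt0 //= ge_min lexx.
apply: filterS2 h h' => n /andP[h1 _] /andP[h2 _] i.
have N0 : 0 < (nhalf (M n))%:R :> R by rewrite nhalf_gt0.
have t0 : 0 < (nhalf_in (M n) true)%:R :> R by rewrite ltr0n nhalf_in_gt0.
rewrite ler_pdivlMr // in h1; rewrite ler_pdivlMr // in h2.
case: i.
  by apply: le_trans h2; rewrite ler_wpM2r // !ge_min lexx orbT.
apply: le_trans h1; apply: (@le_trans _ _ (c * c' * (nhalf (M n))%:R)).
  by rewrite ler_wpM2r // !ge_min lexx !orbT.
by rewrite -mulrA ler_wpM2l // ltW.
Qed.

End Sequences.

(** * Constants fixed before the sequence *)

Section Constants.
Variable R : realType.

(** The default value 1 keeps the constant positive outside the range where it is used. *)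
Definition lower_constant (eps r : R) : R :=
  if (0 < 1 - r - eps) && (0 < Num.min r (1 - r)) then (1 - r - eps) / flat (Num.min r (1 - r)) else 1.

(* The expansion constant is only known for each lower bound on the fraction of
   half-edges in a community, so [r] is rounded to a grid meeting each compact
   subset of (0, 1) in finitely many points. *)
Definition grid (r : R) : nat := Num.truncn (Num.min r (1 - r))^-1.

(** A grid value [j] stands for the balance bound 1/(j + 1). Outside 0 < eps < 1 the value 1 is
    arbitrary. *)
Lemma upper_constant_exists (j : nat) (eps k : R) : exists b : R, 0 < b /\ (0 < eps < 1 ->
  forall (delta : R) Delta, 0 < delta -> exists a1 Y1 : R, 0 < a1 /\
    forall M, regime j.+1%:R^-1 Delta (`|k| + 1) a1 Y1 M -> forall x : half_edge M,
      prob R (fun eta : {perm half_edge M} => ~~ (tmix_from eta x eps <= (b / alpha R M)%:E)%E) <= delta).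
Proof.
case: (boolP (0 < eps < 1)) => he; last by exists 1; split.
have j01 : 0 < (j.+1%:R^-1 : R) <= 1 by rewrite invr_gt0 ltr0n invf_le1 ?ltr0n // ler1n.
have k0 : 0 < `|k| + 1 by rewrite ltr_wpDl.
by have [b [b0 h]] := upper_regime j01 he k0; exists b.
Qed.

Definition upper_constant (eps r k : R) : R := sval (cid (upper_constant_exists (grid r) eps k)).

Lemma upper_constantP (eps r k : R) : 0 < upper_constant eps r k /\ (0 < eps < 1 ->
  forall (delta : R) Delta, 0 < delta -> exists a1 Y1 : R, 0 < a1 /\
    forall M, regime (grid r).+1%:R^-1 Delta (`|k| + 1) a1 Y1 M -> forall x : half_edge M,
      prob R (fun eta : {perm half_edge M} =>
        ~~ (tmix_from eta x eps <= (upper_constant eps r k / alpha R M)%:E)%E) <= delta).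
Proof. by rewrite /upper_constant; case: cid. Qed.

Lemma lower_constant_gt0 (eps r : R) : 0 < lower_constant eps r.
Proof.
rewrite /lower_constant; case: ifP => // /andP[h1 h2].
by rewrite divr_gt0 // /flat divr_gt0 // exprn_gt0.
Qed.

End Constants.

(** * Error terms along a sequence of graphs *)

Section MixingTimeBounds.
Variables (R : realType) (M : nat -> two_community).
Hypothesis degree_ge3 : forall n (v : vertex (M n)), (3 <= degree v)%N.
Local Notation al n := (alpha R (M n)).
Variables (rho C : R) (Delta : nat).
Hypothesis rho01 : 0 < rho <= 1.
Hypothesis near_regime : forall a1 Y1 : R, 0 < a1 ->
  \forall n \near \oo, regime rho Delta C a1 Y1 (M n).
Variables (i : bool) (x : forall n, half_edge (M n)) (eps : R).
Hypothesis x_in : forall n, community (tag (x n)) = i.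
Hypothesis eps_gt0 : 0 < eps.
Hypothesis eps_lt : forall n, eps < (nhalf_in (M n) (~~ i))%:R / (nhalf (M n))%:R.
Local Notation r n := ((nhalf_in (M n) i)%:R / (nhalf (M n))%:R : R).
Local Notation a n := (lower_constant eps (r n)).

Lemma lower_constantE n : a n = (1 - r n - eps) / flat (Num.min (r n) (1 - r n)).
Proof.
have [/andP[h _] _] := balanced_fraction (@degree_ge3 n) (erefl (r n)).
rewrite /lower_constant h andbT ifT // subr_gt0.
by rewrite (fraction_compl (@degree_ge3 n) (erefl (r n))).
Qed.

Lemma tmix_from_ge0 n (eta : {perm half_edge (M n)}) : (0 <= tmix_from eta (x n) eps)%E.
Proof. by apply: tmix_from_ge => t; rewrite ltNge ler0n. Qed.

(** The error is zero when the bound holds and the exact deficit otherwise, so the inequality is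
    true for every pairing and only the smallness is probabilistic. In the second case the mixing
    time is finite and [fine] loses nothing. *)
Definition lower_error n (eta : {perm half_edge (M n)}) : \bar R :=
  if ((a n / al n)%:E <= tmix_from eta (x n) eps)%E then 0%E
  else (fine (tmix_from eta (x n) eps) * al n - a n)%:E.

Lemma lower_error_le n (eta : {perm half_edge (M n)}) :
  (((a n)%:E + lower_error eta) / (al n)%:E <= tmix_from eta (x n) eps)%E.
Proof.
have al0 := alpha_gt0 R (@degree_ge3 n).
rewrite /lower_error; case: ifP => h.
  by rewrite adde0 inver gt_eqF // -EFinM.
have := tmix_from_ge0 eta; move: h; case: (tmix_from _ _ _) => [u| |] //.
  by move=> _ _; rewrite -EFinD inver gt_eqF // -EFinM lee_fin addrC subrK mulfK // gt_eqF.
by rewrite leey.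
Qed.

Lemma lower_error_small : oP1 (M := M) lower_error.
Proof.
move=> delta d0; apply: cvg0_of_le => [n|e e0]; first exact: prob_ge0.
pose d := Num.min delta e; have dd0 : 0 < d by rewrite lt_min d0.
have [a1 [Y1 [a10 h]]] := lower_regime C Delta rho01 dd0.
apply: filterS (near_regime Y1 a10) => n /h {}h.
apply: le_trans (_ : d <= e); last by rewrite ge_min lexx orbT.
apply: le_trans (h i (x n) eps (x_in n) (r n) erefl); apply: prob_le => eta _.
have al0 := alpha_gt0 R (@degree_ge3 n).
rewrite -lower_constantE /lower_error; case: ifP => ha.
  by rewrite abse0 lte_fin ltNge (ltW d0).
rewrite -ltNge; move: ha => /negbT; rewrite -ltNge; have := tmix_from_ge0 eta.
case: (tmix_from _ _ _) => [u| |] //; rewrite !lte_fin /= => u0.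
rewrite ltr_pdivlMr // => ha; rewrite ltr_pdivlMr //.
rewrite ltr0_norm ?subr_lt0 // opprB => hd.
have hde : d <= delta by rewrite ge_min lexx.
by move: hd hde; lra.
Qed.

Variable k : R.
Hypothesis near_alpha_ln : \forall n \near \oo, al n * ln (nhalf (M n))%:R <= `|k| + 1.
Local Notation b n := (upper_constant eps (r n) k).

(** On the exceptional event the mixing time may be infinite, and so is the error. *)
Definition upper_error n (eta : {perm half_edge (M n)}) : \bar R :=
  if (tmix_from eta (x n) eps <= (b n / al n)%:E)%E then 0%E else +oo%E.

Lemma upper_error_ge n (eta : {perm half_edge (M n)}) :
  (tmix_from eta (x n) eps <= ((b n)%:E + upper_error eta) / (al n)%:E)%E.
Proof.
have al0 := alpha_gt0 R (@degree_ge3 n).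
rewrite /upper_error; case: ifP => h; rewrite inver gt_eqF //.
  by rewrite adde0 -EFinM.
by rewrite addey // mulyr gtr0_sg ?invr_gt0 // mul1e leey.
Qed.

Lemma near_grid : \forall n \near \oo, (grid (r n) <= Num.truncn rho^-1)%N.
Proof.
apply: filterS (near_regime 0 ltr01) => n [_ hb _ _ _].
have [/andP[m0 _] _] := balanced_fraction (@degree_ge3 n) (erefl (r n)).
have /andP[rho0 _] := rho01.
have N0 : 0 < (nhalf (M n))%:R :> R by rewrite nhalf_gt0.
apply: le_truncn; rewrite lef_pV2 ?posrE // le_min.
by rewrite (fraction_compl (@degree_ge3 n) (erefl (r n))) !ler_pdivlMr // !hb.
Qed.

Lemma upper_error_small : oP1 (M := M) upper_error.
Proof.
move=> delta d0; apply: cvg0_of_le => [n|e e0]; first exact: prob_ge0.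
have eps1 : eps < 1.
  apply: lt_le_trans (eps_lt 0%N) _; rewrite ler_pdivrMr ?nhalf_gt0 // mul1r ler_nat /nhalf.
  by case: (i); rewrite ?leq_addl ?leq_addr.
have eps01 : 0 < eps < 1 by rewrite eps_gt0.
(* The thresholds of [upper_constantP] depend on the grid value, so each value is treated apart;
   eventually only finitely many of them occur. *)
pose P j n := grid (r n) = j -> prob R (fun eta => (delta%:E < `|upper_error (n := n) eta|)%E) <= e.
have hP j : \forall n \near \oo, P j n.
  have [ex|nex] := pselect (exists n, grid (r n) = j); last first.
    by exists 0%N => // n _ h; case: nex; exists n.
  have [n1 hn1] := ex.
  have [_ /(_ eps01 e Delta e0) [a1 [Y1 [a10 h]]]] := upper_constantP eps (r n1) k.
  apply: filterS2 (near_regime Y1 a10) near_alpha_ln => n [h1 _ h3 h4 _] h5 hj.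
  have [/andP[m0 _] hbal] := balanced_fraction (@degree_ge3 n) (erefl (r n)).
  have hreg : regime (grid (r n1)).+1%:R^-1 Delta (`|k| + 1) a1 Y1 (M n).
    split=> // c; apply: le_trans (hbal c); rewrite ler_wpM2r // hn1 -hj.
    rewrite -[leRHS]invrK lef_pV2 ?posrE ?invr_gt0 // ltW //.
    have m0' : 0 <= (Num.min (r n) (1 - r n))^-1 by rewrite invr_ge0 ltW.
    by have /andP[_] := truncn_itv m0'.
  apply: le_trans (h _ hreg (x n)); apply: prob_le => eta _.
  have -> : upper_constant eps (r n1) k = b n.
    by rewrite /upper_constant hn1 hj.
  rewrite /upper_error; case: ifP => // _.
  by rewrite abse0 lte_fin ltNge (ltW d0).
apply: filterS2 (near_upto hP (Num.truncn rho^-1)) near_grid => n hn hg.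
exact: hn _ hg erefl.
Qed.

End MixingTimeBounds.

(** Cutoff would make the probability that the ratio differs from 1 by more than 1/2 tend to 0,
    whereas it stays at least 1/2. *)
Lemma no_cutoff (R : realType) (M : nat -> two_community) (rho C : R) (Delta : nat) :
  0 < rho <= 1 -> 0 < C ->
  (forall a1 Y1 : R, 0 < a1 -> \forall n \near \oo, regime rho Delta C a1 Y1 (M n)) -> ~ cutoff R M.
Proof.
move=> r01 C0 hreg hcut; have [eps [a1 [Y1 [e01 a10 h]]]] := cutoff_regime Delta r01 C0.
have h2 : (0 : R) < 1 / 2 by rewrite divr_gt0.
have h4 : (0 : R) < 1 / 4 by rewrite divr_gt0.
have := cvgr_le _ (hcut eps e01 _ h2) _ h4.
move=> /(_ _) hc; have [n [/h h1 h3]] := filter_ex (filterI (hreg a1 Y1 a10) hc).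
by have := le_trans h1 h3; lra.
Qed.

Theorem theorem1p2 (R : realType) :
  exists (a : R -> R -> R) (b : R -> R -> R -> R),
    (forall eps r : R, 0 < a eps r) /\
    (forall eps r k : R, 0 < b eps r k) /\
    forall M : nat -> two_community,
      ((nhalf (M n))%:R : R) @[n --> \oo] --> +oo ->
      (* (A1) *)
      (forall n, alpha_in R (M n) false + alpha_in R (M n) true <= 1) ->
      (* (A2) *)
      same_order (fun n => (nhalf_in (M n) false)%:R : R)
                 (fun n => (nhalf_in (M n) true)%:R) ->
      same_order (fun n => (nhalf_in (M n) true)%:R : R)
                 (fun n => (nhalf (M n))%:R) ->
      (* (A3) *)
      (0 < limn_einf (fun n => (sigma2 R (M n))%:E))%E ->
      (* (A4) *)
      (forall n (v : vertex (M n)), (3 <= degree v)%N) ->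
      (* (A5) *)
      (exists D : nat, forall n, (max_degree (M n) <= D)%N) ->
      much_less (fun n => alpha R (M n)) (fun n => 1 / ln (nhalf (M n))%:R) \/
      same_order (fun n => alpha R (M n)) (fun n => 1 / ln (nhalf (M n))%:R) ->
      (forall (i : bool) (x : forall n, half_edge (M n)),
        (forall n, x n \in half_edges_in (M n) i) ->
        forall eps : R, 0 < eps ->
        (forall n, eps < (nhalf_in (M n) (~~ i))%:R / (nhalf (M n))%:R) ->
        exists xi zeta : forall n, {perm half_edge (M n)} -> \bar R,
          oP1 xi /\ oP1 zeta /\
          forall n (eta : {perm half_edge (M n)}),
            let r : R := (nhalf_in (M n) i)%:R / (nhalf (M n))%:R in
            let k : R := limn_sup (fun m => alpha R (M m) * ln (nhalf (M m))%:R) in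
            (((a eps r)%:E + xi n eta) / (alpha R (M n))%:E
               <= tmix_from eta (x n) eps)%E /\
            (tmix_from eta (x n) eps
               <= ((b eps r k)%:E + zeta n eta) / (alpha R (M n))%:E)%E) /\
      ~ cutoff R M.
Proof.
exists (@lower_constant R), (@upper_constant R).
split; first exact: lower_constant_gt0.
split=> [eps r k|]; first by case: (upper_constantP eps r k).
move=> M hN _ hA2 hA2' _ hd [D hD] hal.
have [C [C0 hC]] := alpha_ln_bounded hal.
have [rho [rho01 hb]] := near_balanced hA2 hA2'.
have hreg a1 Y1 : 0 < a1 -> \forall n \near \oo, regime rho D C a1 Y1 (M n).
  move=> a10; apply: filterS3 (filterI hb hC) (near_alpha_le hN a10 hC) (near_ln_ge hN Y1).
  move=> n [h1 h2] h3 h4; split=> // v; rewrite hd /=.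
  by apply: leq_trans (hD n); apply: leq_bigmax.
split; last exact: no_cutoff rho01 C0 hreg.
move=> i x hx eps e0 he; set k := limn_sup _.
have hk : \forall n \near \oo, alpha R (M n) * ln (nhalf (M n))%:R <= `|k| + 1.
  apply: eventually_le_limn_sup hC => n.
  apply: mulr_ge0; first exact/ltW/alpha_gt0.
  by rewrite ln_ge0 // ler1n -(ltr_nat R) nhalf_gt0.
have hx' n : community (tag (x n)) = i by have := hx n; rewrite inE => /eqP.
exists (@lower_error R M i x eps), (@upper_error R M i x eps k).
split; first exact: (lower_error_small hd rho01 hreg hx' he).
split; first exact: (upper_error_small hd rho01 hreg x e0 he hk).
move=> n eta /=; split; first exact: (lower_error_le hd).
exact: (upper_error_ge hd i x eps k eta).
Qed.
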